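(* Let $s:\mathbb{C}\to\mathbb{P}^1$ be a meromorphic function. If there is a complete holomorphic vector field $X$ on $\mathbb{C}^2$ which is tangent to $\mathrm{graph}(s)$ and has at most isolated zeros on $\mathrm{graph}(s)$, then $s$ has at most one pole. Moreover, let $C_z$ be the (non-constant) trajectory of $X$ contained in $\mathrm{graph}(s)$. Then: - If $s$ is entire (no poles), $C_z$ is of type $\mathbb{C}$ or $\mathbb{C}^*$, being $C_z$ respectively equal to $\mathrm{graph}(s)$ or to $\mathrm{graph}(s)\setminus\{p\}$, where $p$ is the unique zero of $X$ on $\mathrm{graph}(s)$. - If $s$ has exactly one pole, $C_z$ is equal to $\mathrm{graph}(s)$ and of type $\mathbb{C}^*$.
   Context: $\mathrm{graph}(s)\subset\mathbb{C}^2$ is $\{(z,s(z)): s(z)\neq\infty\}$. A vector field is tangent to a curve $C$ if $X(p)\in T_pC$ at each smooth point $p$ of $C$ ($X(p)=0$ allowed). A holomorphic vector field is complete if its solutions are defined for all complex times. The trajectory of $X$ through a point is the image of its maximal solution through that point; it is of type $\mathbb{C}$ (resp. $\mathbb{C}^*$) if it is isomorphic to $\mathbb{C}$ (resp. $\mathbb{C}^*$) as a Riemann surface. *)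

(* Defs.v *)
From Stdlib Require Import Reals.
From Coquelicot Require Import Coquelicot.

(* Derivatives and differentials are taken over
   the scalars [C_AbsRing], so "differentiable" means complex differentiable. *)

Definition C2 : NormedModule C_AbsRing :=
  prod_NormedModule C_AbsRing C_NormedModule C_NormedModule.

Definition set_eq {T : Type} (A B : T -> Prop) : Prop := forall x, A x <-> B x.

(** * Meromorphic functions *)

Inductive P1 : Type := Fin (w : C) | Inf.

(* The affine coordinate w, used only off [Inf]. *)
Definition P1_coord (x : P1) : C :=
  match x with Fin w => w | Inf => 0%C end.

(* The coordinate 1/w at infinity, used only off [Fin 0]. *)
Definition P1_coord_inf (x : P1) : C :=
  match x with Fin w => (/ w)%C | Inf => 0%C end.

Definition P1_holomorphic_at (s : C -> P1) (a : C) : Prop :=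
  locally (T := C_UniformSpace) a (fun z =>
    s z <> Inf /\
    ex_derive (K := C_AbsRing) (V := C_NormedModule)
      (fun z' => P1_coord (s z')) z)
  \/
  locally (T := C_UniformSpace) a (fun z =>
    s z <> Fin 0%C /\
    ex_derive (K := C_AbsRing) (V := C_NormedModule)
      (fun z' => P1_coord_inf (s z')) z).

(* A holomorphic map to P1 other than the constant infinity. *)
Definition meromorphic (s : C -> P1) : Prop :=
  (forall a, P1_holomorphic_at s a) /\ exists a, s a <> Inf.

Definition pole (s : C -> P1) (a : C) : Prop := s a = Inf.

Definition graph (s : C -> P1) (p : C2) : Prop := s (fst p) = Fin (snd p).

(** * Plane curves and tangency *)

Definition holomorphic_near (f : C2 -> C) (p : C2) : Prop :=
  locally p (fun q => ex_filterdiff (V := C_NormedModule) f (locally q)).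

(* Near p, Gamma is the zero set of a holomorphic f with df_p <> 0. *)
Definition smooth_point (Gamma : C2 -> Prop) (p : C2) : Prop :=
  Gamma p /\
  exists (f : C2 -> C) (df : C2 -> C),
    holomorphic_near f p /\
    locally p (fun q => Gamma q <-> f q = 0%C) /\
    filterdiff (V := C_NormedModule) f (locally p) df /\
    exists v, df v <> 0%C.

(* The vectors killed by df_p for every holomorphic germ f at p that vanishes
   on Gamma. *)
Definition tangent_space (Gamma : C2 -> Prop) (p v : C2) : Prop :=
  forall (f : C2 -> C) (df : C2 -> C),
    holomorphic_near f p ->
    locally p (fun q => Gamma q -> f q = 0%C) ->
    filterdiff (V := C_NormedModule) f (locally p) df ->
    df v = 0%C.

(** * Vector fields *)

Definition holomorphic_field (X : C2 -> C2) : Prop :=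
  forall p, ex_filterdiff X (locally p).

Definition tangent_to (X : C2 -> C2) (Gamma : C2 -> Prop) : Prop :=
  forall p, smooth_point Gamma p -> tangent_space Gamma p (X p).

Definition isolated_zeros_on (X : C2 -> C2) (Gamma : C2 -> Prop) : Prop :=
  forall p, Gamma p -> X p = zero ->
    locally p (fun q => Gamma q -> X q = zero -> q = p).

Definition solution_on (U : C -> Prop) (X : C2 -> C2) (phi : C -> C2) : Prop :=
  forall t, U t -> is_derive (K := C_AbsRing) (V := C2) phi t (X (phi t)).

Definition entire_solution (X : C2 -> C2) (phi : C -> C2) : Prop :=
  solution_on (fun _ => True) X phi.

Definition complete_field (X : C2 -> C2) : Prop :=
  forall p, exists phi, entire_solution X phi /\ phi 0%C = p.

(* Meant for complete X, where the maximal solution through p is the entire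
   solution with phi 0 = p. *)
Definition trajectory (X : C2 -> C2) (p q : C2) : Prop :=
  exists phi t, entire_solution X phi /\ phi 0%C = p /\ phi t = q.

Definition nonconstant_trajectory (X : C2 -> C2) (T : C2 -> Prop) : Prop :=
  (exists p, set_eq T (trajectory X p)) /\ (exists p q, T p /\ T q /\ p <> q).

(** * Riemann surface structures *)

(* A Riemann surface structure is given by its local holomorphic
   parametrizations: [A U phi] says that phi, restricted to the open set
   U of C, is an inverse chart. *)
Definition atlas (T : Type) : Type := (C -> Prop) -> (C -> T) -> Prop.

Definition points {T : Type} (A : atlas T) (x : T) : Prop :=
  exists U phi u, A U phi /\ U u /\ phi u = x.

(* f reads as a holomorphic g in charts; in particular it maps points of A to
   points of B. *)
Definition holomorphic_map {S T : Type} (A : atlas S) (B : atlas T)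
    (f : S -> T) : Prop :=
  forall U phi u, A U phi -> U u ->
  exists (V : C -> Prop) (psi : C -> T) (g : C -> C),
    B V psi /\
    locally (T := C_UniformSpace) u (fun u' =>
      V (g u') /\
      ex_derive (K := C_AbsRing) (V := C_NormedModule) g u' /\
      f (phi u') = psi (g u')).

Definition isomorphic {S T : Type} (A : atlas S) (B : atlas T) : Prop :=
  exists (f : S -> T) (g : T -> S),
    holomorphic_map A B f /\ holomorphic_map B A g /\
    (forall x, points A x -> g (f x) = x) /\
    (forall y, points B y -> f (g y) = y).

Definition domain_atlas (M : C -> Prop) : atlas C := fun U phi =>
  open (T := C_UniformSpace) U /\ forall u, U u -> M u /\ phi u = u.

(* A non-constant trajectory is locally parametrized by complex time. *)
Definition trajectory_atlas (X : C2 -> C2) (T : C2 -> Prop) : atlas C2 :=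
  fun U phi =>
  open (T := C_UniformSpace) U /\
  (forall u, U u -> T (phi u)) /\
  solution_on U X phi /\
  (forall u v, U u -> U v -> phi u = phi v -> u = v).

Definition type_C (X : C2 -> C2) (T : C2 -> Prop) : Prop :=
  isomorphic (trajectory_atlas X T) (domain_atlas (fun _ => True)).

Definition type_Cstar (X : C2 -> C2) (T : C2 -> Prop) : Prop :=
  isomorphic (trajectory_atlas X T) (domain_atlas (fun z => z <> 0%C)).

(* Main.v *)
Require Import Defs.
From Stdlib Require Import Reals Lra Lia Classical ClassicalEpsilon.
From Coquelicot Require Import Coquelicot.
Local Open Scope R_scope.

(* Writing S for the coordinate of s and h z for the first component of X at
   (z, S z), tangency makes X at (z, S z) equal to h(z) (1, S'(z)), and by uniqueness
   and completeness the flow of X restricts to a complete flow of z' = h(z) on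
   O = {z : z is not a pole and h z <> 0}. As O is connected, it is a single orbit x(C),
   a quotient of C by the group of periods of x. If the group is trivial this
   quotient has one end, if it lies on a real line it has two, and otherwise the
   quotient is compact. Two points outside O would, with infinity, give O at
   least three ends; so O is C or C minus a point, and the trajectory is isomorphic to
   O through the first coordinate. This counting of ends replaces Picard's theorem.
   Since differentials are only assumed to exist pointwise, the regularity this needs
   (Lipschitz bounds, isolated zeros, local primitives of 1/h) comes from Goursat's
   theorem and Cauchy's formula on squares. *)

(** * Complex differentiability *)

(** Poles of s and zeros of X on the graph are treated alike, as points outside O. That at most one
    point lies outside O yields at once that the pole is unique, that X has at most one zero on the
    graph, and that it has none when there is a pole. The obstacle is that nothing controls X near a
    pole of s, where the graph runs off to infinity, so the ends are counted through the flow alone: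
    a connected set of times lying outside a large box, or outside a strip when there are periods,
    cannot cross the boundary of a small square around a missing point, so it either stays in that
    square or never enters it. Completeness supplies the global curves, and the finite second
    coordinate of an entire solution prevents it from leaving the graph through a pole, where s
    blows up. A primitive T of 1/h is a local inverse of the flow; it gives uniqueness of integral
    curves, openness of orbits and the charts of the trajectory. *)

(** Neighbourhoods are taken in the modulus, which suits the estimates; [near_iff_osquare] and
    [locally_near] translate to the square balls of [C_UniformSpace]. *)
Definition near (z : C) (P : C -> Prop) : Prop :=
  exists d, 0 < d /\ forall w, Cmod (w - z) < d -> P w.

Definition cont (f : C -> C) (z : C) : Prop :=
  forall e, 0 < e -> near z (fun w => Cmod (f w - f z) < e).

(** The bound is non-strict, so that w = z needs no exception; it is the domination condition inside
    [is_derive]. *)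
Definition deriv (f : C -> C) (z l : C) : Prop :=
  forall e, 0 < e ->
  near z (fun w => Cmod (f w - f z - l * (w - z)) <= e * Cmod (w - z)).

Definition hol (f : C -> C) (z : C) : Prop := exists l, deriv f z l.

Lemma Cmod_sub_self z : Cmod (z - z) = 0.
Proof. replace (z - z)%C with (RtoC 0) by ring. apply Cmod_0. Qed.

Lemma Cmod_sub_sym z w : Cmod (z - w) = Cmod (w - z).
Proof. rewrite <- Cmod_opp. f_equal. ring. Qed.

Lemma Cmod_sub_triangle x y z : Cmod (x - z) <= Cmod (x - y) + Cmod (y - z).
Proof.
  replace (x - z)%C with ((x - y) + (y - z))%C by ring. apply Cmod_triangle.
Qed.

Lemma Cmod_triangle_rev x y : Cmod x - Cmod y <= Cmod (x - y).
Proof.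
  pose proof (Cmod_triangle (x - y) y).
  replace (x - y + y)%C with x in H by ring. lra.
Qed.

Lemma Cmod_minus_le x y : Cmod (x - y) <= Cmod x + Cmod y.
Proof.
  pose proof (Cmod_triangle x (- y)). rewrite Cmod_opp in H. exact H.
Qed.

Lemma Cmod_sub_eq_0 z w : Cmod (z - w) = 0 -> z = w.
Proof.
  intros H. apply Cmod_eq_0 in H.
  replace z with ((z - w) + w)%C by ring. rewrite H. ring.
Qed.

Lemma Cmod_sub_gt_0 z w : z <> w -> 0 < Cmod (z - w).
Proof.
  intros H. destruct (Cmod_ge_0 (z - w)) as [h|h]; [exact h|].
  exfalso. apply H, Cmod_sub_eq_0. auto.
Qed.

Lemma Csub_neq_0 (z w : C) : z <> w -> (z - w)%C <> 0%C.
Proof. intros H. apply Cmod_gt_0, Cmod_sub_gt_0, H. Qed.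

Lemma Csub_eq_0 (z w : C) : (z - w)%C = 0%C -> z = w.
Proof. intros H. apply Cmod_sub_eq_0. rewrite H. apply Cmod_0. Qed.

Lemma near_and z (P Q : C -> Prop) :
  near z P -> near z Q -> near z (fun w => P w /\ Q w).
Proof.
  intros (d & hd & H) (d' & hd' & H').
  exists (Rmin d d'). split; [apply Rmin_glb_lt; assumption|].
  intros w hw. pose proof (Rmin_l d d'). pose proof (Rmin_r d d').
  split; [apply H|apply H']; lra.
Qed.

Lemma near_imp z (P Q : C -> Prop) :
  (forall w, P w -> Q w) -> near z P -> near z Q.
Proof. intros h (d & hd & H). exists d. split; auto. Qed.

Lemma near_self z (P : C -> Prop) : near z P -> P z.
Proof. intros (d & hd & H). apply H. rewrite Cmod_sub_self. exact hd. Qed.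

Lemma near_true z (P : C -> Prop) : (forall w, P w) -> near z P.
Proof. intros H. exists 1. split; [lra|auto]. Qed.

Lemma near_ball z d : 0 < d -> near z (fun w => Cmod (w - z) < d).
Proof. intros H. exists d. auto. Qed.

Lemma near_near z (P : C -> Prop) : near z P -> near z (fun w => near w P).
Proof.
  intros (d & hd & H). exists (d / 2). split; [lra|].
  intros w hw. exists (d / 2). split; [lra|]. intros v hv. apply H.
  pose proof (Cmod_sub_triangle v w z). lra.
Qed.

Lemma near_neq z w : z <> w -> near z (fun v => v <> w).
Proof.
  intros H. exists (Cmod (z - w)). split; [apply Cmod_sub_gt_0, H|].
  intros v hv E. subst v. rewrite Cmod_sub_sym in hv. lra.
Qed.

Lemma cont_near f z (P : C -> Prop) :
  cont f z -> near (f z) P -> near z (fun w => P (f w)).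
Proof.
  intros hf (d & hd & H). apply (near_imp z _ _ (fun w => H (f w))), hf, hd.
Qed.

Lemma cont_neq f z w : cont f z -> f z <> w -> near z (fun v => f v <> w).
Proof.
  intros hf H. apply (cont_near f z (fun y => y <> w) hf), near_neq, H.
Qed.

Lemma cont_bounded f z : cont f z -> near z (fun w => Cmod (f w) < Cmod (f z) + 1).
Proof.
  intros hf. apply (near_imp z (fun w => Cmod (f w - f z) < 1)).
  - intros w hw. pose proof (Cmod_triangle_rev (f w) (f z)). lra.
  - apply hf. lra.
Qed.

Lemma cont_ext f g z : near z (fun w => f w = g w) -> cont f z -> cont g z.
Proof.
  intros h hf e he. pose proof (near_self _ _ h) as h0.
  apply (near_imp z (fun w => f w = g w /\ Cmod (f w - f z) < e)).
  - intros w [E H]. rewrite <- E, <- h0. exact H.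
  - apply near_and; auto.
Qed.

Lemma cont_const k z : cont (fun _ => k) z.
Proof. intros e he. apply near_true. intros w. rewrite Cmod_sub_self. exact he. Qed.

Lemma cont_id z : cont (fun w => w) z.
Proof. intros e he. exists e. auto. Qed.

Lemma cont_plus f g z : cont f z -> cont g z -> cont (fun w => f w + g w)%C z.
Proof.
  intros hf hg e he.
  refine (near_imp z _ _ _ (near_and _ _ _ (hf (e/2) _) (hg (e/2) _))); [|lra|lra].
  intros w [H1 H2].
  replace (f w + g w - (f z + g z))%C with ((f w - f z) + (g w - g z))%C by ring.
  pose proof (Cmod_triangle (f w - f z) (g w - g z)). lra.
Qed.

Lemma cont_mult f g z : cont f z -> cont g z -> cont (fun w => f w * g w)%C z.
Proof.
  intros hf hg e he.
  pose proof (Cmod_ge_0 (f z)) as Hf. pose proof (Cmod_ge_0 (g z)) as Hg.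
  set (M := Cmod (f z) + Cmod (g z) + 1).
  assert (hM : 0 < M) by (unfold M; lra).
  assert (he' : 0 < Rmin 1 (e / (2 * M))).
  { apply Rmin_glb_lt; [lra|]. apply Rdiv_lt_0_compat; lra. }
  refine (near_imp z _ _ _ (near_and _ _ _ (hf _ he') (hg _ he'))).
  intros w [H1 H2].
  replace (f w * g w - f z * g z)%C
    with ((f w - f z) * g w + f z * (g w - g z))%C by ring.
  eapply Rle_lt_trans; [apply Cmod_triangle|]. rewrite !Cmod_mult.
  pose proof (Rmin_l 1 (e / (2 * M))). pose proof (Rmin_r 1 (e / (2 * M))).
  assert (hgw : Cmod (g w) <= M).
  { pose proof (Cmod_triangle_rev (g w) (g z)). unfold M. lra. }
  assert (E : e = e / (2 * M) * M + M * (e / (2 * M))) by (field; lra).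
  rewrite E.
  assert (0 <= Cmod (f w - f z)) by apply Cmod_ge_0.
  assert (0 <= Cmod (g w - g z)) by apply Cmod_ge_0.
  assert (Cmod (f z) <= M) by (unfold M; lra).
  assert (Cmod (f w - f z) * Cmod (g w) <= Cmod (f w - f z) * M)
    by (apply Rmult_le_compat_l; lra).
  assert (Cmod (f w - f z) * M < e / (2 * M) * M)
    by (apply Rmult_lt_compat_r; lra).
  assert (Cmod (f z) * Cmod (g w - g z) <= M * Cmod (g w - g z))
    by (apply Rmult_le_compat_r; lra).
  assert (M * Cmod (g w - g z) <= M * (e / (2 * M)))
    by (apply Rmult_le_compat_l; lra).
  lra.
Qed.

Lemma cont_comp f g z : cont g z -> cont f (g z) -> cont (fun w => f (g w)) z.
Proof.
  intros hg hf e he. apply (cont_near g z (fun y => Cmod (f y - f (g z)) < e) hg), hf, he.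
Qed.

Lemma Cinv_sub (z w : C) : z <> 0%C -> w <> 0%C ->
  (/ w - / z = - (w - z) * (/ z * / w))%C.
Proof. intros. field. auto. Qed.

Lemma near_Cmod_ge_half f z : cont f z -> f z <> 0%C ->
  near z (fun w => Cmod (f z) / 2 < Cmod (f w)).
Proof.
  intros hf H. apply Cmod_gt_0 in H.
  apply (near_imp z (fun w => Cmod (f w - f z) < Cmod (f z) / 2)).
  - intros w hw. pose proof (Cmod_triangle_rev (f z) (f w)).
    rewrite (Cmod_sub_sym (f z)) in H0. lra.
  - apply hf. lra.
Qed.

Lemma deriv_cont f z l : deriv f z l -> cont f z.
Proof.
  intros hf e he. pose proof (Cmod_ge_0 l) as Hl.
  assert (hd : 0 < e / (Cmod l + 2)) by (apply Rdiv_lt_0_compat; lra).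
  refine (near_imp z _ _ _ (near_and _ _ _ (hf 1 _) (near_ball z _ hd))); [|lra].
  intros w [H1 H2].
  replace (f w - f z)%C with ((f w - f z - l * (w - z)) + l * (w - z))%C by ring.
  eapply Rle_lt_trans; [apply Cmod_triangle|]. rewrite Cmod_mult.
  pose proof (Cmod_ge_0 (w - z)).
  assert (Cmod (w - z) * (Cmod l + 2) < e).
  { apply (Rmult_lt_compat_r (Cmod l + 2)) in H2; [|lra].
    replace (e / (Cmod l + 2) * (Cmod l + 2)) with e in H2 by (field; lra). lra. }
  nra.
Qed.

Lemma hol_cont f z : hol f z -> cont f z.
Proof. intros [l H]. apply (deriv_cont _ _ _ H). Qed.

Lemma deriv_ext f g z l : near z (fun w => f w = g w) -> deriv f z l -> deriv g z l.
Proof.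
  intros h hf e he. pose proof (near_self _ _ h) as h0. simpl in h0.
  refine (near_imp z _ _ _ (near_and _ _ _ h (hf e he))).
  intros w [E H]. rewrite <- E, <- h0. exact H.
Qed.

Lemma hol_ext f g z : near z (fun w => f w = g w) -> hol f z -> hol g z.
Proof. intros h [l H]. exists l. apply (deriv_ext f); assumption. Qed.

Lemma deriv_const k z : deriv (fun _ => k) z 0.
Proof.
  intros e he. apply near_true. intros w.
  replace (k - k - 0 * (w - z))%C with (RtoC 0) by ring.
  rewrite Cmod_0. apply Rmult_le_pos; [lra|apply Cmod_ge_0].
Qed.

Lemma deriv_id z : deriv (fun w => w) z 1.
Proof.
  intros e he. apply near_true. intros w.
  replace (w - z - 1 * (w - z))%C with (RtoC 0) by ring.
  rewrite Cmod_0. apply Rmult_le_pos; [lra|apply Cmod_ge_0].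
Qed.

Lemma deriv_plus f g z l m :
  deriv f z l -> deriv g z m -> deriv (fun w => f w + g w)%C z (l + m).
Proof.
  intros hf hg e he.
  refine (near_imp z _ _ _ (near_and _ _ _ (hf (e/2) _) (hg (e/2) _))); [|lra|lra].
  intros w [H1 H2].
  replace (f w + g w - (f z + g z) - (l + m) * (w - z))%C
    with ((f w - f z - l * (w - z)) + (g w - g z - m * (w - z)))%C by ring.
  eapply Rle_trans; [apply Cmod_triangle|]. lra.
Qed.

(* Differentiability at z amounts to a factorisation f w - f z = q w (w - z)
   with q continuous at z, which turns the chain, product and quotient rules into
   statements about continuous functions. *)
Lemma deriv_slope f z l :
  deriv f z l <->
  exists q, cont q z /\ q z = l /\ forall w, (f w = f z + q w * (w - z))%C.
Proof.
  split.
  - intros hf.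
    exists (fun w => if excluded_middle_informative (w = z) then l
                     else ((f w - f z) / (w - z))%C).
    destruct (excluded_middle_informative (z = z)) as [D0|n] eqn:D; [|exfalso; exact (n eq_refl)].
    split; [|split].
    + intros e he. rewrite D.
      refine (near_imp z _ _ _ (hf (e/2) _)); [|lra].
      intros w hw. destruct (excluded_middle_informative (w = z)) as [E|N].
      * rewrite Cmod_sub_self. exact he.
      * pose proof (Csub_neq_0 _ _ N) as N'.
        replace ((f w - f z) / (w - z) - l)%C
          with ((f w - f z - l * (w - z)) / (w - z))%C by (field; exact N').
        rewrite Cmod_div by exact N'.
        pose proof (Cmod_sub_gt_0 _ _ N).
        apply Rle_lt_trans with (e / 2); [|lra].
        apply Rle_div_l; lra.
    + reflexivity.
    + intros w. destruct (excluded_middle_informative (w = z)) as [E|N].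
      * subst w. ring.
      * field. apply Csub_neq_0, N.
  - intros (q & hq & E & H) e he.
    refine (near_imp z _ _ _ (hq e he)). intros w hw.
    rewrite (H w), <- E.
    replace (f z + q w * (w - z) - f z - q z * (w - z))%C
      with ((q w - q z) * (w - z))%C by ring.
    rewrite Cmod_mult. apply Rmult_le_compat_r; [apply Cmod_ge_0|lra].
Qed.

Lemma deriv_mult f g z l m : deriv f z l -> deriv g z m ->
  deriv (fun w => f w * g w)%C z (l * g z + f z * m).
Proof.
  intros hf hg. pose proof (deriv_cont _ _ _ hg) as cg.
  apply deriv_slope in hf as (q & hq & Eq & Hq).
  apply deriv_slope in hg as (p & hp & Ep & Hp).
  apply deriv_slope. exists (fun w => q w * g w + f z * p w)%C. split; [|split].
  - apply cont_plus; apply cont_mult; auto using cont_const.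
  - now rewrite Eq, Ep.
  - intros w. rewrite (Hq w), (Hp w). ring.
Qed.

Lemma deriv_comp f g z l m : deriv g z m -> deriv f (g z) l ->
  deriv (fun w => f (g w)) z (l * m).
Proof.
  intros hg hf. pose proof (deriv_cont _ _ _ hg) as cg.
  apply deriv_slope in hf as (q & hq & Eq & Hq).
  apply deriv_slope in hg as (p & hp & Ep & Hp).
  apply deriv_slope. exists (fun w => q (g w) * p w)%C. split; [|split].
  - apply cont_mult; [apply cont_comp|]; assumption.
  - now rewrite Eq, Ep.
  - intros w. rewrite (Hq (g w)). rewrite (Hp w) at 2. ring.
Qed.

Lemma cont_inv f z : cont f z -> f z <> 0%C -> cont (fun w => / f w)%C z.
Proof.
  intros hf H e he. pose proof (near_Cmod_ge_half f z hf H) as hn.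
  apply Cmod_gt_0 in H as H'. set (m := Cmod (f z)) in *.
  assert (he' : 0 < e * (m * m / 2)) by (apply Rmult_lt_0_compat; nra).
  refine (near_imp z _ _ _ (near_and _ _ _ hn (hf _ he'))).
  intros w [H1 H2].
  assert (hw : f w <> 0%C) by (apply Cmod_gt_0; lra).
  rewrite Cinv_sub by assumption.
  rewrite !Cmod_mult, Cmod_opp, !Cmod_inv by assumption. fold m.
  apply Rmult_lt_reg_r with (m * Cmod (f w)); [nra|].
  replace (Cmod (f w - f z) * (/ m * / Cmod (f w)) * (m * Cmod (f w)))
    with (Cmod (f w - f z)) by (field; lra).
  eapply Rlt_le_trans; [exact H2|]. apply Rmult_le_compat_l; nra.
Qed.

(** [deriv_slope] asks for a factorisation at every w, whereas that of 1/f, with slope -q/(f z f w),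
    is available only where f w is nonzero. The estimate is therefore made directly, near z. *)
Lemma deriv_inv f z l : deriv f z l -> f z <> 0%C ->
  deriv (fun w => / f w)%C z (- l * (/ f z * / f z)).
Proof.
  intros hf H. pose proof (deriv_cont _ _ _ hf) as cf.
  pose proof (cont_neq _ _ _ cf H) as hn.
  apply deriv_slope in hf as (q & hq & Eq & Hq).
  intros e he.
  assert (hp : cont (fun w => (- (1)) * q w * (/ f z * / f w))%C z).
  { repeat apply cont_mult; auto using cont_const. apply cont_inv; assumption. }
  refine (near_imp z _ _ _ (near_and _ _ _ hn (hp e he))). intros w [H1 H2].
  rewrite Cinv_sub by assumption.
  replace (f w - f z)%C with (q w * (w - z))%C by (rewrite (Hq w); ring).
  replace (- (q w * (w - z)) * (/ f z * / f w) - - l * (/ f z * / f z) * (w - z))%C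
   with ((- (1) * q w * (/ f z * / f w) - - (1) * q z * (/ f z * / f z)) * (w - z))%C
   by (rewrite Eq; ring).
  rewrite Cmod_mult. apply Rmult_le_compat_r; [apply Cmod_ge_0|lra].
Qed.

Lemma hol_const k z : hol (fun _ => k) z.
Proof. eexists. apply deriv_const. Qed.

Lemma hol_id z : hol (fun w => w) z.
Proof. eexists. apply deriv_id. Qed.

Lemma hol_plus f g z : hol f z -> hol g z -> hol (fun w => f w + g w)%C z.
Proof. intros [l H] [m K]. eexists. apply (deriv_plus _ _ _ _ _ H K). Qed.

Lemma hol_mult f g z : hol f z -> hol g z -> hol (fun w => f w * g w)%C z.
Proof. intros [l H] [m K]. eexists. apply (deriv_mult _ _ _ _ _ H K). Qed.

Lemma hol_inv f z : hol f z -> f z <> 0%C -> hol (fun w => / f w)%C z.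
Proof. intros [l H] K. eexists. apply (deriv_inv _ _ _ H K). Qed.

Lemma hol_comp f g z : hol g z -> hol f (g z) -> hol (fun w => f (g w)) z.
Proof. intros [l H] [m K]. eexists. apply (deriv_comp _ _ _ _ _ H K). Qed.

Lemma deriv_opp f z l : deriv f z l -> deriv (fun w => - f w)%C z (- l).
Proof.
  intros H. pose proof (deriv_mult _ _ _ _ _ (deriv_const (- (1)) z) H) as K.
  simpl in K. replace (- l)%C with (0 * f z + - (1) * l)%C by ring.
  apply (deriv_ext (fun w => - (1) * f w)%C); [|exact K].
  apply near_true. intros w. ring.
Qed.

Lemma deriv_minus f g z l m :
  deriv f z l -> deriv g z m -> deriv (fun w => f w - g w)%C z (l - m).
Proof. intros H K. apply deriv_plus; [exact H|apply deriv_opp, K]. Qed.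

Lemma hol_minus f g z : hol f z -> hol g z -> hol (fun w => f w - g w)%C z.
Proof. intros [l H] [m K]. eexists. apply (deriv_minus _ _ _ _ _ H K). Qed.

Lemma hol_div f g z :
  hol f z -> hol g z -> g z <> 0%C -> hol (fun w => f w / g w)%C z.
Proof. intros. apply hol_mult; [|apply hol_inv]; assumption. Qed.

Lemma cont_minus f g z : cont f z -> cont g z -> cont (fun w => f w - g w)%C z.
Proof.
  intros hf hg. apply (cont_ext (fun w => f w + - (1) * g w)%C).
  - apply near_true. intros w. ring.
  - apply cont_plus, cont_mult; auto using cont_const.
Qed.

Lemma cont_div f g z :
  cont f z -> cont g z -> g z <> 0%C -> cont (fun w => f w / g w)%C z.
Proof. intros. apply cont_mult; [|apply cont_inv]; assumption. Qed.

(** * Integrals along the sides of a rectangle *)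

Definition CInt (f : R -> C) (a b : R) : C :=
  (RInt (fun x => Re (f x)) a b, RInt (fun x => Im (f x)) a b).

Definition ex_CInt (f : R -> C) (a b : R) : Prop :=
  ex_RInt (fun x => Re (f x)) a b /\ ex_RInt (fun x => Im (f x)) a b.

Definition line_cont (f : R -> C) (x : R) : Prop :=
  forall e, 0 < e -> exists d, 0 < d /\
    forall y, Rabs (y - x) < d -> Cmod (f y - f x) < e.

Lemma im_le_Cmod z : Rabs (Im z) <= Cmod z.
Proof. eapply Rle_trans; [apply Rmax_r|apply (Rmax_Cmod z)]. Qed.

Lemma Cmod_le_parts z : Cmod z <= Rabs (Re z) + Rabs (Im z).
Proof.
  assert (H : z = (RtoC (Re z) + Ci * RtoC (Im z))%C).
  { destruct z. apply injective_projections; simpl; ring. }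
  rewrite H at 1. eapply Rle_trans; [apply Cmod_triangle|].
  rewrite Cmod_mult, Cmod_Ci, !Cmod_R. lra.
Qed.

Lemma line_cont_parts f x : line_cont f x ->
  continuous (fun y => Re (f y)) x /\ continuous (fun y => Im (f y)) x.
Proof.
  intros H.
  split; apply continuity_pt_filterlim; intros e he;
    destruct (H e he) as (d & hd & K); exists d; (split; [exact hd|]);
    intros y [_ hy]; simpl in *; unfold R_dist in *; specialize (K y hy);
    (eapply Rle_lt_trans; [|exact K]).
  - apply (re_le_Cmod (f y - f x)).
  - apply (im_le_Cmod (f y - f x)).
Qed.

Lemma ex_CInt_cont f a b :
  (forall x, Rmin a b <= x <= Rmax a b -> line_cont f x) -> ex_CInt f a b.
Proof.
  intros H. split; apply (ex_RInt_continuous (V := R_CompleteNormedModule));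
    intros z hz; apply (line_cont_parts _ _ (H z hz)).
Qed.

Lemma CInt_Chasles f a b c : ex_CInt f a b -> ex_CInt f b c ->
  (CInt f a b + CInt f b c)%C = CInt f a c.
Proof.
  intros [H1 H2] [H3 H4].
  apply injective_projections; simpl; apply (RInt_Chasles (V := R_CompleteNormedModule)); assumption.
Qed.

Lemma CInt_swap f a b : ex_CInt f a b -> CInt f b a = (- CInt f a b)%C.
Proof.
  intros [H1 H2]. apply injective_projections; simpl;
    symmetry; apply (opp_RInt_swap (V := R_CompleteNormedModule)); assumption.
Qed.

Lemma CInt_point f a : CInt f a a = 0%C.
Proof. apply injective_projections; simpl; apply (RInt_point (V := R_CompleteNormedModule)). Qed.

Lemma CInt_ext f g a b :
  (forall x, Rmin a b <= x <= Rmax a b -> f x = g x) -> CInt f a b = CInt g a b.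
Proof.
  intros H. apply injective_projections; simpl;
    apply (RInt_ext (V := R_CompleteNormedModule)); intros x hx; rewrite H; auto; lra.
Qed.

Lemma CInt_lin k l f g a b : ex_CInt f a b -> ex_CInt g a b ->
  CInt (fun x => k * f x + l * g x)%C a b = (k * CInt f a b + l * CInt g a b)%C.
Proof.
  intros [H1 H2] [H3 H4].
  apply (RInt_correct (V := R_CompleteNormedModule)) in H1, H2, H3, H4.
  apply injective_projections; simpl; apply is_RInt_unique.
  - eapply is_RInt_ext; [|apply (is_RInt_plus _ _ _ _ _ _
      (is_RInt_minus _ _ _ _ _ _ (is_RInt_scal _ _ _ (Re k) _ H1) (is_RInt_scal _ _ _ (Im k) _ H2))
      (is_RInt_minus _ _ _ _ _ _ (is_RInt_scal _ _ _ (Re l) _ H3) (is_RInt_scal _ _ _ (Im l) _ H4)))].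
    intros x _. simpl. reflexivity.
  - eapply is_RInt_ext; [|apply (is_RInt_plus _ _ _ _ _ _
      (is_RInt_plus _ _ _ _ _ _ (is_RInt_scal _ _ _ (Re k) _ H2) (is_RInt_scal _ _ _ (Im k) _ H1))
      (is_RInt_plus _ _ _ _ _ _ (is_RInt_scal _ _ _ (Re l) _ H4) (is_RInt_scal _ _ _ (Im l) _ H3)))].
    intros x _. simpl. reflexivity.
Qed.

Lemma Rabs_RInt_le g a b M : ex_RInt g a b ->
  (forall x, Rmin a b <= x <= Rmax a b -> Rabs (g x) <= M) ->
  Rabs (RInt g a b) <= M * Rabs (b - a).
Proof.
  intros H K. destruct (Rle_dec a b) as [h|h].
  - rewrite (Rabs_pos_eq (b - a)) by lra. rewrite Rmult_comm.
    apply abs_RInt_le_const; auto. intros t ht. apply K.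
    rewrite Rmin_left, Rmax_right; lra.
  - rewrite <- (opp_RInt_swap (V := R_CompleteNormedModule)) by (apply ex_RInt_swap, H).
    change (Rabs (- RInt g b a) <= M * Rabs (b - a)).
    rewrite Rabs_Ropp, (Rabs_left (b - a)) by lra.
    replace (M * - (b - a)) with ((a - b) * M) by ring.
    apply abs_RInt_le_const; [lra|apply ex_RInt_swap, H|]. intros t ht. apply K.
    rewrite Rmin_right, Rmax_left; lra.
Qed.

(** The real and imaginary parts are bounded separately, which costs the factor 2. *)
Lemma CInt_bound f a b M : ex_CInt f a b ->
  (forall x, Rmin a b <= x <= Rmax a b -> Cmod (f x) <= M) ->
  Cmod (CInt f a b) <= 2 * M * Rabs (b - a).
Proof.
  intros [H1 H2] K. eapply Rle_trans; [apply Cmod_le_parts|]. simpl.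
  pose proof (Rabs_RInt_le _ a b M H1) as B1. pose proof (Rabs_RInt_le _ a b M H2) as B2.
  enough (Rabs (RInt (fun x => Re (f x)) a b) <= M * Rabs (b - a) /\
          Rabs (RInt (fun x => Im (f x)) a b) <= M * Rabs (b - a)) by lra.
  split; [apply B1|apply B2]; intros x hx; (eapply Rle_trans; [|apply K, hx]).
  - apply re_le_Cmod.
  - apply im_le_Cmod.
Qed.

Lemma deriv_line f z v r l : deriv f (z + RtoC r * v)%C l ->
  is_derive (fun x : R => Re (f (z + RtoC x * v)%C)) r (Re (l * v)%C) /\
  is_derive (fun x : R => Im (f (z + RtoC x * v)%C)) r (Im (l * v)%C).
Proof.
  intros H.
  assert (K : forall e, 0 < e -> exists d : posreal, forall h, h <> 0 -> Rabs h < d ->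
     Cmod ((f (z + RtoC (r + h) * v) - f (z + RtoC r * v)) * RtoC (/ h) - l * v)%C < e).
  { intros e he. pose proof (Cmod_ge_0 v) as hv.
    (* Adding 1 to [Cmod v] keeps the divisor positive when v = 0. *)
    assert (he' : 0 < e / (Cmod v + 1)) by (apply Rdiv_lt_0_compat; lra).
    destruct (H _ he') as (d & hd & B).
    assert (hd' : 0 < d / (Cmod v + 1)) by (apply Rdiv_lt_0_compat; lra).
    exists (mkposreal _ hd'). intros h h0 hh. simpl in hh.
    specialize (B (z + RtoC (r + h) * v)%C).
    replace (z + RtoC (r + h) * v - (z + RtoC r * v))%C with (RtoC h * v)%C in B
      by (rewrite RtoC_plus; ring).
    rewrite Cmod_mult, Cmod_R in B.
    assert (h1 : 0 < Rabs h) by (apply Rabs_pos_lt, h0).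
    assert (hlt : Rabs h * Cmod v < d).
    { apply Rlt_div_r in hh; [|lra]. nra. }
    specialize (B hlt).
    replace ((f (z + RtoC (r + h) * v) - f (z + RtoC r * v)) * RtoC (/ h) - l * v)%C with
      ((f (z + RtoC (r + h) * v) - f (z + RtoC r * v) - l * (RtoC h * v)) * RtoC (/ h))%C.
    2: { rewrite RtoC_inv by exact h0. field. intros E. apply h0. apply RtoC_inj, E. }
    rewrite Cmod_mult, Cmod_R, Rabs_inv.
    apply Rmult_lt_reg_r with (Rabs h); [exact h1|].
    rewrite Rmult_assoc, Rinv_l, Rmult_1_r by lra.
    eapply Rle_lt_trans; [exact B|].
    replace (e / (Cmod v + 1) * (Rabs h * Cmod v))
      with (e * Rabs h * (Cmod v / (Cmod v + 1))) by (field; lra).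
    assert (Cmod v / (Cmod v + 1) < 1) by (apply Rlt_div_l; lra).
    assert (0 < e * Rabs h) by nra. nra. }
  split; apply is_derive_Reals; intros e he; destruct (K e he) as (d & B);
    exists d; intros h h0 hh; (eapply Rle_lt_trans; [|apply (B h h0 hh)]).
  - eapply Rle_trans; [|apply re_le_Cmod]. right. f_equal. simpl. unfold Re, Im, Rdiv. field. exact h0.
  - eapply Rle_trans; [|apply im_le_Cmod]. right. f_equal. simpl. unfold Re, Im, Rdiv. field. exact h0.
Qed.

Lemma cont_line f z v r : cont f (z + RtoC r * v)%C ->
  line_cont (fun x => f (z + RtoC x * v)%C) r.
Proof.
  intros H e he. destruct (H e he) as (d & hd & B). pose proof (Cmod_ge_0 v).
  exists (d / (Cmod v + 1)). split; [apply Rdiv_lt_0_compat; lra|]. intros y hy.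
  apply B. replace (z + RtoC y * v - (z + RtoC r * v))%C with (RtoC (y - r) * v)%C
    by (rewrite RtoC_minus; ring).
  rewrite Cmod_mult, Cmod_R. apply Rlt_div_r in hy; [|lra].
  pose proof (Rabs_pos (y - r)). nra.
Qed.

Lemma CInt_primitive_line F f z v a b :
  (forall r, Rmin a b <= r <= Rmax a b ->
     deriv F (z + RtoC r * v)%C (f (z + RtoC r * v)%C) /\ cont f (z + RtoC r * v)%C) ->
  (v * CInt (fun r => f (z + RtoC r * v)%C) a b)%C
  = (F (z + RtoC b * v) - F (z + RtoC a * v))%C.
Proof.
  intros H.
  assert (E : ex_CInt (fun r => f (z + RtoC r * v)%C) a b).
  { apply ex_CInt_cont. intros x hx. apply cont_line, H, hx. }
  (* A zero second summand lets [CInt_lin] serve for multiplication by v alone. *)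
  assert (E' : ex_CInt (fun _ => 0%C) a b) by (split; apply ex_RInt_const).
  pose proof (CInt_lin v 0 _ _ a b E E') as L.
  transitivity (CInt (fun r => v * f (z + RtoC r * v) + 0 * 0)%C a b).
  { rewrite L. ring. }
  assert (C0 : forall r, Rmin a b <= r <= Rmax a b ->
     line_cont (fun r => v * f (z + RtoC r * v) + 0 * 0)%C r).
  { intros r hr. apply (cont_line (fun w => v * f w + 0 * 0)%C).
    apply cont_plus; [apply cont_mult|]; auto using cont_const. apply H, hr. }
  apply injective_projections; simpl; apply is_RInt_unique;
    apply (is_RInt_derive (V := R_CompleteNormedModule)
      (fun x => _ (F (z + RtoC x * v)%C)));
    intros x hx; try (destruct (line_cont_parts _ _ (C0 x hx)); assumption).
  - destruct (deriv_line _ _ _ _ _ (proj1 (H x hx))) as [D1 D2].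
    replace (_ + _) with (Re (f (z + RtoC x * v) * v)%C) by (simpl; ring). exact D1.
  - destruct (deriv_line _ _ _ _ _ (proj1 (H x hx))) as [D1 D2].
    replace (_ + _) with (Im (f (z + RtoC x * v) * v)%C) by (simpl; ring). exact D2.
Qed.

(** The mean value theorem is applied to the real and to the imaginary part, each with its own
    intermediate point; hence the factor 2. *)
Lemma mean_value_bound f f' z w M :
  (forall r, 0 <= r <= 1 -> deriv f (z + RtoC r * (w - z))%C (f' r) /\ Cmod (f' r) <= M) ->
  Cmod (f w - f z) <= 2 * M * Cmod (w - z).
Proof.
  intros H.
  assert (e1 : (z + RtoC 1 * (w - z))%C = w) by ring.
  assert (e0 : (z + RtoC 0 * (w - z))%C = z) by ring.
  eapply Rle_trans; [apply Cmod_le_parts|].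
  assert (B : forall r, 0 <= r <= 1 -> Cmod (f' r * (w - z))%C <= M * Cmod (w - z)).
  { intros r hr. rewrite Cmod_mult.
    apply Rmult_le_compat_r; [apply Cmod_ge_0|]. apply H, hr. }
  assert (P : forall prj : C -> R,
    (forall r, 0 <= r <= 1 -> is_derive (fun x : R => prj (f (z + RtoC x * (w - z))%C)) r
         (prj (f' r * (w - z))%C)) ->
    (forall y, Rabs (prj y) <= Cmod y) ->
    Rabs (prj (f w) - prj (f z)) <= M * Cmod (w - z)).
  { intros prj D L.
    destruct (MVT_gen (fun x : R => prj (f (z + RtoC x * (w - z))%C)) 0 1
       (fun r => prj (f' r * (w - z))%C)) as (c & hc & E).
    - intros x. rewrite Rmin_left, Rmax_right by lra. intros hx. apply D. lra.
    - intros x. rewrite Rmin_left, Rmax_right by lra. intros hx.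
      apply continuity_pt_filterlim, (ex_derive_continuous (V := R_NormedModule)).
      eexists. apply D, hx.
    - rewrite Rmin_left, Rmax_right in hc by lra. rewrite e1, e0 in E.
      rewrite E. replace (1 - 0) with 1 by ring. rewrite Rmult_1_r.
      eapply Rle_trans; [apply L|apply B, hc]. }
  pose proof (P Re) as P1. pose proof (P Im) as P2. simpl.
  enough (Rabs (Re (f w) - Re (f z)) <= M * Cmod (w - z) /\
    Rabs (Im (f w) - Im (f z)) <= M * Cmod (w - z)).
  { unfold Re, Im in H0. unfold Rminus in H0. lra. }
  split; [apply P1|apply P2]; try (intros r hr; apply deriv_line, H, hr).
  - apply re_le_Cmod.
  - apply im_le_Cmod.
Qed.

(** * Integrals around the boundary of a rectangle *)

(** The counterclockwise integral of f dz over the sides of [a, b] x [c, d], where dz is du on the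
    horizontal sides and i dv on the vertical ones. *)
Definition RI (f : C -> C) (a b c d : R) : C :=
  (CInt (fun u => f (u, c)) a b + Ci * CInt (fun v => f (b, v)) c d
   - CInt (fun u => f (u, d)) a b - Ci * CInt (fun v => f (a, v)) c d)%C.

Definition in_rect (a b c d : R) (z : C) : Prop :=
  a <= Re z <= b /\ c <= Im z <= d.

Definition on_bdry (a b c d : R) (z : C) : Prop :=
  in_rect a b c d z /\ (Re z = a \/ Re z = b \/ Im z = c \/ Im z = d).

Lemma hline_eq c u : ((0, c) + RtoC u * 1)%C = (u, c).
Proof. apply injective_projections; simpl; ring. Qed.

Lemma vline_eq a v : ((a, 0) + RtoC v * Ci)%C = (a, v).
Proof. apply injective_projections; simpl; ring. Qed.

Lemma line_cont_h f u c : cont f (u, c) -> line_cont (fun u => f (u, c)) u.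
Proof.
  intros H. rewrite <- hline_eq in H. apply cont_line in H.
  intros e he. destruct (H e he) as (d & hd & B). exists d. split; [exact hd|].
  intros y hy. specialize (B y hy). rewrite !hline_eq in B. exact B.
Qed.

Lemma line_cont_v f a v : cont f (a, v) -> line_cont (fun v => f (a, v)) v.
Proof.
  intros H. rewrite <- vline_eq in H. apply cont_line in H.
  intros e he. destruct (H e he) as (d & hd & B). exists d. split; [exact hd|].
  intros y hy. specialize (B y hy). rewrite !vline_eq in B. exact B.
Qed.

Lemma ex_CInt_h f a b c :
  (forall u, Rmin a b <= u <= Rmax a b -> cont f (u, c)) ->
  ex_CInt (fun u => f (u, c)) a b.
Proof. intros H. apply ex_CInt_cont. intros x hx. apply line_cont_h, H, hx. Qed.

Lemma ex_CInt_v f a c d :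
  (forall v, Rmin c d <= v <= Rmax c d -> cont f (a, v)) ->
  ex_CInt (fun v => f (a, v)) c d.
Proof. intros H. apply ex_CInt_cont. intros x hx. apply line_cont_v, H, hx. Qed.

Ltac minmax := repeat match goal with
  | H : context [Rmin ?a ?b] |- _ => rewrite (Rmin_left a b) in H by lra
  | H : context [Rmax ?a ?b] |- _ => rewrite (Rmax_right a b) in H by lra
  end.
Ltac rect := unfold on_bdry, in_rect, Re, Im in *; simpl in *; minmax; try lra.

Lemma bdry_ex f a b c d : a <= b -> c <= d ->
  (forall z, on_bdry a b c d z -> cont f z) ->
  ex_CInt (fun u => f (u, c)) a b /\ ex_CInt (fun v => f (b, v)) c d /\
  ex_CInt (fun u => f (u, d)) a b /\ ex_CInt (fun v => f (a, v)) c d.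
Proof.
  intros hab hcd H.
  split; [apply ex_CInt_h|split; [apply ex_CInt_v|split; [apply ex_CInt_h|apply ex_CInt_v]]];
    intros x hx; apply H; rect.
Qed.

Lemma RI_ext f g a b c d : a <= b -> c <= d ->
  (forall z, on_bdry a b c d z -> f z = g z) -> RI f a b c d = RI g a b c d.
Proof.
  intros hab hcd H. unfold RI.
  rewrite (CInt_ext (fun u => f (u, c)) (fun u => g (u, c))),
    (CInt_ext (fun u => f (u, d)) (fun u => g (u, d))),
    (CInt_ext (fun v => f (a, v)) (fun v => g (a, v))),
    (CInt_ext (fun v => f (b, v)) (fun v => g (b, v))); [reflexivity|..];
    intros x hx; apply H; rect.
Qed.

Lemma RI_lin k l f g a b c d : a <= b -> c <= d ->
  (forall z, on_bdry a b c d z -> cont f z) ->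
  (forall z, on_bdry a b c d z -> cont g z) ->
  RI (fun z => k * f z + l * g z)%C a b c d = (k * RI f a b c d + l * RI g a b c d)%C.
Proof.
  intros hab hcd H K.
  destruct (bdry_ex f a b c d hab hcd H) as (H1 & H2 & H3 & H4).
  destruct (bdry_ex g a b c d hab hcd K) as (K1 & K2 & K3 & K4).
  unfold RI.
  rewrite (CInt_lin _ _ _ _ _ _ H1 K1), (CInt_lin _ _ _ _ _ _ H2 K2),
    (CInt_lin _ _ _ _ _ _ H3 K3), (CInt_lin _ _ _ _ _ _ H4 K4). ring.
Qed.

Lemma RI_bound f a b c d M : a <= b -> c <= d ->
  (forall z, on_bdry a b c d z -> cont f z) ->
  (forall z, on_bdry a b c d z -> Cmod (f z) <= M) ->
  Cmod (RI f a b c d) <= 4 * M * ((b - a) + (d - c)).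
Proof.
  intros hab hcd H K.
  destruct (bdry_ex f a b c d hab hcd H) as (H1 & H2 & H3 & H4).
  pose proof (CInt_bound _ _ _ M H1) as B1. pose proof (CInt_bound _ _ _ M H2) as B2.
  pose proof (CInt_bound _ _ _ M H3) as B3. pose proof (CInt_bound _ _ _ M H4) as B4.
  rewrite Rabs_pos_eq in B1, B2, B3, B4 by lra.
  unfold RI.
  eapply Rle_trans; [apply Cmod_minus_le|]. rewrite Cmod_mult, Cmod_Ci, Rmult_1_l.
  eapply Rle_trans; [apply Rplus_le_compat_r, Cmod_minus_le|].
  eapply Rle_trans; [apply Rplus_le_compat_r, Rplus_le_compat_r, Cmod_triangle|].
  rewrite Cmod_mult, Cmod_Ci, Rmult_1_l.
  assert (B1' := B1 ltac:(intros x hx; apply K; rect)).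
  assert (B2' := B2 ltac:(intros x hx; apply K; rect)).
  assert (B3' := B3 ltac:(intros x hx; apply K; rect)).
  assert (B4' := B4 ltac:(intros x hx; apply K; rect)).
  lra.
Qed.

Lemma CInt_primitive_h F f a b c :
  (forall u, Rmin a b <= u <= Rmax a b -> deriv F (u, c) (f (u, c)) /\ cont f (u, c)) ->
  CInt (fun u => f (u, c)) a b = (F (b, c) - F (a, c))%C.
Proof.
  intros H. rewrite <- (hline_eq c a), <- (hline_eq c b), <- (CInt_primitive_line F f).
  - rewrite Cmult_1_l. apply CInt_ext. intros x _. now rewrite hline_eq.
  - intros r hr. rewrite hline_eq. apply H, hr.
Qed.

Lemma CInt_primitive_v F f a c d :
  (forall v, Rmin c d <= v <= Rmax c d -> deriv F (a, v) (f (a, v)) /\ cont f (a, v)) ->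
  (Ci * CInt (fun v => f (a, v)) c d)%C = (F (a, d) - F (a, c))%C.
Proof.
  intros H. rewrite <- (vline_eq a c), <- (vline_eq a d), <- (CInt_primitive_line F f).
  - f_equal. apply CInt_ext. intros x _. now rewrite vline_eq.
  - intros r hr. rewrite vline_eq. apply H, hr.
Qed.

Lemma RI_primitive F f a b c d : a <= b -> c <= d ->
  (forall z, on_bdry a b c d z -> deriv F z (f z) /\ cont f z) ->
  RI f a b c d = 0%C.
Proof.
  intros hab hcd H. unfold RI.
  rewrite (CInt_primitive_h F), (CInt_primitive_v F), (CInt_primitive_h F),
    (CInt_primitive_v F); [ring|..]; intros x hx; apply H; rect.
Qed.

Lemma RI_split_re f a m b c d : a <= m <= b -> c <= d ->
  (forall z, in_rect a b c d z -> cont f z) ->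
  RI f a b c d = (RI f a m c d + RI f m b c d)%C.
Proof.
  intros hm hcd H. unfold RI.
  rewrite <- (CInt_Chasles (fun u => f (u, c)) a m b),
    <- (CInt_Chasles (fun u => f (u, d)) a m b); [ring|..];
    apply ex_CInt_h; intros x hx; apply H; rect.
Qed.

Lemma RI_split_im f a b c m d : a <= b -> c <= m <= d ->
  (forall z, in_rect a b c d z -> cont f z) ->
  RI f a b c d = (RI f a b c m + RI f a b m d)%C.
Proof.
  intros hm hcd H. unfold RI.
  rewrite <- (CInt_Chasles (fun v => f (a, v)) c m d),
    <- (CInt_Chasles (fun v => f (b, v)) c m d); [ring|..];
    apply ex_CInt_v; intros x hx; apply H; rect.
Qed.

Lemma RI_flat_re f a c d : RI f a a c d = 0%C.
Proof. unfold RI. rewrite !CInt_point. ring. Qed.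

Lemma RI_flat_im f a b c : RI f a b c c = 0%C.
Proof. unfold RI. rewrite !CInt_point. ring. Qed.

(** * Bisection and Goursat's theorem *)

Lemma nested_intervals (a b : nat -> R) :
  (forall n, a n <= a (S n) /\ b (S n) <= b n /\ a n <= b n) ->
  exists x, forall n, a n <= x <= b n.
Proof.
  intros H.
  assert (up : forall n k, a n <= a (n + k)%nat /\ b (n + k)%nat <= b n).
  { intros n k. induction k as [|k IH]; [rewrite Nat.add_0_r; lra|].
    rewrite Nat.add_succ_r. pose proof (H (n + k)%nat). lra. }
  assert (ab : forall n m, a n <= b m).
  { intros n m. destruct (up n m) as [U _]. destruct (up m n) as [_ V].
    rewrite Nat.add_comm in V. pose proof (H (n + m)%nat). lra. }
  destruct (completeness (fun y => exists n, y = a n)) as (x & U & L).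
  - exists (b O). intros y [n ->]. apply ab.
  - exists (a O). now exists O.
  - exists x. intros n. split; [apply U; now exists n|].
    apply L. intros y [m ->]. apply ab.
Qed.

Section Bisection.
Variable good : R -> R -> R -> R -> Prop.
Hypothesis good_quarters : forall a b c d, a <= b -> c <= d ->
  good a ((a + b) / 2) c ((c + d) / 2) -> good ((a + b) / 2) b c ((c + d) / 2) ->
  good a ((a + b) / 2) ((c + d) / 2) d -> good ((a + b) / 2) b ((c + d) / 2) d ->
  good a b c d.

Let rects : Type := (R * R * (R * R))%type.
Let bad (q : rects) : Prop :=
  fst (fst q) <= snd (fst q) /\ fst (snd q) <= snd (snd q) /\
  ~ good (fst (fst q)) (snd (fst q)) (fst (snd q)) (snd (snd q)).
Let quarter_of (p q : rects) : Prop :=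
  let ma := (fst (fst p) + snd (fst p)) / 2 in
  let mc := (fst (snd p) + snd (snd p)) / 2 in
  (fst q = (fst (fst p), ma) \/ fst q = (ma, snd (fst p))) /\
  (snd q = (fst (snd p), mc) \/ snd q = (mc, snd (snd p))).

Lemma bad_quarter (p : rects) : bad p -> exists q, bad q /\ quarter_of p q.
Proof.
  intros (h1 & h2 & h3). apply NNPP. intros N. apply h3.
  destruct p as [[a b] [c d]]. simpl in *.
  apply good_quarters; auto; apply NNPP; intros B; apply N; unfold bad, quarter_of;
    match type of B with ~ good ?a ?b ?c ?d => exists ((a, b), (c, d)) end;
    simpl; (split; [split; [lra|split; [lra|exact B]]|]); auto.
Qed.

(** The compactness argument shared by Goursat's theorem and [compact_rect]: successive bad quarters
    would shrink to a point z, around which all small enough rectangles are good. *)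
Lemma rect_bisection a b c d : a <= b -> c <= d ->
  (forall z, in_rect a b c d z -> exists e, 0 < e /\
    forall a' b' c' d', a <= a' -> b' <= b -> c <= c' -> d' <= d ->
    in_rect a' b' c' d' z -> b' - a' < e -> d' - c' < e -> good a' b' c' d') ->
  good a b c d.
Proof.
  intros hab hcd H. apply NNPP. intros N.
  (* [epsilon] chooses a bad quarter; its value on a rectangle that is not bad is arbitrary and
     never reached. *)
  set (step := fun q : rects => epsilon (inhabits q) (fun q' => bad q' /\ quarter_of q q')).
  assert (hstep : forall q, bad q -> bad (step q) /\ quarter_of q (step q)).
  { intros q hq. apply (epsilon_spec (inhabits q) (fun q' => bad q' /\ quarter_of q q')).
    apply bad_quarter, hq. }
  set (q := fix q n := match n with O => ((a, b), (c, d)) | S n => step (q n) end).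
  assert (hq : forall n, bad (q n)).
  { induction n as [|n IH]; [split; simpl; auto|]. apply hstep, IH. }
  assert (hs : forall n, quarter_of (q n) (q (S n))) by (intros n; apply hstep, hq).
  assert (width : forall n, snd (fst (q n)) - fst (fst (q n)) = (b - a) / 2 ^ n /\
                            snd (snd (q n)) - fst (snd (q n)) = (d - c) / 2 ^ n).
  { induction n as [|n IH]; [simpl; lra|].
    destruct (hs n) as [[E|E] [F|F]]; rewrite E, F; simpl fst; simpl snd;
    replace ((b - a) / 2 ^ S n) with ((b - a) / 2 ^ n / 2)
      by (simpl; field; apply pow_nonzero; lra);
    replace ((d - c) / 2 ^ S n) with ((d - c) / 2 ^ n / 2)
      by (simpl; field; apply pow_nonzero; lra); lra. }
  destruct (nested_intervals (fun n => fst (fst (q n))) (fun n => snd (fst (q n)))) as (x & hx).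
  { intros n. destruct (hq n) as (h1 & h2 & _).
    destruct (hs n) as [[E|E] _]; rewrite E; simpl; lra. }
  destruct (nested_intervals (fun n => fst (snd (q n))) (fun n => snd (snd (q n)))) as (y & hy).
  { intros n. destruct (hq n) as (h1 & h2 & _).
    destruct (hs n) as [_ [E|E]]; rewrite E; simpl; lra. }
  assert (inside : forall n, a <= fst (fst (q n)) /\ snd (fst (q n)) <= b /\
                             c <= fst (snd (q n)) /\ snd (snd (q n)) <= d).
  { induction n as [|n IH]; [simpl; lra|]. destruct (hq n) as (h1 & h2 & _).
    destruct (hs n) as [[E|E] [F|F]]; rewrite E, F; simpl; lra. }
  destruct (H (x, y)) as (e & he & G).
  { pose proof (hx O). pose proof (hy O). split; simpl in *; lra. }
  assert (small : exists n, (b - a) / 2 ^ n < e /\ (d - c) / 2 ^ n < e).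
  (* The quantity (b - a) + (d - c) + 1 dominates both side lengths and stays positive for
     degenerate rectangles, so one n serves both sides. *)
  { destruct (pow_lt_1_zero (/2)) with (y := e / ((b - a) + (d - c) + 1)) as [n hn].
    - rewrite Rabs_pos_eq; lra.
    - apply Rdiv_lt_0_compat; lra.
    - exists n. specialize (hn n (le_n n)).
      assert (hp : 0 < / 2 ^ n) by (apply Rinv_0_lt_compat, pow_lt; lra).
      rewrite pow_inv, Rabs_pos_eq in hn by lra.
      apply Rlt_div_r in hn; [|lra]. unfold Rdiv. split; nra. }
  destruct small as (n & n1 & n2). destruct (width n) as [W1 W2].
  destruct (inside n) as (i1 & i2 & i3 & i4).
  destruct (hq n) as (_ & _ & B). apply B, G; auto; try lra.
  split; simpl; [apply hx|apply hy].
Qed.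
End Bisection.

Lemma rect_Cmod a b c d z w : in_rect a b c d z -> in_rect a b c d w ->
  Cmod (w - z) <= (b - a) + (d - c).
Proof.
  intros [h1 h2] [h3 h4]. eapply Rle_trans; [apply Cmod_le_parts|].
  assert (Rabs (Re (w - z)%C) <= b - a) by (apply Rabs_le; rect).
  assert (Rabs (Im (w - z)%C) <= d - c) by (apply Rabs_le; rect).
  lra.
Qed.

(* Goursat: the defect is compared with the square of the half-perimeter, a weight
   that quartering divides by exactly 4 whatever the shape of the rectangle. *)
Lemma goursat f a b c d : a <= b -> c <= d ->
  (forall z, in_rect a b c d z -> hol f z) -> RI f a b c d = 0%C.
Proof.
  intros hab hcd H.
  assert (K : forall e, 0 < e -> Cmod (RI f a b c d) <= e * ((b - a) + (d - c)) ^ 2).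
  { intros e he.
    (* The guard, trivial for the whole rectangle, makes the bisected property carry inclusion in
       it, where f is known to be holomorphic. *)
    assert (G : (a <= a /\ b <= b /\ c <= c /\ d <= d) -> 
              Cmod (RI f a b c d) <= e * ((b - a) + (d - c)) ^ 2); [|apply G; lra].
    apply (rect_bisection (fun a' b' c' d' => (a <= a' /\ b' <= b /\ c <= c' /\ d' <= d) ->
       Cmod (RI f a' b' c' d') <= e * ((b' - a') + (d' - c')) ^ 2)); auto.
    - intros p q r s hpq hrs G1 G2 G3 G4 hin.
      assert (cf : forall z, in_rect p q r s z -> cont f z).
      { intros z hz. apply hol_cont, H. rect. }
      rewrite (RI_split_re f p ((p + q) / 2) q) by (lra || auto).
      rewrite (RI_split_im f p _ r ((r + s) / 2) s); try lra.
      2: { intros z hz. apply cf. rect. }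
      rewrite (RI_split_im f _ q r ((r + s) / 2) s); try lra.
      2: { intros z hz. apply cf. rect. }
      eapply Rle_trans; [apply Cmod_triangle|].
      eapply Rle_trans; [apply Rplus_le_compat; apply Cmod_triangle|].
      specialize (G1 ltac:(lra)). specialize (G2 ltac:(lra)).
      specialize (G3 ltac:(lra)). specialize (G4 ltac:(lra)).
      eapply Rle_trans; [apply Rplus_le_compat; apply Rplus_le_compat; eassumption|].
      right. field.
    - intros z hz. destruct (H z hz) as [l D].
      (* The 4 cancels the factor of [RI_bound]. Sides shorter than r / 2 suffice because the
         distance to z is at most the sum of the two sides. *)
      destruct (D (e / 4)) as (r & hr & B); [lra|].
      exists (r / 2). split; [lra|]. intros p q s t h1 h2 h3 h4 hin w1 w2 _.
      assert (hpq : p <= q) by rect. assert (hst : s <= t) by rect.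
      assert (cf : forall w, on_bdry p q s t w -> cont f w).
      { intros w hw. apply hol_cont, H. rect. }
      assert (clin : forall w, cont (fun w => f z + l * (w - z))%C w).
      { intros w. apply cont_plus, cont_mult; auto using cont_const.
        apply cont_minus; auto using cont_const, cont_id. }
      (* The affine part of f at z has a primitive, so only the remainder in the definition of the
         derivative contributes to the integral. *)
      assert (lin0 : RI (fun w => f z + l * (w - z))%C p q s t = 0%C).
      { apply (RI_primitive (fun w => f z * w + l * ((w - z) * (w - z)) * / 2)%C); auto.
        intros w hw. split; [|apply clin].
        assert (D1 := deriv_minus _ _ w _ _ (deriv_id w) (deriv_const z w)).
        assert (D2 := deriv_mult _ _ w _ _ D1 D1).
        assert (D3 := deriv_mult _ _ w _ _ (deriv_mult _ _ w _ _ (deriv_const l w) D2)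
                         (deriv_const (/ 2) w)).
        assert (D4 := deriv_mult _ _ w _ _ (deriv_const (f z) w) (deriv_id w)).
        assert (D5 := deriv_plus _ _ w _ _ D4 D3). simpl in D5.
        eapply eq_rect; [exact D5|]. field. }
      replace (RI f p q s t) with (1 * RI f p q s t + (- (1)) * 
         RI (fun w => f z + l * (w - z))%C p q s t)%C by (rewrite lin0; ring).
      rewrite <- RI_lin; auto.
      eapply Rle_trans; [apply (RI_bound _ _ _ _ _ (e / 4 * ((q - p) + (t - s))))|]; auto.
      + intros w hw. apply cont_plus; apply cont_mult; auto using cont_const.
      + intros w hw. assert (hwz : Cmod (w - z) <= (q - p) + (t - s)).
        { apply (rect_Cmod p q s t); auto. apply hw. }
        replace (1 * f w + - (1) * (f z + l * (w - z)))%C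
          with (f w - f z - l * (w - z))%C by ring.
        eapply Rle_trans; [apply B; lra|]. apply Rmult_le_compat_l; lra.
      + right. field. }
  apply Cmod_eq_0. destruct (Cmod_ge_0 (RI f a b c d)) as [P|P]; [|auto].
  exfalso. set (m := Cmod (RI f a b c d)) in *.
  assert (hW : 0 <= ((b - a) + (d - c)) ^ 2) by apply pow2_ge_0.
  set (W := ((b - a) + (d - c)) ^ 2) in *.
  assert (he : 0 < m / (2 * (W + 1))) by (apply Rdiv_lt_0_compat; lra).
  specialize (K _ he). fold W in K.
  replace (m / (2 * (W + 1)) * W) with (m / 2 * (W / (W + 1))) in K by (field; lra).
  assert (W / (W + 1) < 1) by (apply Rlt_div_l; lra). nra.
Qed.

Lemma Cmod_le_eps_eq_0 z : (forall e, 0 < e -> Cmod z <= e) -> z = 0%C.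
Proof.
  intros H. apply Cmod_eq_0. destruct (Cmod_ge_0 z) as [P|P]; [|auto].
  specialize (H (Cmod z / 2)). lra.
Qed.

(** Cutting out a small rectangle around p leaves four pieces that avoid p. The integral over the
    small one is at most its perimeter times a local bound of f, up to a constant, and so tends to
    0. *)
Lemma RI_remove_point f p a b c d : a <= b -> c <= d ->
  (forall z, in_rect a b c d z -> cont f z) ->
  (forall a' b' c' d', a <= a' <= b' -> b' <= b -> c <= c' <= d' -> d' <= d ->
     ~ in_rect a' b' c' d' p -> RI f a' b' c' d' = 0%C) ->
  RI f a b c d = 0%C.
Proof.
  intros hab hcd cf H.
  destruct (classic (in_rect a b c d p)) as [hp|hp]; [|apply H; auto; lra].
  destruct (cont_bounded f p (cf p hp)) as (r & hr & B).
  set (M := Cmod (f p) + 1) in *. assert (hM : 0 < M) by (pose proof (Cmod_ge_0 (f p)); unfold M; lra).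
  apply Cmod_le_eps_eq_0. intros e he.
  (* The small rectangle has width plus height at most 4 h: this is below r, where M bounds f, and
     [RI_bound] then gives 16 M h <= e. *)
  set (h := Rmin (r / 5) (e / (16 * M))).
  assert (hh : 0 < h) by (apply Rmin_glb_lt; [lra|apply Rdiv_lt_0_compat; lra]).
  assert (h1 : h <= r / 5) by apply Rmin_l.
  assert (h2 : 16 * M * h <= e).
  { assert (h <= e / (16 * M)) by apply Rmin_r. apply Rle_div_r in H0; lra. }
  destruct hp as [[p1 p2] [p3 p4]].
  (* If p is within h of a side, the corresponding outer piece degenerates to a segment and has
     integral 0. *)
  set (a' := Rmax a (Re p - h)). set (b' := Rmin b (Re p + h)).
  set (c' := Rmax c (Im p - h)). set (d' := Rmin d (Im p + h)).
  assert (ha : (a' = a \/ a' = Re p - h) /\ a <= a' /\ Re p - h <= a' <= Re p).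
  { unfold a', Rmax. destruct (Rle_dec a (Re p - h)); lra. }
  assert (hb : (b' = b \/ b' = Re p + h) /\ b' <= b /\ Re p <= b' <= Re p + h).
  { unfold b', Rmin. destruct (Rle_dec b (Re p + h)); lra. }
  assert (hc : (c' = c \/ c' = Im p - h) /\ c <= c' /\ Im p - h <= c' <= Im p).
  { unfold c', Rmax. destruct (Rle_dec c (Im p - h)); lra. }
  assert (hd : (d' = d \/ d' = Im p + h) /\ d' <= d /\ Im p <= d' <= Im p + h).
  { unfold d', Rmin. destruct (Rle_dec d (Im p + h)); lra. }
  clearbody a' b' c' d' h.
  assert (sub : forall s t u v, a <= s -> t <= b -> c <= u -> v <= d ->
    forall z, in_rect s t u v z -> cont f z).
  { intros s t u v k1 k2 k3 k4 z hz. apply cf. rect. }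
  assert (E1 : RI f a a' c d = 0%C).
  { destruct (proj1 ha) as [E|E]; [rewrite E; apply RI_flat_re|].
    apply H; try lra. intros [k _]. lra. }
  assert (E2 : RI f b' b c d = 0%C).
  { destruct (proj1 hb) as [E|E]; [rewrite E; apply RI_flat_re|].
    apply H; try lra. intros [k _]. lra. }
  assert (E3 : RI f a' b' c c' = 0%C).
  { destruct (proj1 hc) as [E|E]; [rewrite E; apply RI_flat_im|].
    apply H; try lra. intros [_ k]. lra. }
  assert (E4 : RI f a' b' d' d = 0%C).
  { destruct (proj1 hd) as [E|E]; [rewrite E; apply RI_flat_im|].
    apply H; try lra. intros [_ k]. lra. }
  rewrite (RI_split_re f a a' b) by (lra || (apply sub; lra)).
  rewrite (RI_split_re f a' b' b) by (lra || (apply sub; lra)).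
  rewrite (RI_split_im f a' b' c c' d) by (lra || (apply sub; lra)).
  rewrite (RI_split_im f a' b' c' d' d) by (lra || (apply sub; lra)).
  rewrite E1, E2, E3, E4.
  replace (0 + (0 + (RI f a' b' c' d' + 0) + 0))%C with (RI f a' b' c' d') by ring.
  eapply Rle_trans; [apply (RI_bound f _ _ _ _ M)|]; try lra.
  - intros z hz. apply (sub a' b' c' d'); try lra. apply hz.
  - intros z hz. left. apply B.
    apply Rle_lt_trans with ((b' - a') + (d' - c')); [|lra].
    apply (rect_Cmod a' b' c' d'); [rect|apply hz].
  - nra.
Qed.

(** Two exceptional points are allowed because [cauchy_formula] integrates a slope: one is the
    centre of the slope, the other a point where the function itself may fail to be holomorphic. *)
Lemma goursat_except2 f p q a b c d : a <= b -> c <= d ->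
  (forall z, in_rect a b c d z -> cont f z) ->
  (forall z, in_rect a b c d z -> z <> p -> z <> q -> hol f z) ->
  RI f a b c d = 0%C.
Proof.
  intros hab hcd cf H.
  apply (RI_remove_point f p); auto. intros a' b' c' d' k1 k2 k3 k4 np.
  apply (RI_remove_point f q); try lra.
  { intros z hz. apply cf. rect. }
  intros a1 b1 c1 d1 l1 l2 l3 l4 nq.
  apply goursat; try lra. intros z hz. apply H.
  - rect.
  - intros ->. apply np. rect.
  - intros ->. apply nq. rect.
Qed.

(** These squares are exactly the balls of [C_UniformSpace]. *)
Definition osquare (p : C) (r : R) (z : C) : Prop :=
  Rabs (Re z - Re p) < r /\ Rabs (Im z - Im p) < r.

Lemma near_osquare p r z : osquare p r z -> near z (osquare p r).
Proof.
  intros [h1 h2].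
  set (d := Rmin (r - Rabs (Re z - Re p)) (r - Rabs (Im z - Im p))).
  exists d. split; [apply Rmin_glb_lt; lra|]. intros w hw.
  assert (d1 : d <= r - Rabs (Re z - Re p)) by apply Rmin_l.
  assert (d2 : d <= r - Rabs (Im z - Im p)) by apply Rmin_r.
  pose proof (re_le_Cmod (w - z)) as b1. pose proof (im_le_Cmod (w - z)) as b2.
  simpl in b1, b2. fold (Re w) (Re z) (Im w) (Im z) in b1, b2.
  split.
  - replace (Re w - Re p) with ((Re w + - Re z) + (Re z - Re p)) by ring.
    eapply Rle_lt_trans; [apply Rabs_triang|]. lra.
  - replace (Im w - Im p) with ((Im w + - Im z) + (Im z - Im p)) by ring.
    eapply Rle_lt_trans; [apply Rabs_triang|]. lra.
Qed.

Lemma Cmod_lt_osquare p r z : Cmod (z - p) < r -> osquare p r z.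
Proof.
  intros H. split; (eapply Rle_lt_trans; [|exact H]).
  - apply (re_le_Cmod (z - p)).
  - apply (im_le_Cmod (z - p)).
Qed.

Lemma near_iff_osquare z P : near z P <-> exists r, 0 < r /\ forall w, osquare z r w -> P w.
Proof.
  split.
  - intros (d & hd & H). exists (d / 2). split; [lra|]. intros w [h1 h2]. apply H.
    eapply Rle_lt_trans; [apply Cmod_le_parts|]. simpl.
    unfold Re, Im, Rminus in *. lra.
  - intros (r & hr & H). exists r. split; [exact hr|]. intros w hw.
    apply H, Cmod_lt_osquare, hw.
Qed.

(** * Primitives on open squares *)

Lemma between_lt x y p r u : Rabs (x - p) < r -> Rabs (y - p) < r ->
  Rmin x y <= u <= Rmax x y -> Rabs (u - p) < r.
Proof.
  intros hx hy hu. apply Rabs_def2 in hx, hy. apply Rabs_def1;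
  unfold Rmin, Rmax in hu; destruct (Rle_dec x y); lra.
Qed.

(** Corners come in any order because [primitive_osquare] compares points in arbitrary position;
    exchanging two opposite sides only changes the sign of the integral. *)
Lemma goursat_osquare f p r x x' y y' :
  (forall z, osquare p r z -> hol f z) ->
  Rabs (x - Re p) < r -> Rabs (x' - Re p) < r ->
  Rabs (y - Im p) < r -> Rabs (y' - Im p) < r ->
  RI f x x' y y' = 0%C.
Proof.
  intros H hx hx' hy hy'.
  assert (eh : forall s t u, Rabs (s - Re p) < r -> Rabs (t - Re p) < r ->
    Rabs (u - Im p) < r -> ex_CInt (fun v => f (v, u)) s t).
  { intros s t u hs ht hu. apply ex_CInt_h. intros v hv. apply hol_cont, H.
    split; simpl; [apply (between_lt s t)|]; assumption. }
  assert (ev : forall s t u, Rabs (s - Im p) < r -> Rabs (t - Im p) < r ->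
    Rabs (u - Re p) < r -> ex_CInt (fun v => f (u, v)) s t).
  { intros s t u hs ht hu. apply ex_CInt_v. intros v hv. apply hol_cont, H.
    split; simpl; [|apply (between_lt s t)]; assumption. }
  assert (sw : forall x x' y y', Rabs (x - Re p) < r -> Rabs (x' - Re p) < r ->
    Rabs (y - Im p) < r -> Rabs (y' - Im p) < r ->
    RI f x' x y y' = (- RI f x x' y y')%C /\ RI f x x' y' y = (- RI f x x' y y')%C).
  { clear x x' y y' hx hx' hy hy'. intros x x' y y' hx hx' hy hy'. unfold RI.
    rewrite (CInt_swap (fun u => f (u, y)) x x'), (CInt_swap (fun u => f (u, y')) x x'),
     (CInt_swap (fun v => f (x, v)) y y'), (CInt_swap (fun v => f (x', v)) y y');
      auto. split; ring. }
  assert (G : forall x x' y y', Rabs (x - Re p) < r -> Rabs (x' - Re p) < r ->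
    Rabs (y - Im p) < r -> Rabs (y' - Im p) < r -> x <= x' -> y <= y' ->
    RI f x x' y y' = 0%C).
  { clear x x' y y' hx hx' hy hy'. intros x x' y y' hx hx' hy hy' l1 l2.
    apply goursat; auto. intros z [z1 z2]. apply H. split.
    - apply (between_lt x x'); rewrite ?Rmin_left, ?Rmax_right; auto.
    - apply (between_lt y y'); rewrite ?Rmin_left, ?Rmax_right; auto. }
  destruct (Rle_dec x x') as [h1|h1]; destruct (Rle_dec y y') as [h2|h2].
  - apply G; auto.
  - rewrite (proj2 (sw x x' y' y hx hx' hy' hy)), G by (auto; lra). ring.
  - rewrite (proj1 (sw x' x y y' hx' hx hy hy')), G by (auto; lra). ring.
  - rewrite (proj1 (sw x' x y y' hx' hx hy hy')),
      (proj2 (sw x' x y' y hx' hx hy' hy)), G by (auto; lra). ring.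
Qed.

Lemma CInt_const k a b : CInt (fun _ => k) a b = (k * RtoC (b - a))%C.
Proof.
  apply injective_projections; simpl; rewrite (RInt_const (V := R_CompleteNormedModule));
    unfold scal; simpl; unfold mult; simpl; unfold Re, Im; ring.
Qed.

Lemma primitive_osquare f p r : 0 < r -> (forall z, osquare p r z -> hol f z) ->
  exists F, forall z, osquare p r z -> deriv F z (f z).
Proof.
  intros hr H.
  (* The integral of f from p along a horizontal and then a vertical segment. *)
  set (F := fun z : C => (CInt (fun u => f (u, Im p)) (Re p) (Re z)
                     + Ci * CInt (fun v => f (Re z, v)) (Im p) (Im z))%C).
  exists F.
  assert (p0 : Rabs (Re p - Re p) < r /\ Rabs (Im p - Im p) < r).
  { replace (Re p - Re p) with 0 by ring. replace (Im p - Im p) with 0 by ring.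
    rewrite Rabs_R0. auto. }
  assert (eh : forall s t u, Rabs (s - Re p) < r -> Rabs (t - Re p) < r ->
    Rabs (u - Im p) < r -> ex_CInt (fun v => f (v, u)) s t).
  { intros s t u hs ht hu. apply ex_CInt_h. intros v hv. apply hol_cont, H.
    split; simpl; [apply (between_lt s t)|]; assumption. }
  assert (ev : forall s t u, Rabs (s - Im p) < r -> Rabs (t - Im p) < r ->
    Rabs (u - Re p) < r -> ex_CInt (fun v => f (u, v)) s t).
  { intros s t u hs ht hu. apply ex_CInt_v. intros v hv. apply hol_cont, H.
    split; simpl; [|apply (between_lt s t)]; assumption. }
  (* Goursat on the rectangle between the heights Im p and Im z, over [Re z, Re w], turns the
     increment of F into an integral along the L-shaped path from z to w. *)
  assert (D : forall z w, osquare p r z -> osquare p r w ->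
    (F w - F z)%C = (CInt (fun u => f (u, Im z)) (Re z) (Re w)
                     + Ci * CInt (fun v => f (Re w, v)) (Im z) (Im w))%C).
  { intros z w [z1 z2] [w1 w2].
    assert (G : RI f (Re z) (Re w) (Im p) (Im z) = 0%C).
    { apply (goursat_osquare f p r); tauto. }
    unfold RI in G. unfold F.
    rewrite <- (CInt_Chasles (fun u => f (u, Im p)) (Re p) (Re z) (Re w)) by (apply eh; tauto).
    rewrite <- (CInt_Chasles (fun v => f (Re w, v)) (Im p) (Im z) (Im w)) by (apply ev; tauto).
    match type of G with ?x = _ => transitivity (x + (CInt (fun u => f (u, Im z)) (Re z) (Re w)
         + Ci * CInt (fun v => f (Re w, v)) (Im z) (Im w)))%C end.
    - ring.
    - rewrite G. ring. }
  intros z hz e he.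
  (* [CInt_bound] contributes a factor 2 and the two legs of the path a total length of at most 2 |w
     - z|. With |w - z| < d / 2 both legs stay within d of z. *)
  destruct (hol_cont _ _ (H z hz) (e / 4)) as (d & hd & B); [lra|].
  refine (near_imp z _ _ _ (near_and _ _ _ (near_osquare _ _ _ hz) (near_ball z (d / 2) _)));
    [|lra].
  intros w [hw hwd]. rewrite (D z w hz hw).
  pose proof hz as [z1 z2]. pose proof hw as [w1 w2].
  assert (hre := re_le_Cmod (w - z)). assert (him := im_le_Cmod (w - z)).
  change (Re (w - z)%C) with (Re w - Re z) in hre. change (Im (w - z)%C) with (Im w - Im z) in him.
  replace (CInt (fun u => f (u, Im z)) (Re z) (Re w)
      + Ci * CInt (fun v => f (Re w, v)) (Im z) (Im w) - f z * (w - z))%C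
   with (CInt (fun u => 1 * f (u, Im z) + (- (1)) * f z)%C (Re z) (Re w)
         + Ci * CInt (fun v => 1 * f (Re w, v) + (- (1)) * f z)%C (Im z) (Im w))%C.
  2: { rewrite (CInt_lin _ _ _ (fun _ => f z) _ _ (eh (Re z) (Re w) (Im z) z1 w1 z2)),
         (CInt_lin _ _ _ (fun _ => f z) _ _ (ev (Im z) (Im w) (Re w) z2 w2 w1))
         by (split; apply ex_RInt_const).
       rewrite !CInt_const.
       replace (w - z)%C with (RtoC (Re w - Re z) + Ci * RtoC (Im w - Im z))%C; [ring|].
       apply injective_projections; simpl; unfold Re, Im; ring. }
  assert (seg : forall x y t, Rmin x y <= t <= Rmax x y -> Rabs (t - x) <= Rabs (y - x)).
  { intros x y t. unfold Rmin, Rmax. destruct (Rle_dec x y); intros ht.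
    - rewrite !Rabs_pos_eq; lra.
    - rewrite !Rabs_left1; lra. }
  eapply Rle_trans; [apply Cmod_triangle|]. rewrite Cmod_mult, Cmod_Ci, Rmult_1_l.
  assert (B1 : Cmod (CInt (fun u => 1 * f (u, Im z) + (- (1)) * f z)%C (Re z) (Re w))
     <= 2 * (e / 4) * Rabs (Re w - Re z)).
  { apply CInt_bound.
    - apply (ex_CInt_h (fun x => 1 * f x + (- (1)) * f z)%C).
      intros u hu. apply cont_plus; apply cont_mult; auto using cont_const.
      apply hol_cont, H. split; simpl; [apply (between_lt (Re z) (Re w))|]; auto.
    - intros u hu. replace (1 * f (u, Im z) + - (1) * f z)%C with (f (u, Im z) - f z)%C by ring.
      left. apply B. eapply Rle_lt_trans; [apply Cmod_le_parts|]. simpl.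
      replace (Im z + - snd z) with 0 by (unfold Im; ring). rewrite Rabs_R0.
      specialize (seg _ _ _ hu). unfold Re, Rminus in *. lra. }
  assert (B2 : Cmod (CInt (fun v => 1 * f (Re w, v) + (- (1)) * f z)%C (Im z) (Im w))
     <= 2 * (e / 4) * Rabs (Im w - Im z)).
  { apply CInt_bound.
    - apply (ex_CInt_v (fun x => 1 * f x + (- (1)) * f z)%C).
      intros u hu. apply cont_plus; apply cont_mult; auto using cont_const.
      apply hol_cont, H. split; simpl; [|apply (between_lt (Im z) (Im w))]; auto.
    - intros u hu. replace (1 * f (Re w, u) + - (1) * f z)%C with (f (Re w, u) - f z)%C by ring.
      left. apply B. eapply Rle_lt_trans; [apply Cmod_le_parts|]. simpl.
      specialize (seg _ _ _ hu). unfold Re, Im, Rminus in *. lra. }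
  nra.
Qed.

(** * Cauchy estimates and their consequences *)

Definition square (a : C) (r : R) : C -> Prop :=
  in_rect (Re a - r) (Re a + r) (Im a - r) (Im a + r).

Definition square_bdry (a : C) (r : R) : C -> Prop :=
  on_bdry (Re a - r) (Re a + r) (Im a - r) (Im a + r).

Ltac rect ::= unfold square, square_bdry, on_bdry, in_rect, Re, Im in *; simpl in *; minmax; try lra.

Definition SI (f : C -> C) (a : C) (r : R) : C :=
  RI f (Re a - r) (Re a + r) (Im a - r) (Im a + r).

Lemma square_Cmod a r z : square a r z -> Cmod (z - a) <= 2 * r.
Proof.
  intros [h1 h2]. eapply Rle_trans; [apply Cmod_le_parts|].
  assert (Rabs (Re (z - a)%C) <= r) by (apply Rabs_le; rect).
  assert (Rabs (Im (z - a)%C) <= r) by (apply Rabs_le; rect).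
  lra.
Qed.

Lemma osquare_square a r z : osquare a r z -> square a r z.
Proof. intros [h1 h2]. apply Rabs_def2 in h1, h2. rect. Qed.

Lemma bdry_dist a r z w : square_bdry a r z -> osquare a (r / 2) w ->
  r / 2 <= Cmod (z - w).
Proof.
  intros [[h1 h2] h] [k1 k2]. apply Rabs_def2 in k1, k2.
  assert (hre := re_le_Cmod (z - w)). assert (him := im_le_Cmod (z - w)).
  change (Re (z - w)%C) with (Re z - Re w) in hre. change (Im (z - w)%C) with (Im z - Im w) in him.
  destruct h as [h|[h|[h|h]]].
  - rewrite Rabs_left in hre; lra.
  - rewrite Rabs_right in hre; lra.
  - rewrite Rabs_left in him; lra.
  - rewrite Rabs_right in him; lra.
Qed.

Lemma bdry_neq a r z w : 0 < r -> square_bdry a r z -> osquare a (r / 2) w ->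
  (z - w)%C <> 0%C.
Proof. intros hr h k. apply Cmod_gt_0. pose proof (bdry_dist _ _ _ _ h k). lra. Qed.

Lemma cont_sub_const w z : cont (fun z => z - w)%C z.
Proof. apply cont_minus; auto using cont_const, cont_id. Qed.

Lemma hol_sub_const w z : hol (fun z => z - w)%C z.
Proof. apply hol_minus; auto using hol_const, hol_id. Qed.

Lemma slope_cont f q w z : (forall z, f z = f w + q z * (z - w))%C ->
  z <> w -> cont f z -> cont q z.
Proof.
  intros H n cf. apply (cont_ext (fun z => (f z - f w) / (z - w))%C).
  - refine (near_imp z _ _ _ (near_neq z w n)). intros v hv. rewrite (H v).
    field. apply Csub_neq_0, hv.
  - apply cont_div; auto using cont_minus, cont_const, cont_sub_const.
    apply Csub_neq_0, n.
Qed.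

Lemma slope_hol f q w z : (forall z, f z = f w + q z * (z - w))%C ->
  z <> w -> hol f z -> hol q z.
Proof.
  intros H n cf. apply (hol_ext (fun z => (f z - f w) / (z - w))%C).
  - refine (near_imp z _ _ _ (near_neq z w n)). intros v hv. rewrite (H v).
    field. apply Csub_neq_0, hv.
  - apply hol_div; auto using hol_minus, hol_const, hol_sub_const.
    apply Csub_neq_0, n.
Qed.

(** The slope of f at w is continuous on the square and holomorphic off w and p, so its boundary
    integral vanishes. The winding integral is kept as a factor, and p is the point later shown to
    be removable. *)
Lemma cauchy_formula f a r p w : 0 < r ->
  (forall z, square a r z -> cont f z) ->
  (forall z, square a r z -> z <> p -> hol f z) ->
  osquare a (r / 2) w -> w <> p ->
  (f w * SI (fun z => / (z - w)) a r = SI (fun z => f z / (z - w)) a r)%C.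
Proof.
  intros hr cf hf hw hp.
  assert (hw' : square a r w).
  { destruct hw as [h1 h2]. apply Rabs_def2 in h1, h2. rect. }
  destruct (hf w hw' hp) as [l D]. apply deriv_slope in D as (q & cq & _ & Q).
  assert (G : SI q a r = 0%C).
  { apply (goursat_except2 q w p); try lra.
    - intros z hz. destruct (classic (z = w)) as [->|n]; [exact cq|].
      apply (slope_cont f q w); auto.
    - intros z hz n1 n2. apply (slope_hol f q w); auto. }
  assert (E : SI q a r = (1 * SI (fun z => f z / (z - w)) a r
     + (- f w) * SI (fun z => / (z - w)) a r)%C).
  { unfold SI. rewrite <- RI_lin; try lra.
    - apply RI_ext; try lra. intros z hz. rewrite (Q z).
      field. apply (bdry_neq a r); auto.
    - intros z hz. apply cont_div; auto using cont_sub_const; [apply cf, hz|].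
      apply (bdry_neq a r); auto.
    - intros z hz. apply cont_inv; auto using cont_sub_const.
      apply (bdry_neq a r); auto. }
  rewrite G in E. symmetry in E. apply Csub_eq_0. rewrite <- Copp_0, <- E. ring.
Qed.

Lemma RInt_ge_const g a b m : a <= b -> ex_RInt g a b ->
  (forall x, a < x < b -> m <= g x) -> m * (b - a) <= RInt g a b.
Proof.
  intros h E H. rewrite Rmult_comm.
  rewrite <- (RInt_const (V := R_CompleteNormedModule) a b m : _ = (b - a) * m).
  apply RInt_le; auto. apply ex_RInt_const.
Qed.

Lemma RInt_le_const g a b m : a <= b -> ex_RInt g a b ->
  (forall x, a < x < b -> g x <= m) -> RInt g a b <= m * (b - a).
Proof.
  intros h E H. rewrite Rmult_comm.
  rewrite <- (RInt_const (V := R_CompleteNormedModule) a b m : _ = (b - a) * m).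
  apply RInt_le; auto. apply ex_RInt_const.
Qed.

(* Each of the four sides contributes at least 1/8, so the exact value 2 i pi
   is not needed. *)
Lemma winding_bound a r w : 0 < r -> osquare a (r / 2) w ->
  / 2 <= Im (SI (fun z => / (z - w))%C a r).
Proof.
  intros hr hw.
  (* The denominator is at most 8 r^2 and the numerator exceeds r / 2, which gives 1 / (16 r); a
     side of length 2 r thus contributes 1/8. *)
  assert (B : forall x y, r / 2 < x -> Rabs x <= 2 * r -> Rabs y <= 2 * r ->
                 / (16 * r) <= x / (x ^ 2 + y ^ 2)).
  { intros x y h1 h2 h3.
    assert (x ^ 2 <= 4 * (r * r)) by (apply pow_maj_Rabs with (n := 2%nat) in h2; nra).
    assert (y ^ 2 <= 4 * (r * r)) by (apply pow_maj_Rabs with (n := 2%nat) in h3; nra).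
    assert (0 < x ^ 2 + y ^ 2) by nra.
    apply Rle_div_r; [assumption|]. apply Rmult_le_reg_l with (16 * r); [lra|].
    rewrite <- Rmult_assoc, Rinv_r by lra. nra. }
  assert (BR : forall c : C, r / 2 < Re c -> Rabs (Re c) <= 2 * r -> Rabs (Im c) <= 2 * r ->
    / (16 * r) <= Re (/ c)%C).
  { intros c h1 h2 h3. apply (B (Re c) (Im c)); auto. }
  assert (BL : forall c : C, Re c < - (r / 2) -> Rabs (Re c) <= 2 * r -> Rabs (Im c) <= 2 * r ->
    Re (/ c)%C <= - / (16 * r)).
  { intros c h1 h2 h3. rewrite <- Rabs_Ropp in h2.
    pose proof (B (- Re c) (Im c) ltac:(lra) h2 h3) as b.
    replace (Re (/ c)%C) with (- (- Re c / ((- Re c) ^ 2 + Im c ^ 2))); [lra|].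
    simpl. unfold Rdiv, Re, Im. rewrite Ropp_mult_distr_l, Ropp_involutive.
    do 2 f_equal. ring. }
  assert (BD : forall c : C, Im c < - (r / 2) -> Rabs (Re c) <= 2 * r -> Rabs (Im c) <= 2 * r ->
    / (16 * r) <= Im (/ c)%C).
  { intros c h1 h2 h3. rewrite <- Rabs_Ropp in h3.
    pose proof (B (- Im c) (Re c) ltac:(lra) h3 h2) as b.
    replace (Im (/ c)%C) with (- Im c / ((- Im c) ^ 2 + Re c ^ 2)); [lra|].
    simpl. unfold Rdiv, Re, Im. do 2 f_equal. ring. }
  assert (BU : forall c : C, r / 2 < Im c -> Rabs (Re c) <= 2 * r -> Rabs (Im c) <= 2 * r ->
    Im (/ c)%C <= - / (16 * r)).
  { intros c h1 h2 h3.
    pose proof (B (Im c) (Re c) ltac:(lra) h3 h2) as b.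
    replace (Im (/ c)%C) with (- (Im c / (Im c ^ 2 + Re c ^ 2))); [lra|].
    simpl. unfold Rdiv, Re, Im. rewrite Ropp_mult_distr_l. do 2 f_equal. ring. }
  assert (EQ : / (16 * r) * (2 * r) = / 8) by (field; lra).
  destruct (bdry_ex (fun z => / (z - w))%C (Re a - r) (Re a + r) (Im a - r) (Im a + r))
    as ((_ & E1) & (E2 & _) & (_ & E3) & (E4 & _)); try lra.
  { intros z hz. apply cont_inv; auto using cont_sub_const. apply (bdry_neq a r); auto. }
  destruct hw as [h1 h2]. apply Rabs_def2 in h1, h2.
  assert (S1 := RInt_ge_const _ (Re a - r) (Re a + r) (/ (16 * r)) ltac:(lra) E1
    ltac:(intros x hx; apply BD; try apply Rabs_le; rect)).
  assert (S2 := RInt_ge_const _ (Im a - r) (Im a + r) (/ (16 * r)) ltac:(lra) E2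
    ltac:(intros x hx; apply BR; try apply Rabs_le; rect)).
  assert (S3 := RInt_le_const _ (Re a - r) (Re a + r) (- / (16 * r)) ltac:(lra) E3
    ltac:(intros x hx; apply BU; try apply Rabs_le; rect)).
  assert (S4 := RInt_le_const _ (Im a - r) (Im a + r) (- / (16 * r)) ltac:(lra) E4
    ltac:(intros x hx; apply BL; try apply Rabs_le; rect)).
  replace (Re a + r - (Re a - r)) with (2 * r) in S1, S3 by ring.
  replace (Im a + r - (Im a - r)) with (2 * r) in S2, S4 by ring.
  match type of S1 with _ <= ?s1 => match type of S2 with _ <= ?s2 =>
  match type of S3 with ?s3 <= _ => match type of S4 with ?s4 <= _ =>
    replace (Im (SI (fun z => / (z - w))%C a r)) with (s1 + s2 - s3 - s4) end end end end.
  - lra.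
  - unfold SI, RI, CInt, Re, Im. simpl. ring.
Qed.

Lemma SI_bound f a r M : 0 < r ->
  (forall z, square_bdry a r z -> cont f z) ->
  (forall z, square_bdry a r z -> Cmod (f z) <= M) ->
  Cmod (SI f a r) <= 16 * M * r.
Proof.
  intros hr cf B. eapply Rle_trans; [apply (RI_bound f _ _ _ _ M); try lra; auto|].
  right. ring.
Qed.

(** A maximum principle up to a constant: the winding integral has modulus at least 1/2 and the
    Cauchy integral at most 16 M (2 / r) r, whence 64. In [isolated_zero] the constant is absorbed
    by arbitrarily high powers of 1/2. *)
Lemma max_estimate f a r p w M : 0 < r ->
  (forall z, square a r z -> cont f z) ->
  (forall z, square a r z -> z <> p -> hol f z) ->
  (forall z, square_bdry a r z -> Cmod (f z) <= M) ->
  osquare a (r / 2) w -> w <> p -> Cmod (f w) <= 64 * M.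
Proof.
  intros hr cf hf B hw hp.
  assert (E := cauchy_formula f a r p w hr cf hf hw hp). apply (f_equal Cmod) in E.
  rewrite Cmod_mult in E.
  assert (W : / 2 <= Cmod (SI (fun z => / (z - w))%C a r)).
  { eapply Rle_trans; [apply (winding_bound a r w hr hw)|].
    eapply Rle_trans; [apply Rle_abs|apply im_le_Cmod]. }
  assert (U : Cmod (SI (fun z => f z / (z - w))%C a r) <= 16 * (M * (2 / r)) * r).
  { apply SI_bound; auto.
    - intros z hz. apply cont_div; auto using cont_sub_const; [apply cf, hz|].
      apply (bdry_neq a r); auto.
    - intros z hz. pose proof (bdry_dist _ _ _ _ hz hw) as D.
      pose proof (bdry_neq _ _ _ _ hr hz hw) as N.
      unfold Cdiv. rewrite Cmod_mult, Cmod_inv by exact N.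
      apply Rmult_le_compat; [apply Cmod_ge_0| |apply B, hz|].
      + left. apply Rinv_0_lt_compat. lra.
      + replace (2 / r) with (/ (r / 2)) by (field; lra). apply Rinv_le_contravar; lra. }
  replace (16 * (M * (2 / r)) * r) with (32 * M) in U by (field; lra).
  pose proof (Cmod_ge_0 (f w)). nra.
Qed.

(** On the boundary the slope of f at w is at most 2 M (2 / r), and [max_estimate], with w as
    exceptional point, carries the bound to z: 256 is 64 * 2 * 2. *)
Lemma lipschitz_of_bounded f a r M : 0 < r ->
  (forall z, square a r z -> hol f z) ->
  (forall z, square a r z -> Cmod (f z) <= M) ->
  forall z w, osquare a (r / 2) z -> osquare a (r / 2) w ->
  Cmod (f z - f w) <= 256 * M / r * Cmod (z - w).
Proof.
  intros hr hf B z w hz hw.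
  assert (hw' : square a r w).
  { destruct hw as [h1 h2]. apply Rabs_def2 in h1, h2. rect. }
  destruct (classic (z = w)) as [->|n].
  { rewrite !Cmod_sub_self. lra. }
  destruct (hf w hw') as [l D]. apply deriv_slope in D as (q & cq & _ & Q).
  assert (Bq : Cmod (q z) <= 64 * (2 * M * (2 / r))).
  { apply (max_estimate q a r w z); auto.
    - intros v hv. destruct (classic (v = w)) as [->|n']; [exact cq|].
      apply (slope_cont f q w); auto using hol_cont.
    - intros v hv n'. apply (slope_hol f q w); auto.
    - intros v hv. pose proof (bdry_dist _ _ _ _ hv hw) as Dv.
      pose proof (bdry_neq _ _ _ _ hr hv hw) as N.
      replace (q v) with ((f v - f w) / (v - w))%C by (rewrite (Q v); field; exact N).
      unfold Cdiv. rewrite Cmod_mult, Cmod_inv by exact N.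
      apply Rmult_le_compat; [apply Cmod_ge_0| | |].
      + left. apply Rinv_0_lt_compat. lra.
      + eapply Rle_trans; [apply Cmod_minus_le|].
        pose proof (B v (proj1 hv)). pose proof (B w hw'). lra.
      + replace (2 / r) with (/ (r / 2)) by (field; lra). apply Rinv_le_contravar; lra. }
  replace (f z - f w)%C with (q z * (z - w))%C by (rewrite (Q z); ring).
  rewrite Cmod_mult. apply Rmult_le_compat_r; [apply Cmod_ge_0|].
  replace (256 * M / r) with (64 * (2 * M * (2 / r))) by (field; lra). exact Bq.
Qed.

(** Differentiation under the integral in the parameter: 1/(z-v) - 1/(z-w) - (v-w)/(z-w)^2 equals
    (v-w)^2 / ((z-v)(z-w)^2), and the last denominator stays away from 0 on the boundary. *)
Lemma cauchy_integral_hol f a r M : 0 < r ->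
  (forall z, square_bdry a r z -> cont f z) ->
  (forall z, square_bdry a r z -> Cmod (f z) <= M) ->
  forall w, osquare a (r / 2) w -> hol (fun w => SI (fun z => f z / (z - w))%C a r) w.
Proof.
  intros hr cf B w hw.
  assert (N : forall z v, square_bdry a r z -> osquare a (r / 2) v -> (z - v)%C <> 0%C).
  { intros z v hz hv. apply (bdry_neq a r); auto. }
  assert (cq : forall z v, square_bdry a r z -> osquare a (r / 2) v ->
    cont (fun z => f z / (z - v))%C z).
  { intros z v hz hv. apply cont_div; auto using cont_sub_const. }
  assert (cs : forall z, square_bdry a r z -> cont (fun z => f z / ((z - w) * (z - w)))%C z).
  { intros z hz. apply cont_div; auto using cont_mult, cont_sub_const.
    apply Cmult_neq_0; auto. }
  exists (SI (fun z => f z / ((z - w) * (z - w)))%C a r).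
  intros e he.
  assert (hM : 0 <= M).
  { eapply Rle_trans; [apply Cmod_ge_0|apply (B (Re a - r, Im a))]. rect. }
  (* [SI_bound] for the remainder integrand, whose three denominators are each at least r / 2 in
     modulus. *)
  set (K := 16 * (M * (2 / r * (2 / r) * (2 / r))) * r).
  assert (hK : 0 <= K).
  { assert (0 < 2 / r) by (apply Rdiv_lt_0_compat; lra). unfold K.
    repeat apply Rmult_le_pos; lra. }
  assert (hd : 0 < e / (K + 1)) by (apply Rdiv_lt_0_compat; lra).
  refine (near_imp w _ _ _ (near_and _ _ _ (near_osquare _ _ _ hw) (near_ball w _ hd))).
  intros v [hv hvd].
  replace (SI (fun z => f z / (z - v)) a r - SI (fun z => f z / (z - w)) a r -
     SI (fun z => f z / ((z - w) * (z - w))) a r * (v - w))%C with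
   ((v - w) * (v - w) * SI (fun z => f z / ((z - v) * ((z - w) * (z - w)))) a r)%C.
  { rewrite !Cmod_mult. rewrite Rmult_assoc, (Rmult_comm e).
    apply Rmult_le_compat_l; [apply Cmod_ge_0|].
    assert (U : Cmod (SI (fun z => f z / ((z - v) * ((z - w) * (z - w))))%C a r) <= K).
    { apply SI_bound; auto.
      - intros z hz. apply cont_div; auto using cont_mult, cont_sub_const.
        repeat apply Cmult_neq_0; auto.
      - intros z hz. unfold Cdiv.
        rewrite Cmod_mult, Cmod_inv, !Cmod_mult, !Rinv_mult
          by (repeat apply Cmult_neq_0; auto).
        assert (b : forall v, osquare a (r / 2) v -> 0 < / Cmod (z - v) <= 2 / r).
        { intros u hu. pose proof (bdry_dist _ _ _ _ hz hu). split.
          - apply Rinv_0_lt_compat. lra.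
          - replace (2 / r) with (/ (r / 2)) by (field; lra). apply Rinv_le_contravar; lra. }
        pose proof (b v hv). pose proof (b w hw).
        apply Rmult_le_compat; [apply Cmod_ge_0| |apply B, hz|].
        + repeat apply Rmult_le_pos; lra.
        + rewrite Rmult_assoc. repeat apply Rmult_le_compat; try apply Rmult_le_pos; lra. }
    apply Rle_trans with (Cmod (v - w) * (K + 1)).
    - apply Rmult_le_compat_l; [apply Cmod_ge_0|lra].
    - apply Rlt_div_r in hvd; lra. }
  transitivity (1 * (1 * SI (fun z => f z / (z - v)) a r + (- (1)) * SI (fun z => f z / (z - w)) a r)
     + (- (v - w)) * SI (fun z => f z / ((z - w) * (z - w))) a r)%C; [|ring].
  unfold SI. rewrite <- RI_lin; try lra; auto. rewrite <- RI_lin; try lra; auto.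
  2: { intros z hz. apply cont_plus; apply cont_mult; auto using cont_const. }
  transitivity (((v - w) * (v - w)) * RI (fun z => f z / ((z - v) * ((z - w) * (z - w))))%C
     (Re a - r) (Re a + r) (Im a - r) (Im a + r) + 0 * RI (fun _ => 0)%C
     (Re a - r) (Re a + r) (Im a - r) (Im a + r))%C; [ring|].
  rewrite <- RI_lin; try lra; auto using cont_const.
  - apply RI_ext; try lra. intros z hz. field. split; apply N; auto.
  - intros z hz. apply cont_div; auto using cont_mult, cont_sub_const.
    repeat apply Cmult_neq_0; auto.
Qed.

Lemma cont_eq_0_punctured f p : cont f p ->
  near p (fun z => z <> p -> f z = 0%C) -> f p = 0%C.
Proof.
  intros cf H. apply Cmod_le_eps_eq_0. intros e he.
  destruct (near_and _ _ _ H (cf e he)) as (d & hd & K).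
  assert (E : (p + RtoC (d / 2) - p)%C = RtoC (d / 2)) by ring.
  destruct (K (p + RtoC (d / 2))%C) as [K1 K2].
  { rewrite E, Cmod_R, Rabs_pos_eq; lra. }
  rewrite K1 in K2.
  - rewrite Cmod_sub_sym in K2. replace (f p - 0)%C with (f p) in K2 by ring. lra.
  - intros F. rewrite F in E.
    replace (p - p)%C with (RtoC 0) in E by ring. apply RtoC_inj in E. lra.
Qed.

Lemma near_square p P : near p P -> exists r, 0 < r /\ forall z, square p r z -> P z.
Proof.
  intros (d & hd & H). exists (d / 3). split; [lra|]. intros z hz. apply H.
  pose proof (square_Cmod _ _ _ hz). lra.
Qed.

Lemma osquare_center p r : 0 < r -> osquare p r p.
Proof.
  intros hr. split; unfold Rminus; rewrite Rplus_opp_r, Rabs_R0; exact hr.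
Qed.

(** Off p, Cauchy's formula presents f as a quotient of two Cauchy integrals, both holomorphic in w,
    the denominator being nonzero by [winding_bound]. Continuity extends the equality to p. *)
Lemma hol_removable f p : cont f p -> near p (fun z => z <> p -> hol f z) -> hol f p.
Proof.
  intros cf H.
  destruct (near_square _ _ (near_and _ _ _ H (cont_bounded _ _ cf))) as (r & hr & K).
  assert (cz : forall z, square p r z -> cont f z).
  { intros z hz. destruct (classic (z = p)) as [->|n]; [exact cf|].
    apply hol_cont, K; assumption. }
  assert (N1 : forall w, osquare p (r / 2) w ->
    hol (fun w => SI (fun z => f z / (z - w))%C p r) w).
  { apply (cauchy_integral_hol f p r (Cmod (f p) + 1)); auto.
    - intros z hz. apply cz, hz.
    - intros z hz. left. apply K, hz. }
  assert (N2 : forall w, osquare p (r / 2) w ->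
    hol (fun w => SI (fun z => / (z - w))%C p r) w).
  { intros w hw. apply (hol_ext (fun w => SI (fun z => 1 / (z - w))%C p r)).
    - apply near_true. intros v. unfold SI. apply RI_ext; try lra.
      intros z _. unfold Cdiv. ring.
    - apply (cauchy_integral_hol (fun _ => 1%C) p r 1); auto using cont_const.
      intros z _. rewrite Cmod_1. lra. }
  assert (W : forall w, osquare p (r / 2) w -> SI (fun z => / (z - w))%C p r <> 0%C).
  { intros w hw E. pose proof (winding_bound p r w hr hw) as B. rewrite E in B.
    simpl in B. lra. }
  assert (hp : osquare p (r / 2) p) by (apply osquare_center; lra).
  assert (E : forall w, osquare p (r / 2) w -> w <> p ->
    (f w * SI (fun z => / (z - w)) p r = SI (fun z => f z / (z - w)) p r)%C).
  { intros w hw n. apply (cauchy_formula f p r p); auto. intros z hz. apply K, hz. }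
  assert (E0 : (f p * SI (fun z => / (z - p)) p r - SI (fun z => f z / (z - p)) p r)%C = 0%C).
  { apply (cont_eq_0_punctured
      (fun w => f w * SI (fun z => / (z - w)) p r - SI (fun z => f z / (z - w)) p r)%C p).
    - apply cont_minus; [apply cont_mult|]; auto using hol_cont.
    - refine (near_imp p _ _ _ (near_osquare _ _ _ hp)). intros w hw n.
      rewrite (E w hw n). ring. }
  apply (hol_ext (fun w => SI (fun z => f z / (z - w)) p r / SI (fun z => / (z - w)) p r)%C).
  - refine (near_imp p _ _ _ (near_osquare _ _ _ hp)). intros w hw.
    destruct (classic (w = p)) as [->|n].
    + apply Csub_eq_0 in E0. rewrite <- E0. field. auto.
    + rewrite <- (E w hw n). field. auto.
  - apply hol_div; auto.
Qed.

(** The order of vanishing is read off from division by powers of z - a. If every quotient tends to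
    0 at a, then [max_estimate] forces f to vanish nearby; otherwise the last quotient tending to 0
    is z - a times a function nonzero at a. *)
Lemma isolated_zero f a : near a (hol f) -> f a = 0%C ->
  near a (fun z => f z = 0%C) \/ near a (fun z => z <> a -> f z <> 0%C).
Proof.
  intros hf f0.
  (* With the value 0 at a, continuity of [g n] at a says that f is o((z - a)^n). *)
  set (g := fun (n : nat) (z : C) => if excluded_middle_informative (z = a) then RtoC 0
                       else (f z / (z - a) ^ n)%C).
  assert (ga : forall n, g n a = 0%C).
  { intros n. unfold g. destruct (excluded_middle_informative (a = a)) as [_|h]; [auto|].
    exfalso. apply h. reflexivity. }
  assert (gz : forall n z, z <> a -> g n z = (f z / (z - a) ^ n)%C).
  { intros n z h. unfold g. destruct (excluded_middle_informative (z = a)); [contradiction|auto]. }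
  assert (pw : forall n z, z <> a -> ((z - a) ^ n)%C <> 0%C).
  { intros n z h. apply Cmod_gt_0. rewrite Cmod_pow. apply pow_lt, Cmod_sub_gt_0, h. }
  assert (hp : forall n z, hol (fun z => (z - a) ^ n)%C z).
  { intros n z. induction n as [|n IH]; simpl; [apply hol_const|].
    apply hol_mult; auto using hol_sub_const. }
  assert (gh : forall n z, z <> a -> hol f z -> hol (g n) z).
  { intros n z h k. apply (hol_ext (fun z => f z / (z - a) ^ n)%C).
    - refine (near_imp z _ _ _ (near_neq z a h)). intros v hv. symmetry. auto.
    - apply hol_div; auto. }
  destruct (classic (forall n, cont (g n) a)) as [all|some].
  - left.
    destruct (near_square _ _ (near_and _ _ _ hf
      (cont_bounded _ _ (hol_cont _ _ (near_self _ _ hf))))) as (r & hr & K).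
    set (M := Cmod (f a) + 1) in *.
    (* Here |w - a| <= r / 2 while |z - a| >= r on the boundary: the ratio 1/2, raised to the power
       k, gives the decay in [B]. *)
    apply near_iff_osquare. exists (r / 4). split; [lra|]. intros w hw.
    destruct (classic (w = a)) as [->|n]; [exact f0|].
    assert (hw2 : osquare a (r / 2) w) by (destruct hw; split; lra).
    assert (hwr : Cmod (w - a) <= r / 2).
    { pose proof (square_Cmod _ _ _ (osquare_square _ _ _ hw)). lra. }
    assert (B : forall k, Cmod (f w) <= 64 * M * (/ 2) ^ k).
    { intros k.
      assert (G : Cmod (g k w) <= 64 * (M * (/ r) ^ k)).
      { apply (max_estimate (g k) a r a); auto.
        - intros z hz. destruct (classic (z = a)) as [->|m]; [apply all|].
          apply hol_cont, gh; auto. apply K, hz.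
        - intros z hz m. apply gh; auto. apply K, hz.
        - intros z hz.
          assert (D : r <= Cmod (z - a)).
          { destruct hz as [[h1 h2] h].
            assert (hre := re_le_Cmod (z - a)). assert (him := im_le_Cmod (z - a)).
            change (Re (z - a)%C) with (Re z - Re a) in hre.
            change (Im (z - a)%C) with (Im z - Im a) in him.
            destruct h as [h|[h|[h|h]]]; rewrite h in *.
            - rewrite Rabs_left in hre; lra.
            - rewrite Rabs_right in hre; lra.
            - rewrite Rabs_left in him; lra.
            - rewrite Rabs_right in him; lra. }
          assert (m : z <> a).
          { intros ->. rewrite Cmod_sub_self in D. lra. }
          rewrite gz, Cmod_div, Cmod_pow by auto. unfold Rdiv. rewrite <- pow_inv.
          apply Rmult_le_compat; [apply Cmod_ge_0| | |].
          + apply pow_le. left. apply Rinv_0_lt_compat. lra.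
          + left. apply K, hz.
          + apply pow_incr. split; [left; apply Rinv_0_lt_compat; lra|].
            apply Rinv_le_contravar; lra. }
      replace (f w) with (g k w * (w - a) ^ k)%C by (rewrite gz by auto; field; auto).
      rewrite Cmod_mult, Cmod_pow.
      apply Rle_trans with (64 * (M * (/ r) ^ k) * (r / 2) ^ k).
      - apply Rmult_le_compat; auto using Cmod_ge_0.
        + apply pow_le, Cmod_ge_0.
        + apply pow_incr. split; [apply Cmod_ge_0|exact hwr].
      - right. replace (/ 2) with (/ r * (r / 2)) by (field; lra).
        rewrite Rpow_mult_distr. ring. }
    apply Cmod_le_eps_eq_0. intros e he.
    assert (hM : 0 < M) by (pose proof (Cmod_ge_0 (f a)); unfold M; lra).
    destruct (pow_lt_1_zero (/ 2)) with (y := e / (64 * M)) as [k hk].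
    + rewrite Rabs_pos_eq; lra.
    + apply Rdiv_lt_0_compat; lra.
    + specialize (hk k (le_n k)). specialize (B k).
      assert (0 < (/ 2) ^ k) by (apply pow_lt; lra).
      rewrite Rabs_pos_eq in hk by lra. apply Rlt_div_r in hk; lra.
  - right.
    (* The order of the zero is then n + 1; the search starts because [g 0] is f itself. *)
    assert (step : exists n, cont (g n) a /\ ~ cont (g (S n)) a).
    { apply NNPP. intros N. apply some. intros n. induction n as [|n IH].
      - apply (cont_ext f); [|apply hol_cont, (near_self _ _ hf)].
        apply near_true. intros z. destruct (classic (z = a)) as [->|m].
        + now rewrite ga.
        + rewrite gz by auto. simpl. field.
      - apply NNPP. intros h. apply N. now exists n. }
    destruct step as (n & cn & cs).
    assert (hn : hol (g n) a).
    { apply hol_removable; auto. refine (near_imp a _ _ _ hf). auto. }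
    destruct hn as [l D]. apply deriv_slope in D as (q & cq & ql & Q).
    assert (QE : forall z, z <> a -> q z = g (S n) z).
    { intros z m. rewrite gz by auto.
      replace (f z) with (g n z * (z - a) ^ n)%C by (rewrite gz by auto; field; auto).
      rewrite (Q z), ga. simpl. field. split; [|apply Csub_neq_0, m]. auto. }
    assert (l0 : q a <> 0%C).
    { intros E. apply cs. apply (cont_ext q); auto. apply near_true. intros z.
      destruct (classic (z = a)) as [->|m]; [|auto]. now rewrite ga. }
    refine (near_imp a _ _ _ (cont_neq _ _ _ cq l0)). intros z hz m F.
    apply hz. rewrite (QE z m), gz, F by auto. unfold Cdiv. ring.
Qed.

(** * Connectedness and compactness in the plane *)

Lemma Cmult_eq_0 (z w : C) : (z * w)%C = 0%C -> z = 0%C \/ w = 0%C.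
Proof.
  intros E. apply NNPP. intros N. apply not_or_and in N as [n1 n2].
  apply (Cmult_neq_0 z w); assumption.
Qed.

Definition clopen_in (A P : C -> Prop) : Prop :=
  (forall z, A z -> P z -> near z (fun w => A w -> P w)) /\
  (forall z, A z -> ~ P z -> near z (fun w => A w -> ~ P w)).

Definition connected (A : C -> Prop) : Prop :=
  forall P, clopen_in A P -> forall z w, A z -> A w -> P z -> P w.

Lemma near_segment z v r P : near (z + RtoC r * v)%C P ->
  exists d, 0 < d /\ forall s, Rabs (s - r) < d -> P (z + RtoC s * v)%C.
Proof.
  intros (e & he & H). pose proof (Cmod_ge_0 v) as hv.
  exists (e / (Cmod v + 1)). split; [apply Rdiv_lt_0_compat; lra|]. intros s hs.
  apply H. replace (z + RtoC s * v - (z + RtoC r * v))%C with (RtoC (s - r) * v)%C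
    by (rewrite RtoC_minus; ring).
  rewrite Cmod_mult, Cmod_R. apply Rlt_div_r in hs; [|lra].
  pose proof (Rabs_pos (s - r)). nra.
Qed.

(** Let m be the supremum of the initial stretches of the segment on which P holds. P holds at m
    since its complement is open in A, and beyond m, unless m = 1, since P is open in A. *)
Lemma segment_joined (A P : C -> Prop) z w : clopen_in A P ->
  (forall r, 0 <= r <= 1 -> A (z + RtoC r * (w - z))%C) -> P z -> P w.
Proof.
  intros [h1 h2] hA hz.
  set (g := fun r => (z + RtoC r * (w - z))%C) in *.
  assert (g0 : g 0 = z) by (unfold g; ring). assert (g1 : g 1 = w) by (unfold g; ring).
  set (S := fun r => 0 <= r <= 1 /\ forall s, 0 <= s <= r -> P (g s)).
  assert (S0 : S 0).
  { split; [lra|]. intros s hs. replace s with 0 by lra. now rewrite g0. }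
  destruct (completeness S) as (m & U & L).
  { exists 1. intros r [hr _]. lra. }
  { now exists 0. }
  assert (m0 : 0 <= m) by (apply U, S0).
  assert (m1 : m <= 1) by (apply L; intros r [hr _]; lra).
  assert (below : forall s, 0 <= s < m -> P (g s)).
  { intros s hs. apply NNPP. intros N. assert (m <= s); [|lra].
    apply L. intros r [hr Hr]. apply Rnot_lt_le. intros k. apply N, Hr. lra. }
  assert (Pm : P (g m)).
  { apply NNPP. intros N.
    destruct (near_segment _ _ _ _ (h2 _ (hA m (conj m0 m1)) N)) as (d & hd & H).
    destruct (Req_dec m 0) as [e|e]; [apply N; rewrite e, g0; exact hz|].
    set (s := Rmax 0 (m - d / 2)).
    assert (hs : 0 <= s < m /\ Rabs (s - m) < d).
    { unfold s, Rmax. destruct (Rle_dec 0 (m - d / 2)); (split; [lra|]);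
      rewrite Rabs_left; lra. }
    apply (H s); [apply hs|apply hA; lra|apply below, hs]. }
  destruct (near_segment _ _ _ _ (h1 _ (hA m (conj m0 m1)) Pm)) as (d & hd & H).
  destruct (Rlt_dec m 1) as [l|l].
  - assert (K : S (Rmin 1 (m + d / 2))).
    { assert (hM : m <= Rmin 1 (m + d / 2) <= 1 /\ Rmin 1 (m + d / 2) <= m + d / 2).
      { unfold Rmin. destruct (Rle_dec 1 (m + d / 2)); lra. }
      split; [lra|]. intros s hs. destruct (Rlt_dec s m) as [k|k]; [apply below; lra|].
      apply (H s); [|apply hA; lra]. rewrite Rabs_pos_eq; lra. }
    apply U in K. unfold Rmin in K. destruct (Rle_dec 1 (m + d / 2)); lra.
  - replace m with 1 in Pm by lra. now rewrite g1 in Pm.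
Qed.

Definition convex (A : C -> Prop) : Prop :=
  forall z w r, A z -> A w -> 0 <= r <= 1 -> A (z + RtoC r * (w - z))%C.

Lemma convex_connected A : convex A -> connected A.
Proof. intros cA P hP z w hz hw. apply (segment_joined A); auto. Qed.

Lemma convex_gt (l : C -> R) k :
  (forall z w r, l (z + RtoC r * (w - z))%C = (1 - r) * l z + r * l w) ->
  convex (fun z => k < l z).
Proof.
  intros E z w r hz hw hr. rewrite E.
  destruct (Req_dec r 0) as [->|n]; [lra|].
  assert (k * r < r * l w) by nra. assert ((1 - r) * k <= (1 - r) * l z) by nra. lra.
Qed.

Lemma convex_and A B : convex A -> convex B -> convex (fun z => A z /\ B z).
Proof. intros hA hB z w r [h1 h2] [k1 k2] hr. split; auto. Qed.

Lemma convex_Re_gt k : convex (fun z => k < Re z).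
Proof. apply convex_gt. intros z w r. simpl. unfold Re, Im. ring. Qed.

Lemma convex_Re_lt k : convex (fun z => Re z < k).
Proof.
  intros z w r hz hw hr. apply Ropp_lt_cancel.
  apply (convex_gt (fun z => - Re z) (- k)); auto; try lra.
  intros. simpl. unfold Re, Im. ring.
Qed.

Lemma convex_Im_gt k : convex (fun z => k < Im z).
Proof. apply convex_gt. intros z w r. simpl. unfold Re, Im. ring. Qed.

Lemma convex_Im_lt k : convex (fun z => Im z < k).
Proof.
  intros z w r hz hw hr. apply Ropp_lt_cancel.
  apply (convex_gt (fun z => - Im z) (- k)); auto; try lra.
  intros. simpl. unfold Re, Im. ring.
Qed.

Lemma osquare_iff p r z : osquare p r z <->
  ((Re p - r < Re z /\ Re z < Re p + r) /\ (Im p - r < Im z /\ Im z < Im p + r)).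
Proof.
  split.
  - intros [h1 h2]. apply Rabs_def2 in h1, h2. lra.
  - intros [h1 h2]. split; apply Rabs_def1; lra.
Qed.

Lemma convex_osquare p r : convex (osquare p r).
Proof.
  intros z w s hz hw hs. rewrite osquare_iff in *.
  apply (convex_and _ _
   (convex_and _ _ (convex_Re_gt (Re p - r)) (convex_Re_lt (Re p + r)))
   (convex_and _ _ (convex_Im_gt (Im p - r)) (convex_Im_lt (Im p + r)))); auto.
Qed.

Lemma plane_connected : connected (fun _ => True).
Proof. apply convex_connected. intros z w r _ _ _. exact I. Qed.

Lemma near_exists_neq z P : near z P -> exists w, w <> z /\ P w.
Proof.
  intros (d & hd & H). exists (z + RtoC (d / 2))%C.
  assert (E : (z + RtoC (d / 2) - z)%C = RtoC (d / 2)) by ring. split.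
  - intros F. rewrite F in E. replace (z - z)%C with (RtoC 0) in E by ring.
    apply RtoC_inj in E. lra.
  - apply H. rewrite E, Cmod_R, Rabs_pos_eq; lra.
Qed.

(** When p lies on the segment from z to w, the detour passes through a point q displaced from p
    perpendicularly to the segment, and close enough to p to stay in A. *)
Lemma punctured_connected A p : convex A -> (forall z, A z -> near z A) ->
  connected (fun z => A z /\ z <> p).
Proof.
  intros cA oA P hP z w [hz zp] [hw wp] Pz.
  destruct (classic (exists r, 0 <= r <= 1 /\ (z + RtoC r * (w - z))%C = p))
    as [(r & hr & E)|N].
  - assert (zw : z <> w).
    { intros <-. apply zp. rewrite <- E. ring. }
    apply Csub_neq_0 in zw as zw'.
    assert (hp : A p) by (rewrite <- E; auto).
    assert (oA' := oA p hp).
    replace p with (p + RtoC 0 * (Ci * (w - z)))%C in oA' at 1 by ring.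
    destruct (near_segment _ _ _ _ oA') as (d & hd & H).
    set (e := d / 2).
    assert (hq : A (p + RtoC e * (Ci * (w - z)))%C).
    { apply H. unfold e. rewrite Rminus_0_r, Rabs_pos_eq; lra. }
    set (q := (p + RtoC e * (Ci * (w - z)))%C) in *.
    (* w - z and i (w - z) are independent over the reals, so a path point equals p only if both
       real coordinates vanish. *)
    assert (nz : forall x y : R, ((RtoC x + Ci * RtoC y) * (w - z))%C = 0%C -> x = 0 /\ y = 0).
    { intros x y F. apply Cmult_eq_0 in F as [F|F].
      - split; [apply (f_equal Re) in F|apply (f_equal Im) in F]; simpl in F; lra.
      - exfalso. apply zw'. replace (z - w)%C with (- (w - z))%C by ring. rewrite F. ring. }
    apply (segment_joined (fun z => A z /\ z <> p) P q w hP).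
    { intros s hs. split; [apply cA; auto|]. intros F.
      destruct (nz (s * (1 - r)) (e * (1 - s))) as [n1 n2].
      - rewrite !RtoC_mult, !RtoC_minus.
        transitivity (q + RtoC s * (w - q) - p)%C; [|rewrite F; ring].
        unfold q. rewrite <- E. ring.
      - unfold e in n2. assert (s = 1) by nra. assert (r = 1) by nra.
        apply wp. rewrite <- E. subst r. ring. }
    apply (segment_joined (fun z => A z /\ z <> p) P z q hP); auto.
    intros s hs. split; [apply cA; auto|]. intros F.
    destruct (nz (s * r - r) (s * e)) as [n1 n2].
    + rewrite RtoC_minus, !RtoC_mult.
      transitivity (z + RtoC s * (q - z) - p)%C; [|rewrite F; ring].
      unfold q. rewrite <- E. ring.
    + unfold e in n2. assert (s = 0) by nra. assert (r = 0) by nra.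
      apply zp. rewrite <- E. subst r. ring.
  - apply (segment_joined (fun z => A z /\ z <> p) P z w hP); auto.
    intros r hr. split; [apply cA; auto|]. intros F. apply N. now exists r.
Qed.

(** The exterior of a square is a union of four half-planes, and consecutive ones share one of the
    points c1, ..., c4. *)
Lemma exterior_connected k : 0 <= k ->
  connected (fun z => k < Rabs (Re z) \/ k < Rabs (Im z)).
Proof.
  intros hk P hP.
  set (A := fun z : C => k < Rabs (Re z) \/ k < Rabs (Im z)) in *.
  assert (half : forall B, convex B -> (forall z, B z -> A z) ->
     forall z w, B z -> B w -> P z -> P w).
  { intros B cB sB z w hz hw. apply (segment_joined A P z w hP). intros r hr. auto. }
  assert (neg : forall x, x < - k -> k < Rabs x) by (intros x hx; rewrite Rabs_left; lra).
  assert (R1 := half _ (convex_Re_gt k)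
    (fun z h => or_introl (Rlt_le_trans _ _ _ h (Rle_abs (Re z))))).
  assert (I1 := half _ (convex_Im_gt k)
    (fun z h => or_intror (Rlt_le_trans _ _ _ h (Rle_abs (Im z))))).
  assert (R2 := half _ (convex_Re_lt (- k))
    (fun z h => or_introl (neg _ h))).
  assert (I2 := half _ (convex_Im_lt (- k))
    (fun z h => or_intror (neg _ h))).
  cbv beta in R1, I1, R2, I2. clear half.
  set (c1 := (k + 1, k + 1) : C). set (c2 := (- (k + 1), k + 1) : C).
  set (c3 := (- (k + 1), - (k + 1)) : C). set (c4 := (k + 1, - (k + 1)) : C).
  assert (key : forall z, A z -> (P z <-> P c1)).
  { assert (E12 : P c1 <-> P c2) by (split; apply I1; simpl; lra).
    assert (E23 : P c2 <-> P c3) by (split; apply R2; simpl; lra).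
    assert (E34 : P c3 <-> P c4) by (split; apply I2; simpl; lra).
    intros z [h|h]; unfold Rabs in h; destruct (Rcase_abs _) as [g|g].
    - rewrite E12. split; apply R2; simpl; lra.
    - split; apply R1; simpl; lra.
    - rewrite E12, E23. split; apply I2; simpl; lra.
    - split; apply I1; simpl; lra. }
  intros z w hz hw Pz. apply key; auto. apply (key z); auto.
Qed.

(** A relatively clopen P extends across Z: by [punctured_connected] it is constant on small
    punctured squares, and this constant value, recorded by [P'], is clopen in A. *)
Lemma connected_remove_discrete A Z : connected A ->
  (forall z, A z -> near z (fun w => A w /\ (w <> z -> ~ Z w))) ->
  connected (fun z => A z /\ ~ Z z).
Proof.
  intros cA hZ P [P1 P2] z w [hz zZ] [hw wZ] Pz.
  set (P' := fun z => near z (fun w => w <> z -> P w)).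
  assert (const : forall z, A z -> near z (fun w => w <> z -> P w) \/
                                   near z (fun w => w <> z -> ~ P w)).
  { intros a ha. destruct (proj1 (near_iff_osquare _ _) (hZ a ha)) as (r & hr & H).
    assert (K := punctured_connected (osquare a r) a (convex_osquare a r) (near_osquare a r) P).
    assert (hP : clopen_in (fun z => osquare a r z /\ z <> a) P).
    { assert (sub : forall z, osquare a r z /\ z <> a -> A z /\ ~ Z z).
      { intros v [v1 v2]. destruct (H v v1). auto. }
      split; intros v hv Pv.
      - refine (near_imp v _ _ _ (P1 v (sub v hv) Pv)). auto.
      - refine (near_imp v _ _ _ (P2 v (sub v hv) Pv)). auto. }
    specialize (K hP).
    destruct (classic (exists v, (osquare a r v /\ v <> a) /\ P v)) as [(v & hv & Pv)|N].
    - left. refine (near_imp a _ _ _ (near_osquare a r a (osquare_center a r hr))).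
      intros u hu n. apply (K v u); auto.
    - right. refine (near_imp a _ _ _ (near_osquare a r a (osquare_center a r hr))).
      intros u hu n Pu. apply N. exists u. auto. }
  assert (spread : forall (Q : C -> Prop) a, near a (fun w => w <> a -> Q w) ->
     near a (fun v => near v (fun w => w <> v -> Q w))).
  { intros Q a h. refine (near_imp a _ _ _ (near_and _ _ _ h (near_near _ _ h))).
    intros v [q1 q2]. destruct (classic (v = a)) as [->|n]; auto.
    refine (near_imp v _ _ _ (near_and _ _ _ q2 (near_neq v a n))).
    intros u [u1 u2] _. auto. }
  assert (excl : forall a, near a (fun w => w <> a -> P w) ->
     near a (fun w => w <> a -> ~ P w) -> False).
  { intros a h1 h2. destruct (near_exists_neq _ _ (near_and _ _ _ h1 h2)) as (v & n & v1 & v2).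
    apply v2; auto. }
  assert (iff : forall a, A a -> ~ Z a -> (P a <-> P' a)).
  { intros a ha na. split; intros Pa.
    - refine (near_imp a _ _ _ (near_and _ _ _ (P1 a (conj ha na) Pa) (hZ a ha))).
      intros v [v1 [v2 v3]] n. auto.
    - apply NNPP. intros N. apply (excl a Pa).
      refine (near_imp a _ _ _ (near_and _ _ _ (P2 a (conj ha na) N) (hZ a ha))).
      intros v [v1 [v2 v3]] n. auto. }
  apply iff; auto. apply (cA P') with z; auto.
  - split; intros a ha Pa.
    + refine (near_imp a _ _ _ (spread P a Pa)). auto.
    + destruct (const a ha) as [h|h]; [contradiction|].
      refine (near_imp a _ _ _ (spread (fun z => ~ P z) a h)).
      intros v hv _ Pv. apply (excl v Pv hv).
  - apply iff; auto.
Qed.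

(** A finite subcover for an increasing sequence of conditions; the sum of the indices of the four
    quarters serves the whole. *)
Lemma compact_rect (Q : nat -> C -> Prop) a b c d : a <= b -> c <= d ->
  (forall n m z, (n <= m)%nat -> Q n z -> Q m z) ->
  (forall z, in_rect a b c d z -> exists n, near z (Q n)) ->
  exists n, forall z, in_rect a b c d z -> Q n z.
Proof.
  intros hab hcd mono H.
  apply (rect_bisection (fun a b c d => exists n, forall z, in_rect a b c d z -> Q n z)); auto.
  - clear a b c d hab hcd H.
    intros a b c d hab hcd [n1 H1] [n2 H2] [n3 H3] [n4 H4].
    exists (n1 + n2 + n3 + n4)%nat. intros z [h1 h2].
    destruct (Rle_dec (Re z) ((a + b) / 2)); destruct (Rle_dec (Im z) ((c + d) / 2)).
    + apply (mono n1); [lia|]. apply H1. split; lra.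
    + apply (mono n3); [lia|]. apply H3. split; lra.
    + apply (mono n2); [lia|]. apply H2. split; lra.
    + apply (mono n4); [lia|]. apply H4. split; lra.
  - intros z hz. destruct (H z hz) as (n & e & he & K).
    exists (e / 2). split; [lra|]. intros a' b' c' d' _ _ _ _ hz' l1 l2.
    exists n. intros w hw. apply K. pose proof (rect_Cmod _ _ _ _ _ _ hz' hw). lra.
Qed.

(** * Counting ends *)

Section Ends.
Variables (O : C -> Prop) (y : C -> C).
Hypothesis y_in : forall t, O (y t).
Hypothesis y_cont : forall t, cont y t.
Hypothesis y_onto : forall z, O z -> exists t, y t = z.
Hypothesis y_open : forall t Q, near t Q ->
  near (y t) (fun z => exists t', Q t' /\ y t' = z).

(** A puncture of A, that is, one end of A. *)
Definition isolated (A : C -> Prop) (a : C) : Prop :=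
  ~ A a /\ near a (fun z => z <> a -> A z).

Lemma rect_image_avoids a s t u v : s <= t -> u <= v -> ~ O a ->
  near a (fun z => forall w, in_rect s t u v w -> y w <> z).
Proof.
  intros hst huv na.
  (* Compactness gives the image of the rectangle a positive distance from a, which it misses. *)
  destruct (compact_rect (fun n w => / INR (S n) < Cmod (y w - a)) s t u v) as (n & K); auto.
  - intros n m w hnm hw. eapply Rle_lt_trans; [|exact hw].
    apply Rinv_le_contravar; [apply lt_0_INR; lia|]. apply le_INR. lia.
  - intros w _.
    assert (h : 0 < Cmod (y w - a)).
    { apply Cmod_sub_gt_0. intros E. apply na. rewrite <- E. apply y_in. }
    destruct (archimed_cor1 (Cmod (y w - a) / 2)) as (N & hN & N0); [lra|].
    exists (pred N). replace (S (pred N)) with N by lia.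
    refine (near_imp w _ _ _ (y_cont w (Cmod (y w - a) / 2) _)); [|lra].
    intros w' hw'. pose proof (Cmod_sub_triangle (y w) (y w') a).
    rewrite (Cmod_sub_sym (y w) (y w')) in H. lra.
  - exists (/ INR (S n)). split; [apply Rinv_0_lt_compat, lt_0_INR; lia|].
    intros z hz w hw E. specialize (K w hw). cbv beta in K. rewrite E in K. lra.
Qed.

Lemma rect_image_bounded s t u v : s <= t -> u <= v ->
  exists M, forall w, in_rect s t u v w -> Cmod (y w) <= M.
Proof.
  intros hst huv.
  destruct (compact_rect (fun n w => Cmod (y w) <= INR n) s t u v) as (n & K); auto.
  - intros n m w hnm hw. apply le_INR in hnm. lra.
  - intros w _. destruct (INR_unbounded (Cmod (y w) + 1)) as [n hn]. exists n.
    refine (near_imp w _ _ _ (cont_bounded _ _ (y_cont w))). intros. simpl. lra.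
  - exists (INR n). exact K.
Qed.

Lemma near_not_square a r z : ~ square a r z -> near z (fun w => ~ square a r w).
Proof.
  intros H. apply near_iff_osquare.
  assert (B : exists d, 0 < d /\ (d <= Re a - r - Re z \/ d <= Re z - (Re a + r) \/
                d <= Im a - r - Im z \/ d <= Im z - (Im a + r))).
  { apply NNPP. intros N. apply H.
    assert (L : forall x, ~ (0 < x /\ (x <= Re a - r - Re z \/ x <= Re z - (Re a + r) \/
                x <= Im a - r - Im z \/ x <= Im z - (Im a + r)))).
    { intros x hx. apply N. now exists x. }
    pose proof (L (Re a - r - Re z)). pose proof (L (Re z - (Re a + r))).
    pose proof (L (Im a - r - Im z)). pose proof (L (Im z - (Im a + r))).
    unfold square, in_rect. lra. }
  destruct B as (d & hd & B). exists d. split; [exact hd|]. intros w hw [h1 h2].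
  apply osquare_iff in hw. lra.
Qed.

Lemma square_cases a r z : square a r z -> square_bdry a r z \/ osquare a r z.
Proof.
  intros H. destruct (classic (square_bdry a r z)) as [h|h]; [left; exact h|right].
  apply osquare_iff. unfold square_bdry, on_bdry in h. fold (square a r) in h.
  destruct H as [h1 h2].
  assert (n1 : Re z <> Re a - r) by (intros E; apply h; split; [split; assumption|auto]).
  assert (n2 : Re z <> Re a + r) by (intros E; apply h; split; [split; assumption|auto]).
  assert (n3 : Im z <> Im a - r) by (intros E; apply h; split; [split; assumption|auto]).
  assert (n4 : Im z <> Im a + r) by (intros E; apply h; split; [split; assumption|auto]).
  lra.
Qed.

Lemma not_bdry_osquare a r z : osquare a r z -> ~ square_bdry a r z.
Proof. intros h [_ k]. apply osquare_iff in h. lra. Qed.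

Lemma bdry_neq_center a r z : 0 < r -> square_bdry a r z -> z <> a.
Proof.
  intros hr h ->. apply (not_bdry_osquare a r a); auto. now apply osquare_center.
Qed.

(** S exhausts the time plane, by boxes in the injective case and by strips in the periodic one. As
    y is open, the images of the S n exhaust the compact boundary. *)
Lemma bdry_covered a r (S : nat -> C -> Prop) : 0 < r ->
  (forall z, square a r z -> z <> a -> O z) ->
  (forall n m t, (n <= m)%nat -> S n t -> S m t) ->
  (forall t, exists n, near t (S n)) ->
  exists n, forall z, square_bdry a r z -> exists t, S n t /\ y t = z.
Proof.
  intros hr hO mono cov.
  destruct (compact_rect (fun n z => square_bdry a r z -> exists t, S n t /\ y t = z)
     (Re a - r) (Re a + r) (Im a - r) (Im a + r)) as (n & K); try lra.
  - intros n m z hnm h hz. destruct (h hz) as (t & ht & E). exists t. eauto.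
  - intros z hz. destruct (square_cases a r z hz) as [hb|ho].
    + destruct (y_onto z (hO z hz (bdry_neq_center a r z hr hb))) as (t & E).
      destruct (cov t) as (n & hn). exists n. rewrite <- E.
      refine (near_imp _ _ _ _ (y_open t _ hn)). auto.
    (* [compact_rect] ranges over the full square; at interior points the condition on boundary
       points is vacuous nearby. *)
    + exists 0%nat. refine (near_imp _ _ _ _ (near_osquare _ _ _ ho)).
      intros w hw hb. exfalso. apply (not_bdry_osquare a r w); assumption.
  - exists n. intros z hz. apply K; auto. apply hz.
Qed.

(** H plays the part of a neighbourhood of an end of the time plane: being connected, it is mapped
    entirely inside or entirely outside a square whose boundary it misses. *)
Lemma stays_inside a r H : connected H -> ~ O a ->
  (forall t, H t -> ~ square_bdry a r (y t)) ->
  forall t u, H t -> H u -> osquare a r (y t) -> osquare a r (y u).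
Proof.
  intros cH na nb t u ht hu. apply (cH (fun t => osquare a r (y t))); auto.
  split.
  - intros v hv pv. refine (near_imp v _ _ _ (cont_near y v _ (y_cont v) (near_osquare _ _ _ pv))).
    auto.
  - intros v hv pv.
    assert (ns : ~ square a r (y v)).
    { intros h. destruct (square_cases _ _ _ h); [apply (nb v)|]; auto. }
    refine (near_imp v _ _ _ (cont_near y v _ (y_cont v) (near_not_square _ _ _ ns))).
    intros w hw _ h. apply hw, osquare_square, h.
Qed.

Lemma isolating_squares a b : isolated O a -> isolated O b -> a <> b ->
  exists r, 0 < r /\ (forall z, square a r z -> z <> a -> O z) /\
    (forall z, square b r z -> z <> b -> O z) /\
    (forall z, square a r z -> square b r z -> False).
Proof.
  intros [_ ha] [_ hb] n.
  destruct (near_square _ _ ha) as (r1 & h1 & K1).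
  destruct (near_square _ _ hb) as (r2 & h2 & K2).
  pose proof (Cmod_sub_gt_0 _ _ n) as h3.
  exists (Rmin (Rmin r1 r2) (Cmod (a - b) / 5)).
  assert (L1 : Rmin (Rmin r1 r2) (Cmod (a - b) / 5) <= r1)
    by (eapply Rle_trans; [apply Rmin_l|apply Rmin_l]).
  assert (L2 : Rmin (Rmin r1 r2) (Cmod (a - b) / 5) <= r2)
    by (eapply Rle_trans; [apply Rmin_l|apply Rmin_r]).
  assert (L3 : Rmin (Rmin r1 r2) (Cmod (a - b) / 5) <= Cmod (a - b) / 5) by apply Rmin_r.
  assert (L0 : 0 < Rmin (Rmin r1 r2) (Cmod (a - b) / 5))
    by (repeat apply Rmin_glb_lt; lra).
  set (r := Rmin (Rmin r1 r2) (Cmod (a - b) / 5)) in *. clearbody r.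
  split; [exact L0|]. split; [|split].
  - intros z hz. apply K1. unfold square, in_rect in *. lra.
  - intros z hz. apply K2. unfold square, in_rect in *. lra.
  - intros z hz1 hz2. apply square_Cmod in hz1, hz2.
    pose proof (Cmod_sub_triangle a z b) as T. rewrite (Cmod_sub_sym a z) in T. lra.
Qed.

(** O contains points arbitrarily close to a, and the compact image of the time rectangle misses
    those close enough, so they are attained at other times only. *)
Lemma reaches_puncture a r s t u v : 0 < r -> s <= t -> u <= v -> isolated O a ->
  exists w, osquare a r (y w) /\ forall w', in_rect s t u v w' -> y w' <> y w.
Proof.
  intros hr hst huv [na ha].
  destruct (near_exists_neq _ _ (near_and _ _ _ ha (near_and _ _ _
    (near_osquare a r a (osquare_center a r hr)) (rect_image_avoids a s t u v hst huv na))))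
    as (z & n & z1 & z2 & z3).
  destruct (y_onto z (z1 n)) as (w & E). exists w. rewrite E. auto.
Qed.

Definition box (k : R) : C -> Prop := in_rect (- k) k (- k) k.

Lemma box_iff k z : ~ box k z <-> (k < Rabs (Re z) \/ k < Rabs (Im z)).
Proof.
  unfold box, in_rect. split.
  - intros N. apply NNPP. intros M. apply not_or_and in M as [m1 m2].
    apply Rnot_lt_le, Rabs_le_between in m1. apply Rnot_lt_le, Rabs_le_between in m2. auto.
  - intros h [k1 k2]. apply Rabs_le_between in k1, k2. lra.
Qed.

Lemma box_cover t : exists n, near t (box (INR n)).
Proof.
  destruct (INR_unbounded (Cmod t + 1)) as [n hn]. exists n.
  refine (near_imp t _ _ _ (cont_bounded (fun w => w) t (cont_id t))). intros w hw.
  pose proof (re_le_Cmod w). pose proof (im_le_Cmod w).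
  split; apply Rabs_le_between; lra.
Qed.

(** By injectivity the boundaries of two small squares around a and b are attained only at times in
    some box. The exterior of the box is connected and cannot cross them, yet it must enter both
    disjoint squares. *)
Lemma no_two_punctures_injective a b :
  (forall t u, y t = y u -> t = u) ->
  isolated O a -> isolated O b -> a <> b -> False.
Proof.
  intros inj ha hb n. destruct (isolating_squares a b ha hb n) as (r & hr & Oa & Ob & dis).
  assert (mono : forall n m t, (n <= m)%nat -> box (INR n) t -> box (INR m) t).
  { intros i j t hij [h1 h2]. apply le_INR in hij. split; lra. }
  destruct (bdry_covered a r (fun n => box (INR n)) hr Oa mono box_cover) as (n1 & K1).
  destruct (bdry_covered b r (fun n => box (INR n)) hr Ob mono box_cover) as (n2 & K2).
  set (k := INR (n1 + n2)). assert (hk : 0 <= k) by apply pos_INR.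
  set (H := fun z : C => k < Rabs (Re z) \/ k < Rabs (Im z)).
  assert (cH : connected H) by (apply exterior_connected, hk).
  assert (NH : forall t, H t -> ~ box k t) by (intros t; apply box_iff).
  assert (na : forall t, H t -> ~ square_bdry a r (y t)).
  { intros t ht hb'. destruct (K1 _ hb') as (u & hu & E). apply inj in E. subst u.
    apply (NH t ht). apply (mono n1); [lia|exact hu]. }
  assert (nb : forall t, H t -> ~ square_bdry b r (y t)).
  { intros t ht hb'. destruct (K2 _ hb') as (u & hu & E). apply inj in E. subst u.
    apply (NH t ht). apply (mono n2); [lia|exact hu]. }
  assert (out : forall w, (forall w', box k w' -> y w' <> y w) -> H w).
  { intros w hw. apply box_iff. intros h. apply (hw w h). reflexivity. }
  destruct (reaches_puncture a r (- k) k (- k) k) as (t & t1 & t2); auto; try lra.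
  destruct (reaches_puncture b r (- k) k (- k) k) as (u & u1 & u2); auto; try lra.
  apply (dis (y u)); apply osquare_square; [|exact u1].
  apply (stays_inside a r H cH (proj1 ha) na t u); auto.
Qed.

Lemma period_Z p : (forall t, y (t + p)%C = y t) ->
  forall (k : Z) t, y (t + RtoC (IZR k) * p)%C = y t.
Proof.
  intros per k. pattern k. apply Z.peano_ind.
  - intros t. f_equal. ring.
  - intros i IH t. rewrite succ_IZR, RtoC_plus.
    replace (t + (RtoC (IZR i) + 1) * p)%C with ((t + RtoC (IZR i) * p) + p)%C by ring.
    now rewrite per, IH.
  - intros i IH t. rewrite <- (IH t). unfold Z.pred. rewrite plus_IZR, RtoC_plus.
    rewrite <- (per (t + (RtoC (IZR i) + RtoC (IZR (- 1))) * p)%C). f_equal.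
    replace (RtoC (IZR (- 1))) with (- (1))%C by (rewrite <- RtoC_opp; f_equal; simpl; ring).
    ring.
Qed.

Lemma reduce_real x : exists k : Z, 0 <= x + IZR k <= 1.
Proof.
  exists (- (up x - 1))%Z. destruct (archimed x) as [h1 h2].
  rewrite opp_IZR, minus_IZR. lra.
Qed.

Lemma reduce_Re t : (forall t, y (t + 1)%C = y t) ->
  exists u, 0 <= Re u <= 1 /\ Im u = Im t /\ y u = y t.
Proof.
  intros per. destruct (reduce_real (Re t)) as [k hk].
  exists (t + RtoC (IZR k) * 1)%C. rewrite (period_Z 1 per).
  simpl. unfold Re, Im in *. repeat split; try ring; lra.
Qed.

(** The independent periods 1 and p move every time into the rectangle [0, 1] x [-q, q] without
    changing y; its compact image would be all of O and could not approach a. *)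
Lemma no_puncture_doubly_periodic a p : (forall t, y (t + 1)%C = y t) ->
  (forall t, y (t + p)%C = y t) -> Im p <> 0 -> isolated O a -> False.
Proof.
  intros per1 perp hp ha.
  set (q := Rabs (Im p)). assert (hq : 0 <= q) by apply Rabs_pos.
  destruct (reaches_puncture a 1 0 1 (- q) q) as (w & _ & N); auto; try lra.
  destruct (reduce_real (Im w / Im p)) as [k hk].
  destruct (reduce_Re (w + RtoC (IZR k) * p)%C per1) as (u & u1 & u2 & u3).
  apply (N u).
  - split; [exact u1|]. apply Rabs_le_between. rewrite u2.
    replace (Im (w + RtoC (IZR k) * p)%C) with ((Im w / Im p + IZR k) * Im p)
      by (simpl; unfold Re, Im in *; field; exact hp).
    rewrite Rabs_mult, (Rabs_pos_eq (_ + _)) by lra. unfold q.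
    pose proof (Rabs_pos (Im p)). nra.
  - rewrite u3. apply period_Z, perp.
Qed.

(** Fibres lie on horizontal lines, so outside some strip y avoids the boundaries of both small
    squares. Both punctures are approached there, hence one of the two remaining half-planes is
    trapped near a and the other near b. As the strip modulo 1 has bounded image, O would be
    bounded. *)
Lemma no_two_punctures_periodic a b : (forall t, y (t + 1)%C = y t) ->
  (forall t u, y t = y u -> Im t = Im u) ->
  (forall M, exists z, O z /\ M < Cmod z) ->
  isolated O a -> isolated O b -> a <> b -> False.
Proof.
  intros per fib unb ha hb n.
  destruct (isolating_squares a b ha hb n) as (r & hr & Oa & Ob & dis).
  set (strip := fun (n : nat) (t : C) => - INR n <= Im t <= INR n).
  assert (mono : forall n m t, (n <= m)%nat -> strip n t -> strip m t).
  { intros i j t hij h. apply le_INR in hij. unfold strip in *. lra. }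
  assert (cov : forall t, exists n, near t (strip n)).
  { intros t. destruct (box_cover t) as [i hi]. exists i.
    refine (near_imp t _ _ _ hi). intros w hw. apply hw. }
  destruct (bdry_covered a r strip hr Oa mono cov) as (n1 & K1).
  destruct (bdry_covered b r strip hr Ob mono cov) as (n2 & K2).
  set (m := (n1 + n2)%nat). set (k := INR m). assert (hk : 0 <= k) by apply pos_INR.
  assert (stripE : forall t u, strip m u -> y u = y t -> strip m t).
  { intros t u hu E. apply fib in E. unfold strip in *. rewrite <- E. exact hu. }
  assert (na : forall t, ~ strip m t -> ~ square_bdry a r (y t)).
  { intros t ht h. destruct (K1 _ h) as (u & hu & E). apply ht, (stripE t u); auto.
    apply (mono n1); [lia|exact hu]. }
  assert (nb : forall t, ~ strip m t -> ~ square_bdry b r (y t)).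
  { intros t ht h. destruct (K2 _ h) as (u & hu & E). apply ht, (stripE t u); auto.
    apply (mono n2); [lia|exact hu]. }
  assert (out : forall w, (forall w', in_rect 0 1 (- k) k w' -> y w' <> y w) -> ~ strip m w).
  { intros w hw h. destruct (reduce_Re w per) as (u & u1 & u2 & u3).
    apply (hw u); [|exact u3]. split; [exact u1|]. rewrite u2. exact h. }
  destruct (reaches_puncture a r 0 1 (- k) k) as (t & t1 & t2); auto; try lra.
  destruct (reaches_puncture b r 0 1 (- k) k) as (u & u1 & u2); auto; try lra.
  apply out in t2, u2.
  assert (cU := convex_connected _ (convex_Im_gt k)).
  assert (cL := convex_connected _ (convex_Im_lt (- k))).
  assert (half : forall w, ~ strip m w -> k < Im w \/ Im w < - k).
  { intros w hw. unfold strip in hw. fold k in hw. lra. }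
  assert (upper : forall w, k < Im w -> ~ strip m w).
  { intros w hw h. unfold strip in h. fold k in h. lra. }
  assert (lower : forall w, Im w < - k -> ~ strip m w).
  { intros w hw h. unfold strip in h. fold k in h. lra. }
  assert (aU := stays_inside a r _ cU (proj1 ha) (fun t h => na t (upper t h))).
  assert (aL := stays_inside a r _ cL (proj1 ha) (fun t h => na t (lower t h))).
  assert (bU := stays_inside b r _ cU (proj1 hb) (fun t h => nb t (upper t h))).
  assert (bL := stays_inside b r _ cL (proj1 hb) (fun t h => nb t (lower t h))).
  cbv beta in aU, aL, bU, bL.
  (* t and u cannot lie in the same half-plane, since its image would enter two disjoint squares; so
     each half-plane contains one of them and is trapped in the corresponding square. *)
  assert (all : forall w, ~ strip m w -> square a r (y w) \/ square b r (y w)).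
  { intros w hw.
    destruct (half t t2) as [ht|ht]; destruct (half u u2) as [hu|hu];
      destruct (half w hw) as [h|h];
      try (exfalso; apply (dis (y u)); apply osquare_square;
           [eauto|exact u1]; fail);
      [left|right|right|left]; apply osquare_square; eauto. }
  destruct (rect_image_bounded 0 1 (- k) k) as (M & HM); try lra.
  destruct (unb (Rmax M (Cmod a + Cmod b + 2 * r))) as (z & Oz & hz).
  destruct (y_onto z Oz) as (w & E).
  pose proof (Rmax_l M (Cmod a + Cmod b + 2 * r)). pose proof (Rmax_r M (Cmod a + Cmod b + 2 * r)).
  pose proof (Cmod_ge_0 a). pose proof (Cmod_ge_0 b).
  destruct (classic (strip m w)) as [h|h].
  - destruct (reduce_Re w per) as (v & v1 & v2 & v3).
    specialize (HM v). rewrite v3, E in HM. enough (Cmod z <= M) by lra. apply HM.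
    split; [exact v1|]. rewrite v2. exact h.
  - rewrite <- E in hz. destruct (all w h) as [h'|h']; apply square_Cmod in h'.
    + pose proof (Cmod_triangle_rev (y w) a). lra.
    + pose proof (Cmod_triangle_rev (y w) b). lra.
Qed.
End Ends.

(** * Complete holomorphic flows without zeros on a plane domain *)

Lemma osquare_convex_bound f f' p r M z w : osquare p r z -> osquare p r w ->
  (forall v, osquare p r v -> deriv f v (f' v) /\ Cmod (f' v) <= M) ->
  Cmod (f w - f z) <= 2 * M * Cmod (w - z).
Proof.
  intros hz hw H. apply (mean_value_bound f (fun s => f' (z + RtoC s * (w - z))%C)).
  intros s hs. apply H. now apply convex_osquare.
Qed.

Section Flow.
Variables (O : C -> Prop) (h : C -> C).
Hypothesis O_open : forall z, O z -> near z O.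
Hypothesis h_hol : forall z, O z -> hol h z.
Hypothesis h_neq_0 : forall z, O z -> h z <> 0%C.

(* T inverts the flow near z0: along every integral curve, T increases like time. *)
Definition local_time (z0 : C) (r : R) (T : C -> C) : Prop :=
  0 < r /\ (forall z, osquare z0 r z -> O z /\ deriv T z (/ h z)%C) /\
  (forall z w, osquare z0 r z -> osquare z0 r w -> T z = T w -> z = w).

(** T is a primitive of 1/h on a square where 1/h stays within m/4 of its value at z0. The mean
    value bound doubles this, so T differs from a linear map of slope modulus m by an m/2-Lipschitz
    function and is injective. *)
Lemma local_time_exists z0 : O z0 -> exists r T, local_time z0 r T.
Proof.
  intros hz0. pose proof (h_neq_0 z0 hz0) as h0. set (m := Cmod (/ h z0)%C).
  assert (hm : 0 < m).
  { unfold m. rewrite Cmod_inv by exact h0. apply Rinv_0_lt_compat, Cmod_gt_0, h0. }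
  assert (ci : cont (fun z => / h z)%C z0) by (apply cont_inv; auto using hol_cont).
  destruct (proj1 (near_iff_osquare _ _) (near_and _ _ _ (O_open z0 hz0) (ci (m / 4) ltac:(lra))))
    as (r & hr & K).
  destruct (primitive_osquare (fun z => / h z)%C z0 r hr) as (T & HT).
  { intros z hz. apply hol_inv; [apply h_hol|apply h_neq_0]; apply K, hz. }
  exists r, T. split; [exact hr|]. split.
  - intros z hz. split; [apply K, hz|apply HT, hz].
  - intros z w hz hw E.
    assert (B := osquare_convex_bound (fun v => T v - (/ h z0) * v)%C
      (fun v => / h v - (0 * v + / h z0 * 1))%C z0 r (m / 4) z w hz hw).
    assert (B' : Cmod (T w - / h z0 * w - (T z - / h z0 * z))%C <= 2 * (m / 4) * Cmod (w - z)).
    { apply B. intros v hv. split.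
      - apply deriv_minus; [apply HT, hv|].
        apply (deriv_mult (fun _ => / h z0)%C (fun v => v)); [apply deriv_const|apply deriv_id].
      - replace (/ h v - (0 * v + / h z0 * 1))%C with (/ h v - / h z0)%C by ring.
        left. apply K, hv. }
    rewrite E in B'.
    replace (T w - / h z0 * w - (T w - / h z0 * z))%C with (/ h z0 * (z - w))%C in B' by ring.
    rewrite Cmod_mult, (Cmod_sub_sym z w) in B'. fold m in B'.
    pose proof (Cmod_ge_0 (w - z)). symmetry. apply Cmod_sub_eq_0. nra.
Qed.

Lemma local_time_along z0 r T x t0 : local_time z0 r T -> osquare z0 r (x t0) ->
  near t0 (fun t => deriv x t (h (x t))) ->
  near t0 (fun t => osquare z0 r (x t) /\ T (x t) = (T (x t0) + (t - t0))%C).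
Proof.
  intros (hr & HT & inj) h0 hx.
  assert (cx : cont x t0) by (apply (deriv_cont _ _ _ (near_self _ _ hx))).
  destruct (proj1 (near_iff_osquare _ _) (near_and _ _ _ hx
     (cont_near x t0 _ cx (near_osquare _ _ _ h0)))) as (d & hd & K).
  apply near_iff_osquare. exists d. split; [exact hd|]. intros t ht.
  split; [apply K, ht|].
  (* T (x t) - t has derivative 0, and the bound with M = 0 makes it constant. *)
  assert (B := osquare_convex_bound (fun t => T (x t) - t)%C
    (fun t => / h (x t) * h (x t) - 1)%C t0 d 0 t0 t (osquare_center _ _ hd) ht).
  assert (B' : Cmod (T (x t) - t - (T (x t0) - t0))%C <= 2 * 0 * Cmod (t - t0)).
  { apply B. intros v hv. destruct (K v hv) as [k1 k2]. destruct (HT _ k2) as [o D]. split.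
    - apply deriv_minus; [|apply deriv_id]. apply deriv_comp; assumption.
    - right. rewrite <- Cmod_0. f_equal. field. apply h_neq_0, o. }
  assert (E : (T (x t) - t - (T (x t0) - t0))%C = 0%C).
  { apply Cmod_eq_0. pose proof (Cmod_ge_0 (T (x t) - t - (T (x t0) - t0))%C). lra. }
  apply Csub_eq_0. rewrite <- E. ring.
Qed.

Lemma local_uniqueness x y t0 : O (x t0) -> x t0 = y t0 ->
  near t0 (fun t => deriv x t (h (x t))) -> near t0 (fun t => deriv y t (h (y t))) ->
  near t0 (fun t => x t = y t).
Proof.
  intros hO E hx hy. destruct (local_time_exists _ hO) as (r & T & LT).
  pose proof (osquare_center (x t0) r (proj1 LT)) as h0.
  assert (h0' := h0). rewrite E in h0' at 2.
  refine (near_imp t0 _ _ _ (near_and _ _ _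
    (local_time_along _ _ _ _ _ LT h0 hx) (local_time_along _ _ _ _ _ LT h0' hy))).
  intros t [[a1 a2] [b1 b2]]. apply LT; auto. rewrite a2, b2, E. reflexivity.
Qed.

Definition integral_curve (x : C -> C) : Prop :=
  forall t, O (x t) /\ deriv x t (h (x t)).

Lemma integral_curve_near x t : integral_curve x -> near t (fun t => deriv x t (h (x t))).
Proof. intros H. apply near_true. apply H. Qed.

Lemma integral_curve_cont x t : integral_curve x -> cont x t.
Proof. intros H. apply (deriv_cont _ _ _ (proj2 (H t))). Qed.

Lemma integral_curve_unique x y t0 : integral_curve x -> integral_curve y ->
  x t0 = y t0 -> forall t, x t = y t.
Proof.
  intros hx hy E t. apply (plane_connected (fun t => x t = y t)) with t0; auto.
  split.
  - intros u _ Eu. refine (near_imp u _ _ _ (local_uniqueness x y u _ Eu _ _)); auto.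
    + apply hx.
    + apply integral_curve_near, hx.
    + apply integral_curve_near, hy.
  - intros u _ Nu.
    assert (cd : cont (fun t => x t - y t)%C u)
      by (apply cont_minus; apply integral_curve_cont; assumption).
    refine (near_imp u _ _ _ (cont_neq _ _ 0%C cd (Csub_neq_0 _ _ Nu))).
    intros v hv _ F. apply hv. rewrite F. ring.
Qed.

Lemma integral_curve_shift x s : integral_curve x -> integral_curve (fun t => x (t + s)%C).
Proof.
  intros H t. destruct (H (t + s)%C) as [h1 h2]. split; [exact h1|].
  replace (h (x (t + s)%C)) with (h (x (t + s)) * (1 + 0))%C by ring.
  apply (deriv_comp x (fun t => t + s)%C); [|exact h2].
  apply deriv_plus; [apply deriv_id|apply deriv_const].
Qed.

(** Thus the fibres of x are cosets of its group of periods. *)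
Lemma integral_curve_period x t u : integral_curve x -> x t = x u ->
  forall s, x (s + (u - t))%C = x s.
Proof.
  intros H E. apply (integral_curve_unique _ _ t); auto.
  - apply integral_curve_shift, H.
  - rewrite E. f_equal. ring.
Qed.

Lemma integral_curve_open x t Q : integral_curve x -> near t Q ->
  near (x t) (fun z => exists t', Q t' /\ x t' = z).
Proof.
  intros H hQ. destruct (local_time_exists _ (proj1 (H t))) as (r & T & LT).
  pose proof (osquare_center (x t) r (proj1 LT)) as h0.
  destruct (near_and _ _ _ hQ (local_time_along _ _ _ _ _ LT h0 (integral_curve_near x t H)))
    as (d & hd & K).
  assert (cT : cont T (x t)) by (apply (deriv_cont _ _ _ (proj2 (proj1 (proj2 LT) _ h0)))).
  refine (near_imp _ _ _ _ (near_and _ _ _ (near_osquare _ _ _ h0) (cT d hd))).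
  (* T measures time, so this is the time at which the curve reaches z. *)
  intros z [hz hT]. exists (t + (T z - T (x t)))%C.
  destruct (K (t + (T z - T (x t)))%C) as [k1 [k2 k3]].
  { replace (t + (T z - T (x t)) - t)%C with (T z - T (x t))%C by ring. exact hT. }
  split; [exact k1|]. apply LT; auto. rewrite k3. ring.
Qed.

Hypothesis O_connected : connected O.
Hypothesis complete : forall z, O z -> exists x, integral_curve x /\ x 0%C = z.

(** Orbits are open and partition O, so the complement of an orbit is open too. *)
Lemma single_orbit x : integral_curve x -> forall z, O z -> exists t, x t = z.
Proof.
  intros H z hz. apply (O_connected (fun z => exists t, x t = z)) with (x 0%C); auto.
  - split.
    + intros w _ [t E]. rewrite <- E.
      refine (near_imp _ _ _ _ (integral_curve_open x t _ H (near_true t (fun _ => True) _))); auto.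
      intros v (t' & _ & E') _. now exists t'.
    + intros w hw N. destruct (complete w hw) as (y & hy & y0).
      rewrite <- y0.
      refine (near_imp _ _ _ _ (integral_curve_open y 0%C _ hy
        (near_true _ (fun _ => True) _))); auto.
      intros v (t' & _ & E') _ [t E]. apply N.
      exists (0 + (t - t'))%C.
      rewrite (integral_curve_unique (fun s => x (s + (t - t'))%C) y t'); auto.
      * apply integral_curve_shift, H.
      * rewrite E', <- E. f_equal. ring.
  - apply H.
  - now exists 0%C.
Qed.

Hypothesis O_unbounded : forall M, exists z, O z /\ M < Cmod z.

(* The orbit is the quotient of C by the periods of x. If the periods are trivial it
   has one end, if they lie on a line it has two, and otherwise it is compact; two
   isolated boundary points and infinity would give three ends. *)
Lemma isolated_boundary_unique x a b : integral_curve x ->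
  isolated O a -> isolated O b -> a = b.
Proof.
  intros H ha hb. apply NNPP. intros n.
  assert (onto := single_orbit x H).
  destruct (classic (exists p : C, p <> 0%C /\ forall t, x (t + p)%C = x t)) as [(p & p0 & per)|np].
  (* Time is rescaled so that the period p becomes 1. *)
  - set (y := fun t => x (p * t)%C).
    assert (y_in : forall t, O (y t)) by (intros t; apply H).
    assert (cp : forall t, cont (fun t => p * t)%C t).
    { intros t. apply cont_mult; [apply cont_const|apply cont_id]. }
    assert (cq : forall t, cont (fun t => / p * t)%C t).
    { intros t. apply cont_mult; [apply cont_const|apply cont_id]. }
    assert (y_cont : forall t, cont y t).
    { intros t. apply (cont_comp x); [apply cp|apply integral_curve_cont, H]. }
    assert (y_onto : forall z, O z -> exists t, y t = z).
    { intros z hz. destruct (onto z hz) as [t E]. exists (/ p * t)%C. unfold y.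
      rewrite <- E. f_equal. field. exact p0. }
    assert (y_open : forall t Q, near t Q ->
       near (y t) (fun z => exists t', Q t' /\ y t' = z)).
    { intros t Q hQ. unfold y at 1.
      assert (hQ' : near (p * t)%C (fun s => Q (/ p * s)%C)).
      { apply (cont_near (fun s => / p * s)%C); [apply cq|].
        replace (/ p * (p * t))%C with t by (field; exact p0). exact hQ. }
      refine (near_imp _ _ _ _ (integral_curve_open x _ _ H hQ')).
      intros z (t' & q & E). exists (/ p * t')%C. split; [exact q|].
      unfold y. rewrite <- E. f_equal. field. exact p0. }
    assert (per1 : forall t, y (t + 1)%C = y t).
    { intros t. unfold y. rewrite <- (per (p * t)%C). f_equal. ring. }
    destruct (classic (exists q, (forall t, y (t + q)%C = y t) /\ Im q <> 0)) as [(q & h1 & h2)|nq].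
    + apply (no_puncture_doubly_periodic O y y_in y_cont y_onto a q per1 h1 h2 ha).
    + apply (no_two_punctures_periodic O y y_in y_cont y_onto y_open a b per1); auto.
      (* Two times with the same image differ by a period, and in this case all periods of y are
         real. *)
      intros t u E. apply NNPP. intros N. apply nq. exists (u - t)%C. split.
      * intros s. unfold y in *.
        rewrite <- (integral_curve_period x _ _ H E (p * s)%C). f_equal. ring.
      * change (Im u - Im t <> 0). lra.
  - apply (no_two_punctures_injective O x (fun t => proj1 (H t))
      (fun t => integral_curve_cont x t H) onto
      (fun t Q => integral_curve_open x t Q H) a b); auto.
    intros t u E. apply NNPP. intros N. apply np. exists (u - t)%C. split.
    + apply Csub_neq_0. auto.
    + apply integral_curve_period; assumption.
Qed.
End Flow.

(** * Filter-based differentiability in C and in C2 *)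

Lemma locally_near z P : locally (T := C_UniformSpace) z P <-> near z P.
Proof.
  rewrite near_iff_osquare. split.
  - intros [e H]. exists e. split; [apply cond_pos|]. intros w hw. apply H, hw.
  - intros (r & hr & H). exists (mkposreal r hr). intros w hw. apply H, hw.
Qed.

Lemma is_derive_deriv f z l :
  is_derive (K := C_AbsRing) (V := C_NormedModule) f z l <-> deriv f z l.
Proof.
  split.
  - intros [_ H] e he.
    destruct (H z (fun P h => h) (mkposreal e he)) as [d K].
    exists d. split; [apply cond_pos|]. intros w hw.
    specialize (K w hw). rewrite (Cmult_comm l). exact K.
  - intros H. split; [apply is_linear_scal_l|]. intros x hx.
    apply (is_filter_lim_locally_unique (V := AbsRing_NormedModule C_AbsRing)) in hx. subst x. intros e.
    destruct (H e (cond_pos e)) as (d & hd & K). exists (mkposreal d hd). intros w hw.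
    specialize (K w hw). rewrite (Cmult_comm l) in K. exact K.
Qed.

Lemma ex_derive_hol f z : ex_derive (K := C_AbsRing) (V := C_NormedModule) f z <-> hol f z.
Proof. split; intros [l H]; exists l; apply is_derive_deriv, H. Qed.

Lemma C2_norm_le (p : C2) : norm p <= Cmod (fst p) + Cmod (snd p).
Proof.
  pose proof (Cmod_ge_0 (fst p)). pose proof (Cmod_ge_0 (snd p)).
  change (sqrt (Cmod (fst p) ^ 2 + Cmod (snd p) ^ 2) <= Cmod (fst p) + Cmod (snd p)).
  rewrite <- (sqrt_pow2 (Cmod (fst p) + Cmod (snd p))) by lra.
  apply sqrt_le_1_alt. nra.
Qed.

Lemma C2_norm_ge (p : C2) : Cmod (fst p) <= norm p /\ Cmod (snd p) <= norm p.
Proof.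
  pose proof (Cmod_ge_0 (fst p)). pose proof (Cmod_ge_0 (snd p)).
  change (norm p) with (sqrt (Cmod (fst p) ^ 2 + Cmod (snd p) ^ 2)).
  split.
  - rewrite <- (sqrt_pow2 (Cmod (fst p))) at 1 by lra. apply sqrt_le_1_alt. nra.
  - rewrite <- (sqrt_pow2 (Cmod (snd p))) at 1 by lra. apply sqrt_le_1_alt. nra.
Qed.

Lemma is_derive_C2 phi t (v : C2) :
  is_derive (K := C_AbsRing) (V := C2) phi t v <->
  deriv (fun s => fst (phi s)) t (fst v) /\ deriv (fun s => snd (phi s)) t (snd v).
Proof.
  split.
  - intros [_ H]. split; intros e he;
      destruct (H t (fun P h => h) (mkposreal e he)) as [d K];
      exists d; (split; [apply cond_pos|]); intros w hw; specialize (K w hw);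
      rewrite Cmult_comm; (eapply Rle_trans; [|exact K]);
      apply (C2_norm_ge (minus (minus (phi w) (phi t)) (scal (minus w t) v))).
  - intros [H1 H2]. split; [apply is_linear_scal_l|]. intros x hx.
    apply (is_filter_lim_locally_unique (V := AbsRing_NormedModule C_AbsRing)) in hx. subst x. intros e.
    destruct (near_and _ _ _ (H1 (e / 2) (is_pos_div_2 e)) (H2 (e / 2) (is_pos_div_2 e)))
      as (d & hd & K).
    exists (mkposreal d hd). intros w hw. destruct (K w hw) as [K1 K2].
    rewrite (Cmult_comm (fst v)) in K1. rewrite (Cmult_comm (snd v)) in K2.
    eapply Rle_trans; [apply (C2_norm_le _)|].
    eapply Rle_trans; [apply (Rplus_le_compat _ _ _ _ K1 K2)|].
    change (norm (minus w t)) with (Cmod (w - t)). lra.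
Qed.

(** * Differentials of functions of two complex variables *)

Definition near2 (p : C2) (P : C2 -> Prop) : Prop :=
  exists d, 0 < d /\ forall q, osquare (fst p) d (fst q) -> osquare (snd p) d (snd q) -> P q.

Lemma locally_near2 (p : C2) P : locally p P <-> near2 p P.
Proof.
  split.
  - intros [e H]. exists e. split; [apply cond_pos|]. intros q h1 h2. apply H.
    split; assumption.
  - intros (r & hr & H). exists (mkposreal r hr). intros q [h1 h2]. apply H; assumption.
Qed.

Lemma near2_curve (p : C2) P (f g : C -> C) t : near2 p P -> cont f t -> cont g t -> f t = fst p ->
  g t = snd p -> near t (fun s => P (f s, g s)).
Proof.
  intros (d & hd & H) cf cg Ef Eg.
  refine (near_imp t _ _ _ (near_and _ _ _ (cf d hd) (cg d hd))).
  intros s [h1 h2]. rewrite Ef in h1. rewrite Eg in h2.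
  apply H; apply Cmod_lt_osquare; assumption.
Qed.

(** A and B are the partial derivatives. The sum of the moduli stands for [norm], which it dominates
    by [C2_norm_le]. *)
Definition diff2 (F : C2 -> C) (p : C2) (A B : C) : Prop :=
  forall e, 0 < e -> near2 p (fun q =>
    Cmod (F q - F p - (A * (fst q - fst p) + B * (snd q - snd p)))%C
    <= e * (Cmod (fst q - fst p) + Cmod (snd q - snd p))).

Lemma linear_C2 (V : NormedModule C_AbsRing) (l : C2 -> V) : is_linear l ->
  forall u v : C, l (u, v) = plus (scal u (l (RtoC 1, RtoC 0))) (scal v (l (RtoC 0, RtoC 1))).
Proof.
  intros [h1 h2 _] u v. rewrite <- !h2, <- h1. f_equal.
  apply injective_projections; unfold scal, plus; simpl; unfold prod_scal, prod_plus, scal, plus;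
    simpl; unfold mult; simpl; ring.
Qed.

Lemma filterdiff_diff2 (f : C2 -> C2) p (l : C2 -> C2) : filterdiff f (locally p) l ->
  diff2 (fun q => fst (f q)) p (fst (l (RtoC 1, RtoC 0))) (fst (l (RtoC 0, RtoC 1))) /\
  diff2 (fun q => snd (f q)) p (snd (l (RtoC 1, RtoC 0))) (snd (l (RtoC 0, RtoC 1))).
Proof.
  intros [L H].
  assert (K : forall e, 0 < e -> near2 p (fun q =>
     norm (minus (minus (f q) (f p)) (l (minus q p))) <=
       e * (Cmod (fst q - fst p) + Cmod (snd q - snd p)))).
  { intros e he. destruct (proj1 (locally_near2 _ _) (H p (fun P h => h) (mkposreal e he)))
      as (d & hd & K). exists d. split; [exact hd|]. intros q h1 h2.
    eapply Rle_trans; [apply (K q h1 h2)|]. apply Rmult_le_compat_l; [simpl; lra|].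
    apply (C2_norm_le (minus q p)). }
  split; intros e he; destruct (K e he) as (d & hd & B); exists d; (split; [exact hd|]);
    intros q h1 h2; (eapply Rle_trans; [|apply (B q h1 h2)]);
    destruct (C2_norm_ge (minus (minus (f q) (f p)) (l (minus q p)))) as [G1 G2].
  - eapply Rle_trans; [|exact G1]. right. f_equal.
    replace (minus q p) with ((fst q - fst p)%C, (snd q - snd p)%C) by reflexivity.
    set (A := l (RtoC 1, RtoC 0)). set (B' := l (RtoC 0, RtoC 1)).
    rewrite (linear_C2 _ l L (fst q - fst p)%C (snd q - snd p)%C). fold A B'.
    rewrite (Cmult_comm (fst A)), (Cmult_comm (fst B')). reflexivity.
  - eapply Rle_trans; [|exact G2]. right. f_equal.
    replace (minus q p) with ((fst q - fst p)%C, (snd q - snd p)%C) by reflexivity.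
    set (A := l (RtoC 1, RtoC 0)). set (B' := l (RtoC 0, RtoC 1)).
    rewrite (linear_C2 _ l L (fst q - fst p)%C (snd q - snd p)%C). fold A B'.
    rewrite (Cmult_comm (snd A)), (Cmult_comm (snd B')). reflexivity.
Qed.

Lemma deriv_increment_bound f z l : deriv f z l ->
  near z (fun w => Cmod (f w - f z) <= (Cmod l + 1) * Cmod (w - z)).
Proof.
  intros H. refine (near_imp z _ _ _ (H 1 _)); [|lra]. intros w hw.
  replace (f w - f z)%C with ((f w - f z - l * (w - z)) + l * (w - z))%C by ring.
  eapply Rle_trans; [apply Cmod_triangle|]. rewrite Cmod_mult. lra.
Qed.

Lemma diff2_comp F (f g : C -> C) t A B l m : diff2 F (f t, g t) A B -> deriv f t l -> deriv g t m ->
  deriv (fun s => F (f s, g s)) t (A * l + B * m).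
Proof.
  intros HF Hf Hg e he.
  pose proof (Cmod_ge_0 l). pose proof (Cmod_ge_0 m).
  pose proof (Cmod_ge_0 A). pose proof (Cmod_ge_0 B).
  (* The 2 makes room for the increment bounds with factors |l| + 1 and |m| + 1; the three error
     terms then add up to at most 3/4 of e |s - t|. *)
  set (k := Cmod l + Cmod m + Cmod A + Cmod B + 2). assert (hk : 0 < k) by (unfold k; lra).
  assert (he1 : 0 < e / (4 * k)) by (apply Rdiv_lt_0_compat; lra).
  assert (N := near2_curve _ _ f g t (HF _ he1) (deriv_cont _ _ _ Hf) (deriv_cont _ _ _ Hg)
    eq_refl eq_refl).
  refine (near_imp t _ _ _ (near_and _ _ _ N (near_and _ _ _
    (near_and _ _ _ (Hf _ he1) (Hg _ he1))
    (near_and _ _ _ (deriv_increment_bound _ _ _ Hf) (deriv_increment_bound _ _ _ Hg))))).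
  simpl. intros s [n1 [[n2 n3] [n4 n5]]].
  replace (F (f s, g s) - F (f t, g t) - (A * l + B * m) * (s - t))%C with
    ((F (f s, g s) - F (f t, g t) - (A * (f s - f t) + B * (g s - g t)))
     + (A * (f s - f t - l * (s - t)) + B * (g s - g t - m * (s - t))))%C by ring.
  eapply Rle_trans; [apply Cmod_triangle|].
  eapply Rle_trans; [apply Rplus_le_compat_l, Cmod_triangle|]. rewrite !Cmod_mult.
  set (x := Cmod (s - t)) in *. assert (hx : 0 <= x) by apply Cmod_ge_0.
  set (u := e / (4 * k)) in *.
  assert (E : e * x = 4 * (u * k * x)) by (unfold u; field; lra). rewrite E.
  assert (S1 : u * (Cmod (f s - f t) + Cmod (g s - g t)) <= u * (k * x)).
  { apply Rmult_le_compat_l; [lra|].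
    assert (0 <= (Cmod A + Cmod B) * x) by (apply Rmult_le_pos; lra). unfold k. nra. }
  assert (S2 : Cmod A * Cmod (f s - f t - l * (s - t))%C <= k * (u * x)).
  { apply Rmult_le_compat; auto using Cmod_ge_0. unfold k; lra. }
  assert (S3 : Cmod B * Cmod (g s - g t - m * (s - t))%C <= k * (u * x)).
  { apply Rmult_le_compat; auto using Cmod_ge_0. unfold k; lra. }
  assert (0 <= u * k * x) by (apply Rmult_le_pos; [apply Rmult_le_pos|]; lra).
  lra.
Qed.

(** Differentiability at one point already bounds F on a bidisc of squares; this makes the Cauchy
    estimates in one variable uniform in the other. *)
Lemma diff2_bounded F (p1 p2 : C) A B : diff2 F (p1, p2) A B ->
  exists M r, 0 < r /\ forall z w, square p1 r z -> square p2 r w ->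
  Cmod (F (z, w)) <= M.
Proof.
  intros H. destruct (H 1 ltac:(lra)) as (d & hd & K).
  simpl in K. set (r := d / 2). exists (Cmod (F (p1, p2)) + (Cmod A + 1) * d + (Cmod B + 1) * d), r.
  assert (hr : 0 < r) by (unfold r; lra). split; [exact hr|]. simpl. intros z w hz hw.
  assert (bz := square_Cmod _ _ _ hz). assert (bw := square_Cmod _ _ _ hw).
  replace (2 * r) with d in bz, bw by (unfold r; field).
  assert (sq : forall a v, square a r v -> osquare a d v).
  { intros a v [h1 h2]. apply osquare_iff. unfold r in *. lra. }
  specialize (K (z, w) (sq _ _ hz) (sq _ _ hw)). simpl in K.
  replace (F (z, w)) with (F (p1, p2) + ((F (z, w) - F (p1, p2) - (A * (z - p1) + B * (w - p2)))
     + (A * (z - p1) + B * (w - p2))))%C by ring.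
  eapply Rle_trans; [apply Cmod_triangle|].
  eapply Rle_trans; [apply Rplus_le_compat_l, Cmod_triangle|].
  eapply Rle_trans; [apply Rplus_le_compat_l, Rplus_le_compat_l, Cmod_triangle|].
  rewrite !Cmod_mult. pose proof (Cmod_ge_0 A). pose proof (Cmod_ge_0 B).
  assert (Cmod A * Cmod (z - p1) <= Cmod A * d) by (apply Rmult_le_compat_l; lra).
  assert (Cmod B * Cmod (w - p2) <= Cmod B * d) by (apply Rmult_le_compat_l; lra).
  lra.
Qed.

(* On a square of half-side rho with 8 K rho <= 1 a bound |u| <= m improves to
   |u| <= m / 2. *)
Lemma gronwall_zero (u u' : C -> C) t0 K : 0 <= K -> u t0 = 0%C ->
  near t0 (fun t => deriv u t (u' t) /\ Cmod (u' t) <= K * Cmod (u t)) ->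
  near t0 (fun t => u t = 0%C).
Proof.
  intros hK u0 H.
  assert (cu : cont u t0) by (apply (deriv_cont _ _ _ (proj1 (near_self _ _ H)))).
  destruct (proj1 (near_iff_osquare _ _) (near_and _ _ _ H (cont_bounded u t0 cu)))
    as (r & hr & B).
  set (M := Cmod (u t0) + 1) in *. assert (hM : 0 < M) by (unfold M; pose proof (Cmod_ge_0 (u t0)); lra).
  set (rho := Rmin r (/ (8 * (K + 1)))).
  assert (h1 : 0 < rho) by (apply Rmin_glb_lt; [lra|apply Rinv_0_lt_compat; lra]).
  assert (h2 : rho <= r) by apply Rmin_l.
  assert (h3 : 8 * K * rho <= 1).
  { assert (L : rho <= / (8 * (K + 1))) by apply Rmin_r.
    apply (Rmult_le_compat_l (8 * (K + 1))) in L; [|lra]. rewrite Rinv_r in L by lra. nra. }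
  clearbody rho.
  assert (sub : forall t, osquare t0 rho t -> osquare t0 r t).
  { intros t [k1 k2]. split; lra. }
  assert (P : forall n t, osquare t0 rho t -> Cmod (u t) <= M * (/ 2) ^ n).
  { induction n as [|n IH]; intros t ht.
    - simpl. rewrite Rmult_1_r. left. apply B, sub, ht.
    - assert (L := osquare_convex_bound u u' t0 rho (K * (M * (/ 2) ^ n)) t0 t
        (osquare_center _ _ h1) ht).
      rewrite u0 in L. replace (u t - 0)%C with (u t) in L by ring.
      eapply Rle_trans; [apply L|].
      + intros v hv. destruct (B v (sub v hv)) as [[b1 b2] _]. split; [exact b1|].
        eapply Rle_trans; [exact b2|]. apply Rmult_le_compat_l; [lra|]. apply IH, hv.
      + pose proof (square_Cmod _ _ _ (osquare_square _ _ _ ht)) as b.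
        assert (0 < M * (/ 2) ^ n) by (apply Rmult_lt_0_compat; [lra|apply pow_lt; lra]).
        set (m := M * (/ 2) ^ n) in *.
        replace (M * (/ 2) ^ S n) with (m * / 2) by (unfold m; simpl; ring).
        assert (Cmod (t - t0) * K <= 2 * rho * K) by (apply Rmult_le_compat_r; lra).
        nra. }
  apply near_iff_osquare. exists rho. split; [exact h1|]. intros t ht.
  apply Cmod_le_eps_eq_0. intros e he.
  destruct (pow_lt_1_zero (/ 2)) with (y := e / M) as [n hn].
  - rewrite Rabs_pos_eq; lra.
  - apply Rdiv_lt_0_compat; lra.
  - specialize (hn n (le_n n)). specialize (P n t ht).
    assert (0 < (/ 2) ^ n) by (apply pow_lt; lra).
    rewrite Rabs_pos_eq in hn by lra. apply Rlt_div_r in hn; lra.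
Qed.

Lemma deriv_le_lipschitz f z l K : deriv f z l -> 0 <= K ->
  near z (fun w => Cmod (f w - f z) <= K * Cmod (w - z)) -> Cmod l <= K.
Proof.
  intros H hK L. apply Rnot_lt_le. intros N.
  set (e := (Cmod l - K) / 2). assert (he : 0 < e) by (unfold e; lra).
  destruct (near_exists_neq _ _ (near_and _ _ _ L (H e he))) as (w & n & w1 & w2).
  pose proof (Cmod_sub_gt_0 _ _ n) as p.
  assert (E : (l * (w - z))%C = ((f w - f z) - (f w - f z - l * (w - z)))%C) by ring.
  apply (f_equal Cmod) in E. rewrite Cmod_mult in E.
  pose proof (Cmod_minus_le (f w - f z) (f w - f z - l * (w - z)))%C as T.
  rewrite <- E in T. unfold e in w2. nra.
Qed.

Lemma hol_locally_lipschitz f a : near a (hol f) ->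
  exists K r, 0 <= K /\ 0 < r /\ forall z w, osquare a r z -> osquare a r w ->
    Cmod (f z - f w) <= K * Cmod (z - w).
Proof.
  intros H. destruct (near_square _ _ (near_and _ _ _ H
    (cont_bounded _ _ (hol_cont _ _ (near_self _ _ H))))) as (r & hr & B).
  exists (256 * (Cmod (f a) + 1) / r), (r / 2). split; [|split; [lra|]].
  - apply Rmult_le_pos; [pose proof (Cmod_ge_0 (f a)); lra|].
    left. apply Rinv_0_lt_compat, hr.
  - apply lipschitz_of_bounded; auto; intros z hz.
    + apply B, hz.
    + left. apply B, hz.
Qed.

(** * Meromorphic functions and their graphs *)

Definition coord (s : C -> P1) (z : C) : C := P1_coord (s z).
Definition coord_inf (s : C -> P1) (z : C) : C := P1_coord_inf (s z).

Lemma P1_cases (v : P1) : v <> Inf -> v = Fin (P1_coord v).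
Proof. destruct v; [reflexivity|intros H; now destruct H]. Qed.

Lemma coord_inf_finite s z : s z <> Inf -> s z <> Fin 0%C ->
  coord s z <> 0%C /\ coord_inf s z = (/ coord s z)%C.
Proof.
  intros h1 h2. unfold coord, coord_inf. destruct (s z) as [w|]; [|now destruct h1].
  simpl. split; [|reflexivity]. intros ->. now apply h2.
Qed.

Lemma P1_holomorphic_cases s a : P1_holomorphic_at s a ->
  near a (fun z => s z <> Inf /\ hol (coord s) z) \/
  near a (fun z => s z <> Fin 0%C /\ hol (coord_inf s) z).
Proof.
  intros [H|H]; apply locally_near in H; [left|right];
    refine (near_imp a _ _ _ H); intros z [h1 h2];
    (split; [exact h1|apply ex_derive_hol, h2]).
Qed.

(** Holomorphy at a finite value may be given in the chart 1/w. That chart excludes the value 0, and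
    its coordinate is nonzero near a, so it can be inverted. *)
Lemma P1_holomorphic_finite s a : P1_holomorphic_at s a -> s a <> Inf ->
  near a (fun z => s z <> Inf /\ hol (coord s) z).
Proof.
  intros H ha. destruct (P1_holomorphic_cases s a H) as [K|K]; [exact K|].
  destruct (near_self _ _ K) as [k1 k2].
  destruct (coord_inf_finite s a ha k1) as [n0 E].
  assert (ni : coord_inf s a <> 0%C).
  { rewrite E. apply Cmod_gt_0. rewrite Cmod_inv by exact n0.
    apply Rinv_0_lt_compat, Cmod_gt_0, n0. }
  assert (N : near a (fun z => coord_inf s z <> 0%C /\ (s z <> Fin 0%C /\ hol (coord_inf s) z))).
  { apply near_and; [|exact K]. apply cont_neq; [apply hol_cont, k2|exact ni]. }
  refine (near_imp a _ _ _ (near_near _ _ N)). intros z hz.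
  assert (fin : forall w, coord_inf s w <> 0%C -> s w <> Inf).
  { intros w hw F. apply hw. unfold coord_inf. now rewrite F. }
  destruct (near_self _ _ hz) as (z1 & z2 & z3). split; [apply fin, z1|].
  apply (hol_ext (fun w => / coord_inf s w)%C).
  - refine (near_imp z _ _ _ hz). intros w (w1 & w2 & _).
    destruct (coord_inf_finite s w (fin w w1) w2) as [m0 Ew]. rewrite Ew. field. exact m0.
  - apply hol_inv; assumption.
Qed.

Lemma P1_holomorphic_pole s a : P1_holomorphic_at s a -> s a = Inf ->
  near a (fun z => s z <> Fin 0%C /\ hol (coord_inf s) z).
Proof.
  intros H ha. destruct (P1_holomorphic_cases s a H) as [K|K]; [|exact K].
  destruct (near_self _ _ K) as [k1 _]. contradiction.
Qed.

Lemma P1_pole_cases s a : P1_holomorphic_at s a -> s a = Inf ->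
  near a (fun z => s z = Inf) \/ near a (fun z => z <> a -> s z <> Inf).
Proof.
  intros H ha. pose proof (P1_holomorphic_pole s a H ha) as K.
  destruct (isolated_zero (coord_inf s) a) as [Z|Z].
  - refine (near_imp a _ _ _ K). intros z [_ h]. exact h.
  - unfold coord_inf. now rewrite ha.
  - left. refine (near_imp a _ _ _ (near_and _ _ _ K Z)). intros z [[z1 _] z2].
    apply NNPP. intros F. destruct (coord_inf_finite s z F z1) as [n0 E].
    rewrite E in z2. apply (f_equal Cmod) in z2. rewrite Cmod_inv, Cmod_0 in z2 by exact n0.
    apply Cmod_gt_0, Rinv_0_lt_compat in n0. lra.
  - right. refine (near_imp a _ _ _ Z). intros z hz n F. apply (hz n).
    unfold coord_inf. now rewrite F.
Qed.

(** Identity principle: the set of points near which s is constantly infinite is clopen, and s takes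
    a finite value somewhere. *)
Lemma poles_isolated s a : meromorphic s -> near a (fun z => z <> a -> s z <> Inf).
Proof.
  intros [hol_s [b hb]].
  destruct (classic (s a = Inf)) as [ha|ha].
  2: { refine (near_imp a _ _ _ (P1_holomorphic_finite s a (hol_s a) ha)). tauto. }
  destruct (P1_pole_cases s a (hol_s a) ha) as [K|K]; [|exact K].
  exfalso. apply hb. apply (near_self b (fun z => s z = Inf)).
  apply (plane_connected (fun z => near z (fun w => s w = Inf))) with a; auto.
  split.
  - intros z _ hz. refine (near_imp z _ _ _ (near_near _ _ hz)). auto.
  - intros z _ hz.
    assert (N : near z (fun w => w <> z -> s w <> Inf)).
    { destruct (classic (s z = Inf)) as [h|h].
      - destruct (P1_pole_cases s z (hol_s z) h); [contradiction|assumption].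
      - refine (near_imp z _ _ _ (P1_holomorphic_finite s z (hol_s z) h)). tauto. }
    refine (near_imp z _ _ _ N). intros w hw _ F.
    destruct (classic (w = z)) as [->|n]; [contradiction|].
    apply (hw n), (near_self _ _ F).
Qed.

Lemma pole_blowup s a M : P1_holomorphic_at s a -> s a = Inf ->
  near a (fun z => s z <> Inf -> M < Cmod (coord s z)).
Proof.
  intros H ha. pose proof (P1_holomorphic_pole s a H ha) as K.
  assert (c : cont (coord_inf s) a) by apply hol_cont, (near_self _ _ K).
  assert (hm : 0 < / (Rabs M + 1)).
  { apply Rinv_0_lt_compat. pose proof (Rabs_pos M). lra. }
  refine (near_imp a _ _ _ (near_and _ _ _ K (c _ hm))). intros z [[z1 _] z2] F.
  destruct (coord_inf_finite s z F z1) as [n0 E].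
  replace (coord_inf s a) with (RtoC 0) in z2 by (unfold coord_inf; now rewrite ha).
  replace (coord_inf s z - 0)%C with (coord_inf s z) in z2 by ring.
  rewrite E, Cmod_inv in z2 by exact n0.
  apply Rinv_lt_cancel in z2; [|apply Cmod_gt_0, n0].
  pose proof (Rle_abs M). lra.
Qed.

Definition graph_point (s : C -> P1) (z : C) : C2 := (z, coord s z).

Lemma graph_iff s q : graph s q <-> (s (fst q) <> Inf /\ q = graph_point s (fst q)).
Proof.
  unfold graph, graph_point, coord. split.
  - intros E. rewrite E. split; [discriminate|]. destruct q; reflexivity.
  - intros [n E]. rewrite E at 2. simpl. now apply P1_cases.
Qed.

Lemma graph_graph_point s z : s z <> Inf -> graph s (graph_point s z).
Proof. intros n. apply graph_iff. auto. Qed.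

Lemma filterdiff_graph_equation g (q : C2) l : deriv g (fst q) l ->
  filterdiff (V := C_NormedModule) (fun p : C2 => (snd p - g (fst p))%C) (locally q)
    (fun v : C2 => (snd v - l * fst v)%C).
Proof.
  intros H. split.
  - split.
    + intros x y. unfold plus; simpl. unfold prod_plus, plus; simpl. ring.
    + intros k x. unfold scal; simpl. unfold prod_scal, scal; simpl. unfold mult; simpl. ring.
    + pose proof (Cmod_ge_0 l). exists (1 + Cmod l). split; [lra|]. intros x.
      destruct (C2_norm_ge x) as [n1 n2].
      change (Cmod (snd x - l * fst x) <= (1 + Cmod l) * norm x).
      eapply Rle_trans; [apply Cmod_minus_le|]. rewrite Cmod_mult.
      assert (Cmod l * Cmod (fst x) <= Cmod l * norm x) by (apply Rmult_le_compat_l; lra). lra.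
  - intros x hx. apply is_filter_lim_locally_unique in hx. subst x. intros e.
    apply locally_near2.
    destruct (proj1 (near_iff_osquare _ _) (H e (cond_pos e))) as (d & hd & K).
    exists d. split; [exact hd|]. intros p h1 _. specialize (K (fst p) h1).
    destruct (C2_norm_ge (minus p q)) as [n1 _].
    change (Cmod (snd p - g (fst p) - (snd q - g (fst q)) -
       ((snd p - snd q) - l * (fst p - fst q))) <= e * norm (minus p q)).
    replace (snd p - g (fst p) - (snd q - g (fst q)) -
       ((snd p - snd q) - l * (fst p - fst q)))%C
      with (- (g (fst p) - g (fst q) - l * (fst p - fst q)))%C by ring.
    rewrite Cmod_opp. eapply Rle_trans; [exact K|].
    apply Rmult_le_compat_l; [left; apply cond_pos|exact n1].
Qed.

(** The function y - S(x) serves twice: it certifies that the point is smooth, and it is the germ on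
    which tangency is tested. *)
Lemma graph_tangency s X z l : meromorphic s -> tangent_to X (graph s) -> s z <> Inf ->
  deriv (coord s) z l -> snd (X (graph_point s z)) = (l * fst (X (graph_point s z)))%C.
Proof.
  intros [hol_s _] tan hz D.
  set (p := graph_point s z).
  pose proof (P1_holomorphic_finite s z (hol_s z) hz) as N.
  destruct (proj1 (near_iff_osquare _ _) N) as (r & hr & K).
  assert (H1 : holomorphic_near (fun p : C2 => (snd p - coord s (fst p))%C) p).
  { apply locally_near2. exists r. split; [exact hr|]. intros q h1 _.
    destruct (K (fst q) h1) as [_ [m Dm]].
    eexists. apply filterdiff_graph_equation, Dm. }
  assert (H2 : locally p (fun q => graph s q <-> (snd q - coord s (fst q))%C = 0%C)).
  { apply locally_near2. exists r. split; [exact hr|]. intros q h1 _.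
    destruct (K (fst q) h1) as [n _]. split.
    - intros g. apply graph_iff in g as [_ E]. rewrite E. simpl. ring.
    - intros E. apply Csub_eq_0 in E. apply graph_iff. split; [exact n|].
      unfold graph_point. rewrite <- E. destruct q; reflexivity. }
  assert (H3 := filterdiff_graph_equation (coord s) p l D).
  apply Csub_eq_0. apply (tan p) with (f := fun p : C2 => (snd p - coord s (fst p))%C)
    (df := fun v : C2 => (snd v - l * fst v)%C); auto.
  - split; [now apply graph_graph_point|].
    exists (fun p : C2 => (snd p - coord s (fst p))%C), (fun v : C2 => (snd v - l * fst v)%C).
    split; [exact H1|]. split; [exact H2|]. split; [exact H3|].
    (* The differential takes the value 1 on the vertical vector, so it is nonzero. *)
    exists (RtoC 0, RtoC 1). simpl. replace (1 - l * 0)%C with (RtoC 1) by ring.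
    intros E. apply RtoC_inj in E. lra.
  - destruct H2 as [e H2]. exists e. intros q hq. apply H2, hq.
Qed.

(** * The field along the graph *)

Lemma connected_iff A B : (forall z, A z <-> B z) -> connected A -> connected B.
Proof.
  intros E H P [h1 h2] z w hz hw. apply H; try (apply E; assumption).
  split; intros v hv pv.
  - refine (near_imp v _ _ _ (h1 v (proj1 (E v) hv) pv)). intros u K hu. apply K, E, hu.
  - refine (near_imp v _ _ _ (h2 v (proj1 (E v) hv) pv)). intros u K hu. apply K, E, hu.
Qed.

Section Field.
Variables (s : C -> P1) (X : C2 -> C2).
Hypothesis hs : meromorphic s.
Hypothesis hX : holomorphic_field X.
Hypothesis hcomplete : complete_field X.
Hypothesis htangent : tangent_to X (graph s).
Hypothesis hzeros : isolated_zeros_on X (graph s).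

Let D (z : C) : Prop := s z <> Inf.
Let S : C -> C := coord s.
Let h (z : C) : C := fst (X (graph_point s z)).
Let O (z : C) : Prop := D z /\ h z <> 0%C.

Lemma D_near z : D z -> near z (fun w => D w /\ hol S w).
Proof. intros hz. apply P1_holomorphic_finite; [apply hs|exact hz]. Qed.

Lemma S_hol z : D z -> hol S z.
Proof. intros hz. apply (near_self _ _ (D_near z hz)). Qed.

Lemma X_diff2 p : exists A B A' B',
  diff2 (fun q => fst (X q)) p A B /\ diff2 (fun q => snd (X q)) p A' B'.
Proof.
  destruct (hX p) as [l H]. apply filterdiff_diff2 in H as [H1 H2]. eauto 6.
Qed.

Lemma X_graph_point z l : D z -> deriv S z l -> X (graph_point s z) = (h z, (l * h z)%C).
Proof.
  intros hz dl. unfold h. rewrite <- (graph_tangency s X z l hs htangent hz dl).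
  apply surjective_pairing.
Qed.

Lemma X_zero_iff z : D z -> (X (graph_point s z) = zero <-> h z = 0%C).
Proof.
  intros hz. destruct (S_hol z hz) as [l dl]. rewrite (X_graph_point z l hz dl). split.
  - intros E. apply (f_equal fst) in E. exact E.
  - intros E. rewrite E. apply injective_projections; [reflexivity|]. simpl.
    apply Cmult_0_r.
Qed.

Lemma h_hol z : D z -> hol h z.
Proof.
  intros hz. destruct (S_hol z hz) as [l dl].
  destruct (X_diff2 (z, S z)) as (A & B & _ & _ & H & _).
  eexists. apply (diff2_comp (fun q => fst (X q)) (fun w => w) S z A B 1 l H); auto using deriv_id.
Qed.

Definition graph_curve (x : C -> C) (t : C) : Prop := D (x t) /\ deriv x t (h (x t)).

Lemma graph_curve_solution x t : graph_curve x t ->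
  is_derive (K := C_AbsRing) (V := C2) (fun t => graph_point s (x t)) t (X (graph_point s (x t))).
Proof.
  intros [hD dx]. destruct (S_hol _ hD) as [l dl].
  rewrite (X_graph_point _ l hD dl). apply is_derive_C2. split; [exact dx|].
  apply (deriv_comp S x); assumption.
Qed.

(** Each slice with z' fixed is holomorphic, and [diff2_bounded] bounds it uniformly in z'. The
    second variable suffices because a solution (x, y) is compared with (x, S x), over the same
    x. *)
Lemma field_lipschitz z w : exists K r, 0 <= K /\ 0 < r /\
  forall z' w1 w2, square z r z' -> osquare w r w1 -> osquare w r w2 ->
  Cmod (fst (X (z', w1)) - fst (X (z', w2))) <= K * Cmod (w1 - w2) /\
  Cmod (snd (X (z', w1)) - snd (X (z', w2))) <= K * Cmod (w1 - w2).
Proof.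
  destruct (X_diff2 (z, w)) as (A & B & A' & B' & H1 & H2).
  destruct (diff2_bounded _ _ _ _ _ H1) as (M1 & r1 & p1 & K1).
  destruct (diff2_bounded _ _ _ _ _ H2) as (M2 & r2 & p2 & K2).
  set (r := Rmin r1 r2). assert (hr : 0 < r) by (apply Rmin_glb_lt; assumption).
  assert (l1 : r <= r1) by apply Rmin_l. assert (l2 : r <= r2) by apply Rmin_r.
  assert (sub : forall a r' v, r <= r' -> square a r v -> square a r' v).
  { intros a r' v L [k1 k2]. split; lra. }
  clearbody r.
  assert (hw : forall a, square a r a).
  { intros a. apply osquare_square, osquare_center, hr. }
  assert (hM1 : 0 <= M1).
  { eapply Rle_trans; [apply Cmod_ge_0|apply (K1 z w); apply sub; auto]. }
  assert (hM2 : 0 <= M2).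
  { eapply Rle_trans; [apply Cmod_ge_0|apply (K2 z w); apply sub; auto]. }
  set (M := M1 + M2).
  assert (hK : 0 <= 256 * M / r).
  { apply Rmult_le_pos; [unfold M; lra|left; apply Rinv_0_lt_compat, hr]. }
  exists (256 * M / r), (r / 2). split; [exact hK|]. split; [lra|].
  intros z' w1 w2 hz h1 h2.
  assert (hz' : square z r z') by (destruct hz; split; lra).
  assert (hol1 : forall v, hol (fun v => fst (X (z', v))) v /\ hol (fun v => snd (X (z', v))) v).
  { intros v. destruct (X_diff2 (z', v)) as (a & b & a' & b' & d1 & d2).
    split; eexists.
    - apply (diff2_comp (fun q => fst (X q)) (fun _ => z') (fun v => v) v a b 0 1 d1);
        auto using deriv_const, deriv_id.
    - apply (diff2_comp (fun q => snd (X q)) (fun _ => z') (fun v => v) v a' b' 0 1 d2);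
        auto using deriv_const, deriv_id. }
  split.
  - apply (lipschitz_of_bounded (fun v => fst (X (z', v))) w r M hr); auto.
    + intros v _. apply hol1.
    + intros v hv. apply Rle_trans with M1; [|unfold M; lra]. apply K1; apply sub; auto.
  - apply (lipschitz_of_bounded (fun v => snd (X (z', v))) w r M hr); auto.
    + intros v _. apply hol1.
    + intros v hv. apply Rle_trans with M2; [|unfold M; lra]. apply K2; apply sub; auto.
Qed.

Lemma entire_solution_parts phi : entire_solution X phi -> forall t,
  deriv (fun t => fst (phi t)) t (fst (X (phi t))) /\
  deriv (fun t => snd (phi t)) t (snd (X (phi t))).
Proof. intros H t. apply is_derive_C2, H. exact I. Qed.

(* y - S x satisfies |u'| <= K |u| along a solution (x, y) near a point of the graph. *)
Lemma graph_locally_invariant phi t0 : entire_solution X phi -> graph s (phi t0) ->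
  near t0 (fun t => graph s (phi t)).
Proof.
  intros H G.
  set (x := fun t => fst (phi t) : C). set (y := fun t => snd (phi t) : C).
  assert (P : forall t, phi t = (x t, y t)) by (intros t; apply surjective_pairing).
  assert (dxy : forall t, deriv x t (fst (X (phi t))) /\ deriv y t (snd (X (phi t)))).
  { apply entire_solution_parts, H. }
  assert (cx : cont x t0) by apply (deriv_cont _ _ _ (proj1 (dxy t0))).
  assert (cy : cont y t0) by apply (deriv_cont _ _ _ (proj2 (dxy t0))).
  apply graph_iff in G as [hD G]. fold (x t0) in hD, G. fold (D (x t0)) in hD.
  assert (y0 : y t0 = S (x t0)) by (unfold y; rewrite G; reflexivity).
  destruct (field_lipschitz (x t0) (y t0)) as (K & r & hK & hr & L).
  assert (hSn : near (x t0) (hol S)).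
  { refine (near_imp _ _ _ _ (D_near _ hD)). tauto. }
  destruct (hol_locally_lipschitz S (x t0) hSn) as (K' & r' & hK' & hr' & L').
  (* A choice of derivative of S, arbitrary where S has none. *)
  set (S' := fun z => epsilon (inhabits (RtoC 0)) (fun l => deriv S z l)).
  assert (dS : forall z, hol S z -> deriv S z (S' z)).
  { intros z hz. apply epsilon_spec, hz. }
  assert (cSx : cont (fun t => S (x t)) t0).
  { apply (cont_comp S x); [exact cx|apply hol_cont, S_hol, hD]. }
  assert (N : near t0 (fun t => ((D (x t) /\ hol S (x t)) /\ osquare (x t0) r' (x t)) /\
     (osquare (x t0) r (x t) /\ (osquare (y t0) r (y t) /\ osquare (y t0) r (S (x t)))))).
  { apply near_and; [apply near_and|apply near_and; [|apply near_and]].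
    - apply (cont_near x t0 (fun z => D z /\ hol S z)); [exact cx|apply D_near, hD].
    - apply (cont_near x); [exact cx|]. apply near_osquare, osquare_center, hr'.
    - apply (cont_near x); [exact cx|]. apply near_osquare, osquare_center, hr.
    - apply (cont_near y); [exact cy|]. apply near_osquare, osquare_center, hr.
    - apply (cont_near (fun t => S (x t))); [exact cSx|]. rewrite y0.
      apply near_osquare, osquare_center, hr. }
  assert (U : near t0 (fun t => (y t - S (x t))%C = 0%C)).
  { apply (gronwall_zero (fun t => y t - S (x t))%C
      (fun t => snd (X (phi t)) - S' (x t) * fst (X (phi t)))%C t0 (K + K' * K)).
    - assert (0 <= K' * K) by (apply Rmult_le_pos; assumption). lra.
    - rewrite y0. ring.
    - refine (near_imp t0 _ _ _ N). intros t [[[t1 t2] t3] [t4 [t5 t6]]].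
      destruct (dxy t) as [dx dy]. split.
      + apply deriv_minus; [exact dy|]. apply (deriv_comp S x); [exact dx|]. apply dS, t2.
      + destruct (L (x t) (y t) (S (x t))) as [L1 L2]; auto using osquare_square.
        assert (E : X (x t, S (x t)) = (h (x t), (S' (x t) * h (x t))%C)).
        { apply (X_graph_point (x t)); auto. }
        rewrite E in L1, L2. simpl in L1, L2. rewrite (P t).
        assert (B : Cmod (S' (x t)) <= K').
        { apply (deriv_le_lipschitz S (x t)); auto.
          refine (near_imp _ _ _ _ (near_osquare _ _ _ t3)). intros v hv. apply L'; auto. }
        (* By tangency the second component of X at (x, S x) is S'(x) h(x), so u' splits into two
           increments of X in the second variable, bounded by K |u| and K' K |u|. *)
        replace (snd (X (x t, y t)) - S' (x t) * fst (X (x t, y t)))%C with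
          ((snd (X (x t, y t)) - S' (x t) * h (x t)) -
            S' (x t) * (fst (X (x t, y t)) - h (x t)))%C by ring.
        eapply Rle_trans; [apply Cmod_minus_le|]. rewrite Cmod_mult.
        rewrite Rmult_plus_distr_r. apply Rplus_le_compat; [exact L2|].
        rewrite Rmult_assoc. apply Rmult_le_compat; auto using Cmod_ge_0. }
  refine (near_imp t0 _ _ _ (near_and _ _ _ U N)). intros t [u [[[t1 _] _] _]].
  apply Csub_eq_0 in u. apply graph_iff. split; [exact t1|].
  rewrite (P t). unfold graph_point. simpl. rewrite u. reflexivity.
Qed.

(** The set of times on the graph is open by [graph_locally_invariant]. It is closed even where the
    first coordinate meets a pole, because points of the graph over a neighbourhood of a pole have
    large second coordinate. *)
Lemma graph_invariant phi t0 : entire_solution X phi -> graph s (phi t0) ->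
  forall t, graph s (phi t).
Proof.
  intros H G t. apply (plane_connected (fun t => graph s (phi t))) with t0; auto.
  split.
  - intros u _ Gu. refine (near_imp u _ _ _ (graph_locally_invariant phi u H Gu)). auto.
  - intros u _ Nu.
    set (x := fun t => fst (phi t) : C). set (y := fun t => snd (phi t) : C).
    destruct (entire_solution_parts phi H u) as [dx dy].
    assert (cx : cont x u) by apply (deriv_cont _ _ _ dx).
    assert (cy : cont y u) by apply (deriv_cont _ _ _ dy).
    destruct (classic (D (x u))) as [hD|hD].
    + assert (cd : cont (fun t => y t - S (x t))%C u).
      { apply cont_minus; [exact cy|]. apply (cont_comp S x); [exact cx|apply hol_cont, S_hol, hD]. }
      assert (n : (y u - S (x u))%C <> 0%C).
      { apply Csub_neq_0. intros E. apply Nu, graph_iff. split; [exact hD|].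
        unfold graph_point. fold S. fold (x u). rewrite <- E. apply surjective_pairing. }
      refine (near_imp u _ _ _ (cont_neq _ _ _ cd n)). intros v hv _ Gv. apply hv.
      apply graph_iff in Gv as [_ E]. unfold y, x. rewrite E at 1. simpl. unfold S. ring.
    + apply NNPP in hD.
      (* At a pole, s exceeds |y u| + 1 in modulus nearby while y stays below it. *)
      assert (B := cont_near x u _ cx (pole_blowup s (x u) (Cmod (y u) + 1) (proj1 hs _) hD)).
      refine (near_imp u _ _ _ (near_and _ _ _ B (cont_bounded y u cy))).
      intros v [v1 v2] _ Gv. apply graph_iff in Gv as [g1 g2].
      assert (Ey : y v = coord s (x v)) by (unfold y; rewrite g2; reflexivity).
      rewrite Ey in v2. specialize (v1 g1). unfold x in v1, v2. lra.
Qed.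

Lemma solution_graph_curve phi : entire_solution X phi -> graph s (phi 0%C) ->
  (forall t, graph_curve (fun t => fst (phi t)) t) /\
  (forall t, phi t = graph_point s (fst (phi t))).
Proof.
  intros H G. assert (Gt := graph_invariant phi 0%C H G).
  split; intros t; destruct (proj1 (graph_iff _ _) (Gt t)) as [g1 g2]; [|exact g2].
  split; [exact g1|]. unfold h. rewrite <- g2. apply entire_solution_parts, H.
Qed.

(** h is Lipschitz near its zero x t0, so [gronwall_zero] applies to x - x t0. Consequently a curve
    starting in O never meets a zero of h. *)
Lemma graph_curve_stationary x t0 : (forall t, graph_curve x t) -> h (x t0) = 0%C ->
  forall t, x t = x t0.
Proof.
  intros H E t. apply (plane_connected (fun t => x t = x t0)) with t0; auto.
  assert (cx : forall u, cont x u) by (intros u; apply (deriv_cont _ _ _ (proj2 (H u)))).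
  split.
  - intros u _ Eu. destruct (H u) as [hD _].
    assert (hN : near (x u) (hol h)).
    { refine (near_imp _ _ _ _ (D_near _ hD)). intros z [z1 _]. apply h_hol, z1. }
    destruct (hol_locally_lipschitz h (x u) hN) as (K & r & hK & hr & L).
    assert (U : near u (fun t => (x t - x t0)%C = 0%C)).
    { apply (gronwall_zero (fun t => x t - x t0)%C (fun t => h (x t) - 0)%C u K hK).
      - rewrite Eu. ring.
      - refine (near_imp u _ _ _ (cont_near x u _ (cx u)
          (near_osquare _ _ _ (osquare_center (x u) r hr)))).
        intros v hv. split.
        + apply deriv_minus; [apply H|apply deriv_const].
        + rewrite <- E, <- Eu. apply L; [exact hv|apply osquare_center, hr]. }
    refine (near_imp u _ _ _ U). intros v hv _. apply Csub_eq_0, hv.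
  - intros u _ Nu.
    refine (near_imp u _ _ _ (cont_neq x u (x t0) (cx u) Nu)). auto.
Qed.

Lemma O_open z : O z -> near z O.
Proof.
  intros [hD hz]. refine (near_imp z _ _ _ (near_and _ _ _ (D_near z hD)
    (cont_neq h z _ (hol_cont _ _ (h_hol z hD)) hz))).
  intros w [[w1 _] w2]. split; assumption.
Qed.

Lemma zero_punctured z : D z -> near z (fun w => w <> z -> O w).
Proof.
  intros hD. destruct (classic (h z = 0%C)) as [E|n].
  2: { refine (near_imp z _ _ _ (O_open z (conj hD n))). auto. }
  assert (G : graph s (graph_point s z)) by now apply graph_graph_point.
  assert (Z := proj1 (locally_near2 _ _) (hzeros _ G (proj2 (X_zero_iff z hD) E))).
  refine (near_imp z _ _ _ (near_and _ _ _ (D_near z hD) (near2_curve _ _ (fun z => z) S z Z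
     (cont_id z) (hol_cont _ _ (S_hol z hD)) eq_refl eq_refl))).
  intros w [[w1 _] w2] nw. split; [exact w1|]. intros F. apply nw.
  apply (f_equal fst (w2 (graph_graph_point s w w1) (proj2 (X_zero_iff w w1) F))).
Qed.

(** The poles are removed first: zeros of h are known to be isolated only at points of D, and might
    accumulate at a pole. *)
Lemma O_connected : connected O.
Proof.
  assert (cD : connected D).
  { apply (connected_iff (fun z => True /\ ~ s z = Inf)); [unfold D; tauto|].
    apply connected_remove_discrete; [apply plane_connected|]. intros z _.
    refine (near_imp z _ _ _ (poles_isolated s z hs)). auto. }
  apply (connected_remove_discrete D (fun z => h z = 0%C) cD). intros z hD.
  refine (near_imp z _ _ _ (near_and _ _ _ (D_near z hD) (zero_punctured z hD))).
  intros w [[w1 _] w2]. split; [exact w1|]. intros n. apply (w2 n).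
Qed.

Lemma O_dense z P : near z P -> exists w, O w /\ P w.
Proof.
  intros N.
  destruct (near_exists_neq _ _ (near_and _ _ _ (near_near _ _ N) (poles_isolated s z hs)))
    as (v & nv & v1 & v2).
  destruct (near_exists_neq _ _ (near_and _ _ _ v1 (zero_punctured v (v2 nv))))
    as (w & nw & w1 & w2).
  exists w. auto.
Qed.

Lemma O_unbounded M : exists z, O z /\ M < Cmod z.
Proof.
  apply (O_dense (RtoC (Rabs M + 1))).
  exists 1. split; [lra|]. intros w hw.
  pose proof (Cmod_triangle_rev (RtoC (Rabs M + 1)) w) as T.
  rewrite Cmod_sub_sym, Cmod_R, Rabs_pos_eq in T by (pose proof (Rabs_pos M); lra).
  pose proof (Rle_abs M). lra.
Qed.

Lemma graph_curve_O x : (forall t, graph_curve x t) -> O (x 0%C) -> integral_curve O h x.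
Proof.
  intros H [_ n] t. destruct (H t) as [hD dx]. split; [|exact dx]. split; [exact hD|].
  intros E. apply n. rewrite (graph_curve_stationary x t H E 0%C). exact E.
Qed.

Lemma integral_curves_exist z : O z -> exists x, integral_curve O h x /\ x 0%C = z.
Proof.
  intros hz. destruct (hcomplete (graph_point s z)) as (phi & H & E).
  assert (G : graph s (phi 0%C)) by (rewrite E; apply graph_graph_point, hz).
  exists (fun t => fst (phi t)). destruct (solution_graph_curve phi H G) as [K _].
  assert (x0 : fst (phi 0%C) = z) by now rewrite E. split; [|exact x0].
  apply graph_curve_O; [exact K|]. rewrite x0. exact hz.
Qed.

Lemma isolated_O_unique a b : isolated O a -> isolated O b -> a = b.
Proof.
  destruct (O_unbounded 0) as (z & hz & _).
  destruct (integral_curves_exist z hz) as (x & hx & _).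
  apply (isolated_boundary_unique O h O_open (fun z hz => h_hol z (proj1 hz))
    (fun z hz => proj2 hz) O_connected integral_curves_exist O_unbounded x a b hx).
Qed.

Lemma zero_isolated a : D a -> h a = 0%C -> isolated O a.
Proof. intros hD E. split; [intros [_ n]; auto|apply zero_punctured, hD]. Qed.

(* Zeros of h could a priori accumulate at a pole, but two distinct zeros are already
   isolated boundary points of O. *)
Lemma not_O_isolated a : ~ O a -> isolated O a.
Proof.
  intros na. destruct (classic (D a)) as [hD|hp].
  - apply zero_isolated; [exact hD|]. apply NNPP. intros n. apply na. split; assumption.
  - split; [exact na|]. apply NNPP in hp.
    destruct (classic (exists z, D z /\ h z = 0%C)) as [(z & hz & E)|N].
    + assert (az : a <> z) by (intros ->; now apply hz).
      refine (near_imp a _ _ _ (near_and _ _ _ (poles_isolated s a hs) (near_neq a z az))).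
      intros w [w1 w2] n. split; [apply w1, n|]. intros F. apply w2.
      apply isolated_O_unique; apply zero_isolated; auto. apply w1, n.
    + refine (near_imp a _ _ _ (poles_isolated s a hs)).
      intros w w1 n. split; [apply w1, n|]. intros F. apply N. exists w. split; [apply w1, n|exact F].
Qed.

Lemma not_O_unique a b : ~ O a -> ~ O b -> a = b.
Proof. intros ha hb. apply isolated_O_unique; apply not_O_isolated; assumption. Qed.

(** * Trajectories contained in the graph *)

Lemma trajectory_regular p : graph s p -> O (fst p) ->
  forall q, trajectory X p q <-> (graph s q /\ O (fst q)).
Proof.
  intros Gp hp q. split.
  - intros (phi & t & H & E & Eq).
    assert (G : graph s (phi 0%C)) by (rewrite E; exact Gp).
    destruct (solution_graph_curve phi H G) as [K _].
    split; rewrite <- Eq; [apply (graph_invariant phi 0%C); assumption|].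
    apply (graph_curve_O (fun t => fst (phi t)) K). rewrite E. exact hp.
  - intros [Gq hq]. destruct (hcomplete p) as (phi & H & E).
    assert (G : graph s (phi 0%C)) by (rewrite E; exact Gp).
    destruct (solution_graph_curve phi H G) as [K P].
    assert (hx : integral_curve O h (fun t => fst (phi t))).
    { apply graph_curve_O; [exact K|]. rewrite E. exact hp. }
    destruct (single_orbit O h O_open (fun z hz => h_hol z (proj1 hz)) (fun z hz => proj2 hz)
      O_connected integral_curves_exist _ hx (fst q) hq) as [t Et].
    exists phi, t. split; [exact H|]. split; [exact E|]. 
    rewrite (P t). rewrite (proj2 (proj1 (graph_iff s q) Gq)). exact (f_equal (graph_point s) Et).
Qed.

Lemma trajectory_singular p : graph s p -> ~ O (fst p) ->
  forall q, trajectory X p q -> q = p.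
Proof.
  intros Gp np q (phi & t & H & E & Eq).
  assert (G : graph s (phi 0%C)) by (rewrite E; exact Gp).
  destruct (solution_graph_curve phi H G) as [K P].
  assert (Z : h (fst (phi 0%C)) = 0%C).
  { apply NNPP. intros n. apply np. rewrite <- E. split; [apply K|exact n]. }
  rewrite <- Eq, <- E, (P t), (P 0%C).
  f_equal. apply (graph_curve_stationary (fun t => fst (phi t)) 0%C K Z).
Qed.

Lemma trajectory_refl p : trajectory X p p.
Proof. destruct (hcomplete p) as (phi & H & E). exists phi, 0%C. auto. Qed.

(** By [trajectory_regular] this is the trajectory of each of its points, so no starting point has
    to be chosen. *)
Definition regular_part (q : C2) : Prop := graph s q /\ O (fst q).

Lemma regular_part_point z : O z -> regular_part (graph_point s z).
Proof. intros hz. split; [apply graph_graph_point, hz|exact hz]. Qed.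

Lemma nonconstant_trajectory_regular_part : nonconstant_trajectory X regular_part.
Proof.
  destruct (O_unbounded 0) as (z & hz & _). split.
  - exists (graph_point s z). intros q. symmetry.
    apply trajectory_regular; [apply graph_graph_point, hz|exact hz].
  - destruct (near_exists_neq _ _ (O_open z hz)) as (w & n & hw).
    exists (graph_point s w), (graph_point s z).
    split; [now apply regular_part_point|]. split; [now apply regular_part_point|].
    intros E. apply n, (f_equal fst E).
Qed.

(** A starting point outside O would be a zero of X, whose trajectory is a single point. *)
Lemma nonconstant_trajectory_unique T : nonconstant_trajectory X T ->
  (forall q, T q -> graph s q) -> set_eq T regular_part.
Proof.
  intros [[p hp] (q & q' & Tq & Tq' & n)] sub.
  assert (Gp : graph s p) by apply sub, hp, trajectory_refl.
  assert (Op : O (fst p)).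
  { apply NNPP. intros N. apply n.
    rewrite (trajectory_singular p Gp N q), (trajectory_singular p Gp N q'); [reflexivity|..];
      apply hp; assumption. }
  intros v. rewrite (hp v). apply trajectory_regular; assumption.
Qed.

(** * The type of the trajectory as a Riemann surface *)

Lemma open_translate (Om : C -> Prop) k : (forall z, O z <-> Om (z - k)%C) ->
  open (T := C_UniformSpace) Om.
Proof.
  intros E. enough (N : forall v : C, Om v -> near v Om).
  { intros v hv. apply locally_near, N, hv. }
  intros v hv.
  assert (hO : O (v + k)%C) by (apply E; replace (v + k - k)%C with v by ring; exact hv).
  assert (N := cont_near (fun v => v + k)%C v O (cont_plus _ _ v (cont_id v) (cont_const k v))
    (O_open _ hO)).
  refine (near_imp v _ _ _ N). intros w hw. apply E in hw.
  replace (w + k - k)%C with w in hw by ring. exact hw.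
Qed.

(* The isomorphism is the first coordinate; its inverse is the section z |-> (z, S z),
   read in charts through a local time function. *)
Lemma regular_part_iso (Om : C -> Prop) k : (forall z, O z <-> Om (z - k)%C) ->
  isomorphic (trajectory_atlas X regular_part) (domain_atlas Om).
Proof.
  intros E. exists (fun q => (fst q - k)%C), (fun v => graph_point s (v + k)%C).
  split; [|split; [|split]].
  - intros U phi u (oU & TU & solU & _) hu.
    exists Om, (fun v => v), (fun v => (fst (phi v) - k)%C).
    split; [split; [apply (open_translate Om k E)|auto]|].
    apply locally_near. refine (near_imp u _ _ _ (proj1 (locally_near _ _) (oU u hu))).
    intros v hv. split; [apply E, TU, hv|]. split; [|reflexivity].
    apply ex_derive_hol. apply hol_minus; [|apply hol_const].
    eexists. apply (proj1 (is_derive_C2 _ _ _) (solU v hv)).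
  - intros U phi u [oU hU] hu. destruct (hU u hu) as [Omu _].
    assert (hz : O (u + k)%C) by (apply E; replace (u + k - k)%C with u by ring; exact Omu).
    destruct (integral_curves_exist _ hz) as (x & hx & x0).
    destruct (local_time_exists O h O_open (fun z hz => h_hol z (proj1 hz))
      (fun z hz => proj2 hz) _ hz) as (r & T & LT).
    assert (hr : 0 < r) by apply LT.
    assert (c0 : osquare (u + k)%C r (x 0%C)) by (rewrite x0; apply osquare_center, hr).
    destruct (proj1 (near_iff_osquare _ _)
      (local_time_along O h (fun z hz => proj2 hz) _ _ _ x 0%C LT c0
      (integral_curve_near O h x 0%C hx))) as (d & hd & K).
    assert (inj : forall t t', osquare 0%C d t -> osquare 0%C d t' -> x t = x t' -> t = t').
    { intros t t' ht ht' Et. destruct (K t ht) as [_ k1]. destruct (K t' ht') as [_ k2].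
      rewrite Et, k2 in k1. apply Csub_eq_0.
      transitivity ((T (x 0%C) + (t - 0)) - (T (x 0%C) + (t' - 0)))%C; [ring|].
      rewrite <- k1. ring. }
    (* The chart is the integral curve through u + k, for times so short that T makes it injective;
       the coordinate of v is the time the flow takes from u + k to v + k. *)
    exists (osquare 0%C d), (fun t => graph_point s (x t)), (fun v => (T (v + k) - T (u + k))%C).
    split.
    { split; [|split; [|split]].
      - intros v hv. apply locally_near, near_osquare, hv.
      - intros v _. apply regular_part_point, hx.
      - intros t _. apply graph_curve_solution. destruct (hx t) as [[h1 _] h2]. split; assumption.
      - intros t t' ht ht' F. apply inj; auto. apply (f_equal fst F). }
    apply locally_near.
    assert (ck : cont (fun v => v + k)%C u) by (apply cont_plus; auto using cont_id, cont_const).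
    assert (N1 : near u (fun v => osquare (u + k)%C r (v + k)%C)).
    { apply (cont_near (fun v => v + k)%C u _ ck). apply near_osquare, osquare_center, hr. }
    assert (hT : forall v, osquare (u + k)%C r (v + k)%C -> hol (fun v => T (v + k) - T (u + k))%C v).
    { intros v hv. apply hol_minus; [|apply hol_const].
      apply (hol_comp T (fun v => v + k)%C);
        [apply hol_plus; [apply hol_id|apply hol_const]|].
      eexists. apply LT, hv. }
    assert (N2 : near u (fun v => osquare 0%C d (T (v + k) - T (u + k))%C)).
    { apply (cont_near (fun v => T (v + k) - T (u + k))%C).
      - apply hol_cont, hT, osquare_center, hr.
      - replace (T (u + k) - T (u + k))%C with (RtoC 0) by ring.
        apply near_osquare, osquare_center, hd. }
    refine (near_imp u _ _ _ (near_and _ _ _ (proj1 (locally_near _ _) (oU u hu))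
       (near_and _ _ _ N1 N2))).
    intros v [v1 [v2 v3]]. split; [exact v3|]. split; [apply ex_derive_hol, hT, v2|].
    destruct (hU v v1) as [_ Ev]. rewrite Ev. f_equal.
    destruct (K _ v3) as [k1 k2]. rewrite x0 in k2.
    apply LT; auto. rewrite k2. ring.
  - intros q (U & phi & u & (_ & TU & _) & hu & Eq). destruct (TU u hu) as [Gq _].
    rewrite Eq in Gq. apply graph_iff in Gq as [_ Gq]. rewrite Gq. simpl.
    apply (f_equal (graph_point s)). ring.
  - intros v _. simpl. ring.
Qed.

Lemma pole_not_O a : pole s a -> ~ O a.
Proof. intros ha [n _]. exact (n ha). Qed.

Lemma pole_unique a b : pole s a -> pole s b -> a = b.
Proof. intros ha hb. apply not_O_unique; now apply pole_not_O. Qed.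

(** The point a, pole or zero, is the only one missing from O; translating it to 0 gives the
    punctured plane. *)
Lemma regular_part_type_Cstar a : ~ O a -> type_Cstar X regular_part.
Proof.
  intros ha. apply (regular_part_iso (fun z => z <> 0%C) a). intros z. split.
  - intros hz. apply Csub_neq_0. intros ->. contradiction.
  - intros n. apply NNPP. intros N. apply n.
    rewrite (not_O_unique z a N ha). ring.
Qed.

Lemma regular_part_without_pole : (forall a, ~ pole s a) ->
  (type_C X regular_part /\ set_eq regular_part (graph s)) \/
  (type_Cstar X regular_part /\
   exists p, unique (fun q => graph s q /\ X q = zero) p /\
             set_eq regular_part (fun q => graph s q /\ q <> p)).
Proof.
  intros np. destruct (classic (exists a, ~ O a)) as [[a ha]|N].
  - right. split; [apply (regular_part_type_Cstar a ha)|].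
    assert (Da : D a) by apply np.
    assert (Za : h a = 0%C) by (apply NNPP; intros n; apply ha; split; assumption).
    exists (graph_point s a). split.
    + split.
      * split; [apply graph_graph_point, Da|]. apply X_zero_iff; assumption.
      * intros q [Gq Zq]. apply graph_iff in Gq as [g1 g2]. rewrite g2. f_equal.
        apply not_O_unique; [exact ha|]. intros [_ n]. apply n, X_zero_iff; [exact g1|].
        rewrite <- g2. exact Zq.
    + intros q. split.
      * intros [Gq Oq]. split; [exact Gq|]. intros Eq. apply ha. rewrite Eq in Oq. exact Oq.
      * intros [Gq n]. split; [exact Gq|]. apply NNPP. intros N. apply n.
        apply graph_iff in Gq as [_ g2]. rewrite g2. f_equal. apply not_O_unique; assumption.
  - left. assert (all : forall z, O z).
    { intros z. apply NNPP. intros n. apply N. now exists z. }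
    split.
    + apply (regular_part_iso (fun _ => True) 0%C). intros z. split; auto.
    + intros q. split; [intros [G _]; exact G|intros G; split; [exact G|apply all]].
Qed.

(** The pole already is the one point outside O, so X has no zero on the graph and the trajectory
    fills it. *)
Lemma regular_part_with_pole a : pole s a ->
  set_eq regular_part (graph s) /\ type_Cstar X regular_part.
Proof.
  intros ha. split; [|apply (regular_part_type_Cstar a), pole_not_O, ha].
  intros q. split; [intros [G _]; exact G|]. intros G. split; [exact G|].
  apply NNPP. intros N. apply graph_iff in G as [g _]. apply g.
  rewrite (not_O_unique _ _ N (pole_not_O a ha)). exact ha.
Qed.
End Field.

Theorem lemma1 (s : C -> P1) (hs : meromorphic s)
    (X : C2 -> C2) (hX : holomorphic_field X) (hcomplete : complete_field X)
    (htangent : tangent_to X (graph s))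
    (hzeros : isolated_zeros_on X (graph s)) :
  (forall a b, pole s a -> pole s b -> a = b) /\
  exists Cz : C2 -> Prop,
    nonconstant_trajectory X Cz /\ (forall q, Cz q -> graph s q) /\
    (forall T : C2 -> Prop,
      nonconstant_trajectory X T -> (forall q, T q -> graph s q) ->
      set_eq T Cz) /\
    ((forall a, ~ pole s a) ->
      (type_C X Cz /\ set_eq Cz (graph s)) \/
      (type_Cstar X Cz /\
       exists p, unique (fun q => graph s q /\ X q = zero) p /\
                 set_eq Cz (fun q => graph s q /\ q <> p))) /\
    ((exists! a, pole s a) ->
      set_eq Cz (graph s) /\ type_Cstar X Cz).
Proof.
  split; [now apply (pole_unique s X)|].
  exists (regular_part s X).
  split; [now apply nonconstant_trajectory_regular_part|].
  split; [intros q [G _]; exact G|].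
  split; [now apply nonconstant_trajectory_unique|].
  split; [now apply regular_part_without_pole|].
  intros [a [ha _]]. now apply (regular_part_with_pole s X) with a.
Qed.
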